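(* Let $(\mathbb B,\ltimes,\rtimes)$ be a purely central premonoidal double category such that the 2-cells $-\rtimes u|_U$ are trivial for all vertical 1-cells $U,u$, and let $\mathbb Z_p^{st}(\mathbb B)$ be its pure center. Then the pseudodouble category $\mathbb Z_p^{st}(\mathbb B)$ is monoidal with the monoidal product $\boxtimes_r:\mathbb Z_p^{st}(\mathbb B)\times\mathbb Z_p^{st}(\mathbb B)\to\mathbb Z_p^{st}(\mathbb B)$.
   Context: Double categories are strict: objects, 1h-cells (horizontal), 1v-cells (vertical), squares (2-cells); in a pseudodouble category horizontal composition is associative and unital up to coherent isomorphism. $[a|b]$: horizontal composition ($a$ left); $a/b$: vertical composition ($a$ on top), also for 1v-cells and transformations. Pseudodouble functors preserve vertical structure strictly and horizontal composition up to coherent natural invertible compositors and unitors. A horizontal pseudonatural transformation $\alpha:F\Rightarrow G$ has 1h-components $\alpha(A)$, squares $\alpha^u$ (top $\alpha(A)$, bottom $\alpha(\tilde A)$, left $F(u)$, right $G(u)$) and invertible horizontally globular 2-cells $\alpha(B)F(f)\Rightarrow G(f)\alpha(A)$, coherent and natural. A vertical pseudonatural transformation has 1v-components $\alpha(A)$, squares $\alpha_f$ (top $F(f)$, bottom $G(f)$) and horizontally invertible vertically globular 2-cells between $\alpha(A)/G(u)$ and $F(u)/\alpha(\tilde A)$, coherent and natural; strict if these are identities, and then invertible if all $\alpha_f$ are vertically invertible. Modifications between two horizontal and two vertical transformations are families of squares compatible with all structure cells. Binoidal: pseudodouble functors $A\ltimes-,-\rtimes B:\mathbb B\to\mathbb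 B$ with $A\ltimes B=A\rtimes B=:A\bowtie B$ $(=AB)$. A 1h-cell (1v-cell) $p:A\to A'$ is left central via a horizontal (vertical) pseudonatural $p\ltimes-:A\ltimes-\Rightarrow A'\ltimes-$ with $p\ltimes B=p\rtimes B$; right central via $-\rtimes p:-\rtimes A\Rightarrow-\rtimes A'$ with $B\rtimes p=B\ltimes p$; a 2-cell $a$ is left (right) central if the cells $a\rtimes B$ (resp. $B\ltimes a$) form a modification $a\ltimes-$ (resp. $-\rtimes a$). Inversely central 1v-cell: invertible, it and its inverse left and right central with mutually inverse components at 1h-cells. Purely central: every 1- and 2-cell is equipped with left and right centrality structures such that $K\ltimes-|_k=(-\rtimes k|_K)^{-1}$, $U\ltimes-|_u=(-\rtimes u|_U)^{-1}$, $K\ltimes-|_u=-\rtimes u|_K$, $U\ltimes-|_k=-\rtimes k|_U$ for all 1h-cells $K,k$ and 1v-cells $U,u$. Premonoidal: binoidal with an object $I$ and invertible vertical strict transformations $\lambda:I\ltimes-\Rightarrow\mathrm{Id}$, $\rho:-\rtimes I\Rightarrow\mathrm{Id}$, $\alpha_{-,B,C}:(-\rtimes B)\rtimes C\Rightarrow-\rtimes(B\bowtie C)$, $\alpha_{A,-,C}:(A\ltimes-)\rtimes C\Rightarrow A\ltimes(-\rtimes C)$, $\alpha_{A,B,-}:(A\bowtie B)\ltimes-\Rightarrow A\ltimes(B\ltimes-)$ with inversely central 1v-components, the $\alpha$'s having common 1v-components, satisfying the pentagon $\alpha_{W,X,Y}Z/\alpha_{W,XY,Z}/W\alpha_{X,Y,Z}=\alpha_{WX,Y,Z}/\alpha_{W,X,YZ}$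 in each variable and $\alpha_{W,I,Y}/W\lambda_Y=\rho_WY$, $\alpha_{I,W,Y}/\lambda_{WY}=\lambda_WY$, $\alpha_{W,Y,I}/W\rho_Y=\rho_{WY}$ in each of $W,Y$. For purely central $\mathbb B$ the associativity is moreover compatible with the chosen exchange cells (for 1-cells $p,q$ in two slots of a triple product, pasting the exchange cell of $(XY)Z$ above the $\alpha$-components at $p,q$ equals pasting the $\alpha$-components above the exchange cell of $X(YZ)$). Pure center $\mathbb Z_p^{st}(\mathbb B)$: the pseudodouble category with the objects of $\mathbb B$ and whose 1h-, 1v- and 2-cells are the triples $(b,b\ltimes-,-\rtimes b)$, $b$ a 1h-, 1v- or 2-cell of $\mathbb B$ with its chosen centrality structures (the superscript $st$ records triviality of the cells $-\rtimes u|_U$). $\boxtimes_r$: on objects $A\bowtie B$; on 2-cells, for $\sigma$ (top $K:A\to A'$, bottom $\tilde K:\tilde A\to\tilde A'$, left $U$, right $U'$) and $\delta$ (top $k:B\to B'$, bottom $\tilde k$, left $u:B\to\tilde B$, right $u'$), $\sigma\boxtimes_r\delta=[(\sigma\rtimes B)/(\tilde K\rtimes u)\;|\;(U'\rtimes k)/(\tilde A'\ltimes\delta)]$ where $\tilde K\rtimes u:=-\rtimes u|_{\tilde K}$ and $U'\rtimes k:=-\rtimes k|_{U'}$; so $K\boxtimes_rk=(A'\ltimes k)(K\rtimes B)$ and $U\boxtimes_ru=(U\rtimes B)/(\tilde A\ltimes u)$, with the induced centrality structures; its compositor uses the cells $K'\ltimes-|_k$ and the compositors of $-\rtimes B$,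 $A\ltimes-$. Monoidal (pseudo)double category: a pseudodouble functor $\otimes$ and a unit $I$ with invertible vertical strict associativity and unit transformations satisfying the pentagon and unit triangles strictly. *)

(* Defs.v *)
From Stdlib Require Import ProofIrrelevance.

Set Implicit Arguments.
Unset Strict Implicit.

(** Double categories are strict.  A square [s : sq t b l r] has top [t], bottom
    [b], left [l] and right [r].  Horizontal composition is written in
    diagrammatic order ([f >> g] is the composite usually written [gf]; [a <|> b]
    has [a] on the left) and vertical composition from top to bottom. *)

(** Equality of squares up to equality of their boundaries.  The strict laws for
    1-cells hold only propositionally, so both sides of a law between squares may
    have boundaries that are equal but not convertible. *)
Inductive sqeq (O : Type) (H V : O -> O -> Type)
    (S : forall A B A1 B1 : O, H A B -> H A1 B1 -> V A A1 -> V B B1 -> Type)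
    (A B A1 B1 : O) (t : H A B) (b : H A1 B1) (l : V A A1) (r : V B B1)
    (s : S A B A1 B1 t b l r) :
  forall (t' : H A B) (b' : H A1 B1) (l' : V A A1) (r' : V B B1),
    S A B A1 B1 t' b' l' r' -> Prop :=
| sqeq_refl : sqeq s s.

Record double_cat := DoubleCat {
  ob : Type;
  hom : ob -> ob -> Type;
  ver : ob -> ob -> Type;
  sq : forall A B A1 B1 : ob,
    hom A B -> hom A1 B1 -> ver A A1 -> ver B B1 -> Type;
  hid : forall A, hom A A;
  hcomp : forall A B C, hom A B -> hom B C -> hom A C;
  vid : forall A, ver A A;
  vcomp : forall A B C, ver A B -> ver B C -> ver A C;
  sq_hid : forall A B (u : ver A B), sq (hid A) (hid B) u u;
  sq_vid : forall A B (f : hom A B), sq f f (vid A) (vid B);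
  sq_hcomp : forall A B C A1 B1 C1
    (t : hom A B) (t' : hom B C) (b : hom A1 B1) (b' : hom B1 C1)
    (l : ver A A1) (m : ver B B1) (r : ver C C1),
    sq t b l m -> sq t' b' m r -> sq (hcomp t t') (hcomp b b') l r;
  sq_vcomp : forall A B A1 B1 A2 B2
    (t : hom A B) (m : hom A1 B1) (b : hom A2 B2)
    (l : ver A A1) (l' : ver A1 A2) (r : ver B B1) (r' : ver B1 B2),
    sq t m l r -> sq m b l' r' -> sq t b (vcomp l l') (vcomp r r');
  hassoc : forall A B C E (f : hom A B) (g : hom B C) (h : hom C E),
    hcomp (hcomp f g) h = hcomp f (hcomp g h);
  hid_l : forall A B (f : hom A B), hcomp (hid A) f = f;
  hid_r : forall A B (f : hom A B), hcomp f (hid B) = f;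
  vassoc : forall A B C E (u : ver A B) (v : ver B C) (w : ver C E),
    vcomp (vcomp u v) w = vcomp u (vcomp v w);
  vid_l : forall A B (u : ver A B), vcomp (vid A) u = u;
  vid_r : forall A B (u : ver A B), vcomp u (vid B) = u;
  sq_hassoc : forall A B C E A1 B1 C1 E1
    (t : hom A B) (t' : hom B C) (t'' : hom C E)
    (b : hom A1 B1) (b' : hom B1 C1) (b'' : hom C1 E1)
    (l : ver A A1) (m : ver B B1) (n : ver C C1) (r : ver E E1)
    (x : sq t b l m) (y : sq t' b' m n) (z : sq t'' b'' n r),
    sqeq (S := sq) (sq_hcomp (sq_hcomp x y) z) (sq_hcomp x (sq_hcomp y z));
  sq_hid_l : forall A B A1 B1 (t : hom A B) (b : hom A1 B1)
    (l : ver A A1) (r : ver B B1) (x : sq t b l r),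
    sqeq (S := sq) (sq_hcomp (sq_hid l) x) x;
  sq_hid_r : forall A B A1 B1 (t : hom A B) (b : hom A1 B1)
    (l : ver A A1) (r : ver B B1) (x : sq t b l r),
    sqeq (S := sq) (sq_hcomp x (sq_hid r)) x;
  sq_vassoc : forall A B A1 B1 A2 B2 A3 B3
    (t : hom A B) (m : hom A1 B1) (n : hom A2 B2) (b : hom A3 B3)
    (l : ver A A1) (l' : ver A1 A2) (l'' : ver A2 A3)
    (r : ver B B1) (r' : ver B1 B2) (r'' : ver B2 B3)
    (x : sq t m l r) (y : sq m n l' r') (z : sq n b l'' r''),
    sqeq (S := sq) (sq_vcomp (sq_vcomp x y) z) (sq_vcomp x (sq_vcomp y z));
  sq_vid_l : forall A B A1 B1 (t : hom A B) (b : hom A1 B1)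
    (l : ver A A1) (r : ver B B1) (x : sq t b l r),
    sqeq (S := sq) (sq_vcomp (sq_vid t) x) x;
  sq_vid_r : forall A B A1 B1 (t : hom A B) (b : hom A1 B1)
    (l : ver A A1) (r : ver B B1) (x : sq t b l r),
    sqeq (S := sq) (sq_vcomp x (sq_vid b)) x;
  interchange : forall A B C A1 B1 C1 A2 B2 C2
    (t : hom A B) (t' : hom B C) (m : hom A1 B1) (m' : hom B1 C1)
    (b : hom A2 B2) (b' : hom B2 C2)
    (l : ver A A1) (n : ver B B1) (r : ver C C1)
    (l' : ver A1 A2) (n' : ver B1 B2) (r' : ver C1 C2)
    (x : sq t m l n) (y : sq t' m' n r) (z : sq m b l' n') (w : sq m' b' n' r'),
    sq_vcomp (sq_hcomp x y) (sq_hcomp z w)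
      = sq_hcomp (sq_vcomp x z) (sq_vcomp y w);
  sq_hid_vcomp : forall A B C (u : ver A B) (v : ver B C),
    sq_hid (vcomp u v) = sq_vcomp (sq_hid u) (sq_hid v);
  sq_vid_hcomp : forall A B C (f : hom A B) (g : hom B C),
    sq_vid (hcomp f g) = sq_hcomp (sq_vid f) (sq_vid g);
  sq_hid_vid : forall A, sq_hid (vid A) = sq_vid (hid A)
}.

Arguments hom {d} A B.
Arguments ver {d} A B.
Arguments sq {d} {A B A1 B1} t b l r.
Arguments hid {d} A.
Arguments vid {d} A.

Declare Scope dbl_scope.
Open Scope dbl_scope.
Notation "f >> g" := (hcomp f g) (at level 40, left associativity) : dbl_scope.
Notation "u // v" := (vcomp u v) (at level 40, left associativity) : dbl_scope.
Notation "a <|> b" := (sq_hcomp a b) (at level 43, left associativity) : dbl_scope.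
Notation "a </> b" := (sq_vcomp a b) (at level 45, left associativity) : dbl_scope.
Notation "a ~= b" := (sqeq (S := @sq _) a b) (at level 70) : dbl_scope.

Definition sqcast (D : double_cat) (A B A1 B1 : ob D)
    (t t' : hom A B) (b b' : hom A1 B1) (l l' : ver A A1) (r r' : ver B B1)
    (et : t = t') (eb : b = b') (el : l = l') (er : r = r')
    (s : sq t b l r) : sq t' b' l' r' :=
  match et in _ = t0, eb in _ = b0, el in _ = l0, er in _ = r0
        return sq t0 b0 l0 r0 with
  | eq_refl, eq_refl, eq_refl, eq_refl => s
  end.

Definition vinverse (D : double_cat) (A B A1 B1 : ob D)
    (t : hom A B) (b : hom A1 B1) (l : ver A A1) (r : ver B B1)
    (l' : ver A1 A) (r' : ver B1 B)
    (s : sq t b l r) (s' : sq b t l' r') : Prop :=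
  (s </> s' ~= sq_vid t) /\ (s' </> s ~= sq_vid b).

Definition hinverse (D : double_cat) (A B A1 B1 : ob D)
    (t : hom A B) (b : hom A1 B1) (l : ver A A1) (r : ver B B1)
    (t' : hom B A) (b' : hom B1 A1)
    (s : sq t b l r) (s' : sq t' b' r l) : Prop :=
  (s <|> s' ~= sq_hid l) /\ (s' <|> s ~= sq_hid r).

Definition vinvertible (D : double_cat) (A B A1 B1 : ob D)
    (t : hom A B) (b : hom A1 B1) (l : ver A A1) (r : ver B B1)
    (s : sq t b l r) : Prop :=
  exists (l' : ver A1 A) (r' : ver B1 B) (s' : sq b t l' r'), vinverse s s'.

Definition hinvertible (D : double_cat) (A B A1 B1 : ob D)
    (t : hom A B) (b : hom A1 B1) (l : ver A A1) (r : ver B B1)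
    (s : sq t b l r) : Prop :=
  exists (t' : hom B A) (b' : hom B1 A1) (s' : sq t' b' r l), hinverse s s'.

(** ** Pseudodouble functors

    The object map is a parameter, so that two functors (or two transformations)
    can be required to agree on objects (components) definitionally.  Transformations
    only mention the data of a functor, the laws are in [is_pf]; [pf_vid] is part
    of the data because composing compositors needs it. *)

Record pfdata (C D : double_cat) (F0 : ob C -> ob D) := PFData {
  pf_h : forall A B : ob C, hom A B -> hom (F0 A) (F0 B);
  pf_v : forall A B : ob C, ver A B -> ver (F0 A) (F0 B);
  pf_s : forall (A B A1 B1 : ob C) (t : hom A B) (b : hom A1 B1)
    (l : ver A A1) (r : ver B B1),
    sq t b l r -> sq (pf_h t) (pf_h b) (pf_v l) (pf_v r);
  pf_vid : forall A : ob C, pf_v (vid A) = vid (F0 A);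
  pf_comp : forall (A B E : ob C) (f : hom A B) (g : hom B E),
    sq (pf_h f >> pf_h g) (pf_h (f >> g)) (vid _) (vid _);
  pf_compV : forall (A B E : ob C) (f : hom A B) (g : hom B E),
    sq (pf_h (f >> g)) (pf_h f >> pf_h g) (vid _) (vid _);
  pf_unit : forall A : ob C,
    sq (hid (F0 A)) (pf_h (hid A)) (vid _) (vid _);
  pf_unitV : forall A : ob C,
    sq (pf_h (hid A)) (hid (F0 A)) (vid _) (vid _)
}.

Record is_pf (C D : double_cat) (F0 : ob C -> ob D) (F : pfdata F0) : Prop := IsPF {
  pf_vcomp : forall (A B E : ob C) (u : ver A B) (v : ver B E),
    pf_v F (u // v) = pf_v F u // pf_v F v;
  pf_s_vcomp : forall (A B A1 B1 A2 B2 : ob C)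
    (t : hom A B) (m : hom A1 B1) (b : hom A2 B2)
    (l : ver A A1) (l' : ver A1 A2) (r : ver B B1) (r' : ver B1 B2)
    (x : sq t m l r) (y : sq m b l' r'),
    pf_s F (x </> y) ~= pf_s F x </> pf_s F y;
  pf_s_vid : forall (A B : ob C) (f : hom A B),
    pf_s F (sq_vid f) ~= sq_vid (pf_h F f);
  pf_comp_nat : forall (A B E A1 B1 E1 : ob C)
    (t : hom A B) (t' : hom B E) (b : hom A1 B1) (b' : hom B1 E1)
    (l : ver A A1) (m : ver B B1) (r : ver E E1)
    (x : sq t b l m) (y : sq t' b' m r),
    (pf_s F x <|> pf_s F y) </> pf_comp F b b'
      ~= pf_comp F t t' </> pf_s F (x <|> y);
  pf_unit_nat : forall (A B : ob C) (u : ver A B),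
    sq_hid (pf_v F u) </> pf_unit F B ~= pf_unit F A </> pf_s F (sq_hid u);
  pf_comp_assoc : forall (A B E G : ob C) (f : hom A B) (g : hom B E) (h : hom E G),
    (pf_comp F f g <|> sq_vid (pf_h F h)) </> pf_comp F (f >> g) h
      ~= (sq_vid (pf_h F f) <|> pf_comp F g h) </> pf_comp F f (g >> h);
  pf_unit_l : forall (A B : ob C) (f : hom A B),
    (pf_unit F A <|> sq_vid (pf_h F f)) </> pf_comp F (hid A) f
      ~= sq_vid (pf_h F f);
  pf_unit_r : forall (A B : ob C) (f : hom A B),
    (sq_vid (pf_h F f) <|> pf_unit F B) </> pf_comp F f (hid B)
      ~= sq_vid (pf_h F f);
  pf_comp_inv : forall (A B E : ob C) (f : hom A B) (g : hom B E),
    vinverse (pf_comp F f g) (pf_compV F f g);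
  pf_unit_inv : forall A : ob C, vinverse (pf_unit F A) (pf_unitV F A)
}.

Lemma vid_vid (D : double_cat) (A : ob D) : vid A // vid A = vid A.
Proof. apply vid_l. Qed.

Definition pfid (C : double_cat) : pfdata (fun A : ob C => A) :=
  @PFData C C (fun A => A)
    (fun A B f => f) (fun A B u => u) (fun A B A1 B1 t b l r s => s)
    (fun A => eq_refl)
    (fun A B E f g => sq_vid (f >> g)) (fun A B E f g => sq_vid (f >> g))
    (fun A => sq_vid (hid A)) (fun A => sq_vid (hid A)).

Section Composition.
Variables (C D E : double_cat) (G0 : ob D -> ob E) (F0 : ob C -> ob D).
Variables (G : pfdata G0) (F : pfdata F0).

Lemma pfcomp_vid (A : ob C) : pf_v G (pf_v F (vid A)) = vid (G0 (F0 A)).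
Proof. rewrite (pf_vid F A). apply pf_vid. Qed.

Lemma pfcomp_bd (A : ob C) :
  vid (G0 (F0 A)) // pf_v G (vid (F0 A)) = vid (G0 (F0 A)).
Proof. rewrite pf_vid. apply vid_l. Qed.

Lemma pfcomp_bdV (A : ob C) :
  pf_v G (vid (F0 A)) // vid (G0 (F0 A)) = vid (G0 (F0 A)).
Proof. rewrite pf_vid. apply vid_l. Qed.

Definition pfcomp : pfdata (fun A => G0 (F0 A)) :=
  @PFData C E (fun A => G0 (F0 A))
    (fun A B f => pf_h G (pf_h F f)) (fun A B u => pf_v G (pf_v F u))
    (fun A B A1 B1 t b l r s => pf_s G (pf_s F s))
    pfcomp_vid
    (fun A B K f g => sqcast eq_refl eq_refl (pfcomp_bd A) (pfcomp_bd K)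
      (pf_comp G (pf_h F f) (pf_h F g) </> pf_s G (pf_comp F f g)))
    (fun A B K f g => sqcast eq_refl eq_refl (pfcomp_bdV A) (pfcomp_bdV K)
      (pf_s G (pf_compV F f g) </> pf_compV G (pf_h F f) (pf_h F g)))
    (fun A => sqcast eq_refl eq_refl (pfcomp_bd A) (pfcomp_bd A)
      (pf_unit G (F0 A) </> pf_s G (pf_unit F A)))
    (fun A => sqcast eq_refl eq_refl (pfcomp_bdV A) (pfcomp_bdV A)
      (pf_s G (pf_unitV F A) </> pf_unitV G (F0 A))).
End Composition.

Definition pfconst (C D : double_cat) (X : ob D) : pfdata (fun _ : ob C => X) :=
  @PFData C D (fun _ => X)
    (fun A B f => hid X) (fun A B u => vid X)
    (fun A B A1 B1 t b l r s => sq_vid (hid X))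
    (fun A => eq_refl)
    (fun A B E f g =>
       sqcast (eq_sym (hid_l (hid X))) eq_refl eq_refl eq_refl (sq_vid (hid X)))
    (fun A B E f g =>
       sqcast eq_refl (eq_sym (hid_l (hid X))) eq_refl eq_refl (sq_vid (hid X)))
    (fun A => sq_vid (hid X)) (fun A => sq_vid (hid X)).

(** ** Horizontal and vertical pseudonatural transformations *)

Record htrans (C D : double_cat) (F0 G0 : ob C -> ob D)
    (F : pfdata F0) (G : pfdata G0) (c : forall A, hom (F0 A) (G0 A)) := HTrans {
  ht_sq : forall (A A1 : ob C) (u : ver A A1),
    sq (c A) (c A1) (pf_v F u) (pf_v G u);
  ht_gl : forall (A B : ob C) (f : hom A B),
    sq (pf_h F f >> c B) (c A >> pf_h G f) (vid _) (vid _);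
  ht_gl_inv : forall (A B : ob C) (f : hom A B), vinvertible (ht_gl f);
  ht_sq_vid : forall A : ob C, ht_sq (vid A) ~= sq_vid (c A);
  ht_sq_vcomp : forall (A A1 A2 : ob C) (u : ver A A1) (v : ver A1 A2),
    ht_sq (u // v) ~= ht_sq u </> ht_sq v;
  ht_nat : forall (A B A1 B1 : ob C) (t : hom A B) (b : hom A1 B1)
    (l : ver A A1) (r : ver B B1) (x : sq t b l r),
    (pf_s F x <|> ht_sq r) </> ht_gl b ~= ht_gl t </> (ht_sq l <|> pf_s G x);
  ht_gl_comp : forall (A B E : ob C) (f : hom A B) (g : hom B E),
    (pf_comp F f g <|> sq_vid (c E)) </> ht_gl (f >> g)
      ~= (sq_vid (pf_h F f) <|> ht_gl g)
         </> sqcast (hassoc _ _ _) (hassoc _ _ _) eq_refl eq_refl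
               (ht_gl f <|> sq_vid (pf_h G g))
         </> (sq_vid (c A) <|> pf_comp G f g);
  ht_gl_hid : forall A : ob C,
    (pf_unit F A <|> sq_vid (c A)) </> ht_gl (hid A)
      ~= sq_vid (c A) <|> pf_unit G A
}.

Record vtrans (C D : double_cat) (F0 G0 : ob C -> ob D)
    (F : pfdata F0) (G : pfdata G0) (c : forall A, ver (F0 A) (G0 A)) := VTrans {
  vt_sq : forall (A B : ob C) (f : hom A B),
    sq (pf_h F f) (pf_h G f) (c A) (c B);
  vt_gl : forall (A A1 : ob C) (u : ver A A1),
    sq (hid _) (hid _) (c A // pf_v G u) (pf_v F u // c A1);
  vt_gl_inv : forall (A A1 : ob C) (u : ver A A1), hinvertible (vt_gl u);
  vt_sq_hid : forall A : ob C,
    sq_hid (c A) </> pf_unit G A ~= pf_unit F A </> vt_sq (hid A);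
  vt_sq_hcomp : forall (A B E : ob C) (f : hom A B) (g : hom B E),
    (vt_sq f <|> vt_sq g) </> pf_comp G f g ~= pf_comp F f g </> vt_sq (f >> g);
  vt_nat : forall (A B A1 B1 : ob C) (t : hom A B) (b : hom A1 B1)
    (l : ver A A1) (r : ver B B1) (x : sq t b l r),
    (vt_sq t </> pf_s G x) <|> vt_gl r ~= vt_gl l <|> (pf_s F x </> vt_sq b);
  vt_gl_comp : forall (A A1 A2 : ob C) (u : ver A A1) (v : ver A1 A2),
    vt_gl (u // v)
      ~= sqcast eq_refl eq_refl (vassoc _ _ _) (vassoc _ _ _)
           (vt_gl u </> sq_hid (pf_v G v))
         <|> (sq_hid (pf_v F u) </> vt_gl v);
  vt_gl_vid : forall A : ob C, vt_gl (vid A) ~= sq_hid (c A)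
}.

Definition vt_strict (C D : double_cat) (F0 G0 : ob C -> ob D)
    (F : pfdata F0) (G : pfdata G0) (c : forall A, ver (F0 A) (G0 A))
    (a : vtrans F G c) : Prop :=
  forall (A A1 : ob C) (u : ver A A1), vt_gl a u ~= sq_hid (c A // pf_v G u).

Record isvtrans (C D : double_cat) (F0 G0 : ob C -> ob D)
    (F : pfdata F0) (G : pfdata G0) (c : forall A, ver (F0 A) (G0 A)) := ISVTrans {
  isv_trans :> vtrans F G c;
  isv_strict : vt_strict isv_trans;
  isv_inv : forall (A B : ob C) (f : hom A B), vinvertible (vt_sq isv_trans f)
}.

Definition vtrans_eq (C D : double_cat) (F0 G0 : ob C -> ob D)
    (F : pfdata F0) (G : pfdata G0) (c : forall A, ver (F0 A) (G0 A))
    (a a' : vtrans F G c) : Prop :=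
  (forall (A B : ob C) (f : hom A B), vt_sq a f = vt_sq a' f) /\
  (forall (A A1 : ob C) (u : ver A A1), vt_gl a u = vt_gl a' u).

(** Modifications with horizontal transformations [p : F => G], [q : F' => G']
    on top and bottom, vertical ones [a : F => F'], [b : G => G'] on the left and
    right. *)
Record modification (C D : double_cat) (F0 G0 F0' G0' : ob C -> ob D)
    (F : pfdata F0) (G : pfdata G0) (F' : pfdata F0') (G' : pfdata G0')
    (cp : forall A, hom (F0 A) (G0 A)) (cq : forall A, hom (F0' A) (G0' A))
    (ca : forall A, ver (F0 A) (F0' A)) (cb : forall A, ver (G0 A) (G0' A))
    (p : htrans F G cp) (q : htrans F' G' cq)
    (a : vtrans F F' ca) (b : vtrans G G' cb)
    (m : forall A : ob C, sq (cp A) (cq A) (ca A) (cb A)) : Prop := Modification {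
  mod_h : forall (A B : ob C) (f : hom A B),
    (vt_sq a f <|> m B) </> ht_gl q f ~= ht_gl p f </> (m A <|> vt_sq b f);
  mod_v : forall (A A1 : ob C) (u : ver A A1),
    (m A </> ht_sq q u) <|> vt_gl b u ~= vt_gl a u <|> (ht_sq p u </> m A1)
}.

(** ** Binoidal structures and centrality *)

Record binoidal (D : double_cat) := Binoidal {
  bow : ob D -> ob D -> ob D;
  lt : forall A : ob D, pfdata (bow A);
  rt : forall B : ob D, pfdata (fun A => bow A B);
  lt_pf : forall A, is_pf (lt A);
  rt_pf : forall B, is_pf (rt B)
}.

Section Centrality.
Variables (D : double_cat) (b : binoidal D).

Definition left_central_h (A A' : ob D) (K : hom A A') : Type :=
  htrans (lt b A) (lt b A') (fun X => pf_h (rt b X) K).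
Definition right_central_h (A A' : ob D) (K : hom A A') : Type :=
  htrans (rt b A) (rt b A') (fun X => pf_h (lt b X) K).
Definition left_central_v (A A' : ob D) (U : ver A A') : Type :=
  vtrans (lt b A) (lt b A') (fun X => pf_v (rt b X) U).
Definition right_central_v (A A' : ob D) (U : ver A A') : Type :=
  vtrans (rt b A) (rt b A') (fun X => pf_v (lt b X) U).

Definition left_central_sq (A A' C C' : ob D) (K : hom A A') (L : hom C C')
    (U : ver A C) (U' : ver A' C')
    (lK : left_central_h K) (lL : left_central_h L)
    (lU : left_central_v U) (lU' : left_central_v U') (s : sq K L U U') : Prop :=
  modification lK lL lU lU' (fun X => pf_s (rt b X) s).
Definition right_central_sq (A A' C C' : ob D) (K : hom A A') (L : hom C C')
    (U : ver A C) (U' : ver A' C')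
    (rK : right_central_h K) (rL : right_central_h L)
    (rU : right_central_v U) (rU' : right_central_v U') (s : sq K L U U') : Prop :=
  modification rK rL rU rU' (fun X => pf_s (lt b X) s).

Record inversely_central (A C : ob D) (U : ver A C) := InvCentral {
  ic_inv : ver C A;
  ic_invr : U // ic_inv = vid A;
  ic_invl : ic_inv // U = vid C;
  ic_left : left_central_v U;
  ic_right : right_central_v U;
  ic_leftV : left_central_v ic_inv;
  ic_rightV : right_central_v ic_inv;
  ic_left_inv : forall (X Y : ob D) (k : hom X Y),
    vinverse (vt_sq ic_left k) (vt_sq ic_leftV k);
  ic_right_inv : forall (X Y : ob D) (k : hom X Y),
    vinverse (vt_sq ic_right k) (vt_sq ic_rightV k)
}.

Record purely_central := PurelyCentral {
  lH : forall (A A' : ob D) (K : hom A A'), left_central_h K;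
  rH : forall (A A' : ob D) (K : hom A A'), right_central_h K;
  lV : forall (A A' : ob D) (U : ver A A'), left_central_v U;
  rV : forall (A A' : ob D) (U : ver A A'), right_central_v U;
  lS : forall (A A' C C' : ob D) (K : hom A A') (L : hom C C')
    (U : ver A C) (U' : ver A' C') (s : sq K L U U'),
    left_central_sq (lH K) (lH L) (lV U) (lV U') s;
  rS : forall (A A' C C' : ob D) (K : hom A A') (L : hom C C')
    (U : ver A C) (U' : ver A' C') (s : sq K L U U'),
    right_central_sq (rH K) (rH L) (rV U) (rV U') s;
  exch_hh : forall (A A' B B' : ob D) (K : hom A A') (k : hom B B'),
    vinverse (ht_gl (lH K) k) (ht_gl (rH k) K);
  exch_vv : forall (A A1 B B1 : ob D) (U : ver A A1) (u : ver B B1),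
    hinverse (vt_gl (lV U) u) (vt_gl (rV u) U);
  exch_hv : forall (A A' B B1 : ob D) (K : hom A A') (u : ver B B1),
    ht_sq (lH K) u = vt_sq (rV u) K;
  exch_vh : forall (A A1 B B' : ob D) (U : ver A A1) (k : hom B B'),
    vt_sq (lV U) k = ht_sq (rH k) U
}.
End Centrality.

(** ** Premonoidal double categories

    Each coherence equation is stated at the objects and, for every slot, at the
    1h-cells in that slot.  When the varying slot is the one whiskered with a
    structure 1v-cell, the component is supplied by the centrality structure of
    that 1v-cell, e.g. [vt_sq (ic_right (al_ic X Y Z)) f] for the component of
    [W al_{X,Y,Z}] at a 1h-cell [f] in the slot of [W].  The components at
    1v-cells of all other transformations involved are identities, so there the
    equations say that those of these centrality structures are trivial
    ([la_ic_triv], [ra_ic_triv], [al_ic_triv]). *)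

Record premonoidal (D : double_cat) := Premonoidal {
  pm_b :> binoidal D;
  pm_I : ob D;
  la : forall A, ver (bow pm_b pm_I A) A;
  ra : forall A, ver (bow pm_b A pm_I) A;
  al : forall A B C,
    ver (bow pm_b (bow pm_b A B) C) (bow pm_b A (bow pm_b B C));
  lam : isvtrans (lt pm_b pm_I) (pfid D) la;
  rho : isvtrans (rt pm_b pm_I) (pfid D) ra;
  al1 : forall B C, isvtrans (pfcomp (rt pm_b C) (rt pm_b B))
    (rt pm_b (bow pm_b B C)) (fun A => al A B C);
  al2 : forall A C, isvtrans (pfcomp (rt pm_b C) (lt pm_b A))
    (pfcomp (lt pm_b A) (rt pm_b C)) (fun B => al A B C);
  al3 : forall A B, isvtrans (lt pm_b (bow pm_b A B))
    (pfcomp (lt pm_b A) (lt pm_b B)) (fun C => al A B C);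
  la_ic : forall A, inversely_central pm_b (la A);
  ra_ic : forall A, inversely_central pm_b (ra A);
  al_ic : forall A B C, inversely_central pm_b (al A B C);
  la_ic_triv : forall A,
    vt_strict (ic_left (la_ic A)) /\ vt_strict (ic_right (la_ic A));
  ra_ic_triv : forall A,
    vt_strict (ic_left (ra_ic A)) /\ vt_strict (ic_right (ra_ic A));
  al_ic_triv : forall A B C,
    vt_strict (ic_left (al_ic A B C)) /\ vt_strict (ic_right (al_ic A B C));
  pentagon : forall W X Y Z,
    pf_v (rt pm_b Z) (al W X Y) // al W (bow pm_b X Y) Z
        // pf_v (lt pm_b W) (al X Y Z)
      = al (bow pm_b W X) Y Z // al W X (bow pm_b Y Z);
  pentagon1 : forall W W' (f : hom W W') X Y Z,
    pf_s (rt pm_b Z) (vt_sq (al1 X Y) f) </> vt_sq (al1 (bow pm_b X Y) Z) f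
        </> vt_sq (ic_right (al_ic X Y Z)) f
      ~= vt_sq (al1 Y Z) (pf_h (rt pm_b X) f) </> vt_sq (al1 X (bow pm_b Y Z)) f;
  pentagon2 : forall W X X' (f : hom X X') Y Z,
    pf_s (rt pm_b Z) (vt_sq (al2 W Y) f)
        </> vt_sq (al2 W Z) (pf_h (rt pm_b Y) f)
        </> pf_s (lt pm_b W) (vt_sq (al1 Y Z) f)
      ~= vt_sq (al1 Y Z) (pf_h (lt pm_b W) f) </> vt_sq (al2 W (bow pm_b Y Z)) f;
  pentagon3 : forall W X Y Y' (f : hom Y Y') Z,
    pf_s (rt pm_b Z) (vt_sq (al3 W X) f)
        </> vt_sq (al2 W Z) (pf_h (lt pm_b X) f)
        </> pf_s (lt pm_b W) (vt_sq (al2 X Z) f)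
      ~= vt_sq (al2 (bow pm_b W X) Z) f </> vt_sq (al3 W X) (pf_h (rt pm_b Z) f);
  pentagon4 : forall W X Y Z Z' (f : hom Z Z'),
    vt_sq (ic_left (al_ic W X Y)) f </> vt_sq (al3 W (bow pm_b X Y)) f
        </> pf_s (lt pm_b W) (vt_sq (al3 X Y) f)
      ~= vt_sq (al3 (bow pm_b W X) Y) f </> vt_sq (al3 W X) (pf_h (lt pm_b Y) f);
  unit_m : forall W Y,
    al W pm_I Y // pf_v (lt pm_b W) (la Y) = pf_v (rt pm_b Y) (ra W);
  unit_m1 : forall W W' (f : hom W W') Y,
    vt_sq (al1 pm_I Y) f </> vt_sq (ic_right (la_ic Y)) f
      ~= pf_s (rt pm_b Y) (vt_sq rho f);
  unit_m2 : forall W Y Y' (f : hom Y Y'),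
    vt_sq (al3 W pm_I) f </> pf_s (lt pm_b W) (vt_sq lam f)
      ~= vt_sq (ic_left (ra_ic W)) f;
  unit_l : forall W Y,
    al pm_I W Y // la (bow pm_b W Y) = pf_v (rt pm_b Y) (la W);
  unit_l1 : forall W W' (f : hom W W') Y,
    vt_sq (al2 pm_I Y) f </> vt_sq lam (pf_h (rt pm_b Y) f)
      ~= pf_s (rt pm_b Y) (vt_sq lam f);
  unit_l2 : forall W Y Y' (f : hom Y Y'),
    vt_sq (al3 pm_I W) f </> vt_sq lam (pf_h (lt pm_b W) f)
      ~= vt_sq (ic_left (la_ic W)) f;
  unit_r : forall W Y,
    al W Y pm_I // pf_v (lt pm_b W) (ra Y) = ra (bow pm_b W Y);
  unit_r1 : forall W W' (f : hom W W') Y,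
    vt_sq (al1 Y pm_I) f </> vt_sq (ic_right (ra_ic Y)) f
      ~= vt_sq rho (pf_h (rt pm_b Y) f);
  unit_r2 : forall W Y Y' (f : hom Y Y'),
    vt_sq (al2 W pm_I) f </> pf_s (lt pm_b W) (vt_sq rho f)
      ~= vt_sq rho (pf_h (lt pm_b W) f)
}.

(** The image of a globular square under a pseudodouble functor, made globular
    again with the compositors, respectively the unitors. *)
Definition img_h (C D : double_cat) (F0 : ob C -> ob D) (F : pfdata F0)
    (A B B' E : ob C) (f : hom A B) (g : hom B E) (f' : hom A B') (g' : hom B' E)
    (s : sq (f >> g) (f' >> g') (vid A) (vid E)) :=
  pf_comp F f g </> pf_s F s </> pf_compV F f' g'.

Definition img_v (C D : double_cat) (F0 : ob C -> ob D) (F : pfdata F0)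
    (A A1 : ob C) (u v : ver A A1) (s : sq (hid A) (hid A1) u v) :=
  pf_unit F A </> pf_s F s </> pf_unitV F A1.

Definition ic_agrees (D : double_cat) (b : binoidal D) (pc : purely_central b)
    (A C : ob D) (U : ver A C) (i : inversely_central b U) : Prop :=
  vtrans_eq (lV pc U) (ic_left i) /\ vtrans_eq (rV pc U) (ic_right i) /\
  vtrans_eq (lV pc (ic_inv i)) (ic_leftV i) /\
  vtrans_eq (rV pc (ic_inv i)) (ic_rightV i).

(** In [assoc_ij_pq], [p] and [q] are the kinds (h or v) of the 1-cells in the
    slots [i < j] of a triple product.  The associativity being strict, its
    components at 1v-cells are identities. *)
Record pc_premonoidal (D : double_cat) := PCPremonoidal {
  pcp_pm :> premonoidal D;
  pcp_pc :> purely_central pcp_pm;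
  la_agrees : forall A, ic_agrees pcp_pc (la_ic pcp_pm A);
  ra_agrees : forall A, ic_agrees pcp_pc (ra_ic pcp_pm A);
  al_agrees : forall A B C, ic_agrees pcp_pc (al_ic pcp_pm A B C);
  assoc_12_hh : forall X X' (K : hom X X') Y Y' (k : hom Y Y') Z,
    img_h (rt pcp_pm Z) (ht_gl (lH pcp_pc K) k)
        </> (vt_sq (al1 pcp_pm Y Z) K <|> vt_sq (al2 pcp_pm X' Z) k)
      ~= (vt_sq (al2 pcp_pm X Z) k <|> vt_sq (al1 pcp_pm Y' Z) K)
         </> ht_gl (lH pcp_pc K) (pf_h (rt pcp_pm Z) k);
  assoc_12_hv : forall X X' (K : hom X X') Y Y1 (u : ver Y Y1) Z,
    pf_s (rt pcp_pm Z) (ht_sq (lH pcp_pc K) u) </> vt_sq (al1 pcp_pm Y1 Z) K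
      ~= vt_sq (al1 pcp_pm Y Z) K </> ht_sq (lH pcp_pc K) (pf_v (rt pcp_pm Z) u);
  assoc_12_vh : forall X X1 (U : ver X X1) Y Y' (k : hom Y Y') Z,
    pf_s (rt pcp_pm Z) (vt_sq (lV pcp_pc U) k) </> vt_sq (al2 pcp_pm X1 Z) k
      ~= vt_sq (al2 pcp_pm X Z) k </> vt_sq (lV pcp_pc U) (pf_h (rt pcp_pm Z) k);
  assoc_12_vv : forall X X1 (U : ver X X1) Y Y1 (u : ver Y Y1) Z,
    img_v (rt pcp_pm Z) (vt_gl (lV pcp_pc U) u) </> sq_hid (al pcp_pm X1 Y1 Z)
      ~= sq_hid (al pcp_pm X Y Z) </> vt_gl (lV pcp_pc U) (pf_v (rt pcp_pm Z) u);
  assoc_13_hh : forall X X' (K : hom X X') Y Z Z' (k : hom Z Z'),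
    ht_gl (lH pcp_pc (pf_h (rt pcp_pm Y) K)) k
        </> (vt_sq (al1 pcp_pm Y Z) K <|> vt_sq (al3 pcp_pm X' Y) k)
      ~= (vt_sq (al3 pcp_pm X Y) k <|> vt_sq (al1 pcp_pm Y Z') K)
         </> ht_gl (lH pcp_pc K) (pf_h (lt pcp_pm Y) k);
  assoc_13_hv : forall X X' (K : hom X X') Y Z Z1 (u : ver Z Z1),
    ht_sq (lH pcp_pc (pf_h (rt pcp_pm Y) K)) u </> vt_sq (al1 pcp_pm Y Z1) K
      ~= vt_sq (al1 pcp_pm Y Z) K </> ht_sq (lH pcp_pc K) (pf_v (lt pcp_pm Y) u);
  assoc_13_vh : forall X X1 (U : ver X X1) Y Z Z' (k : hom Z Z'),
    vt_sq (lV pcp_pc (pf_v (rt pcp_pm Y) U)) k </> vt_sq (al3 pcp_pm X1 Y) k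
      ~= vt_sq (al3 pcp_pm X Y) k </> vt_sq (lV pcp_pc U) (pf_h (lt pcp_pm Y) k);
  assoc_13_vv : forall X X1 (U : ver X X1) Y Z Z1 (u : ver Z Z1),
    vt_gl (lV pcp_pc (pf_v (rt pcp_pm Y) U)) u </> sq_hid (al pcp_pm X1 Y Z1)
      ~= sq_hid (al pcp_pm X Y Z) </> vt_gl (lV pcp_pc U) (pf_v (lt pcp_pm Y) u);
  assoc_23_hh : forall X Y Y' (K : hom Y Y') Z Z' (k : hom Z Z'),
    ht_gl (lH pcp_pc (pf_h (lt pcp_pm X) K)) k
        </> (vt_sq (al2 pcp_pm X Z) K <|> vt_sq (al3 pcp_pm X Y') k)
      ~= (vt_sq (al3 pcp_pm X Y) k <|> vt_sq (al2 pcp_pm X Z') K)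
         </> img_h (lt pcp_pm X) (ht_gl (lH pcp_pc K) k);
  assoc_23_hv : forall X Y Y' (K : hom Y Y') Z Z1 (u : ver Z Z1),
    ht_sq (lH pcp_pc (pf_h (lt pcp_pm X) K)) u </> vt_sq (al2 pcp_pm X Z1) K
      ~= vt_sq (al2 pcp_pm X Z) K </> pf_s (lt pcp_pm X) (ht_sq (lH pcp_pc K) u);
  assoc_23_vh : forall X Y Y1 (U : ver Y Y1) Z Z' (k : hom Z Z'),
    vt_sq (lV pcp_pc (pf_v (lt pcp_pm X) U)) k </> vt_sq (al3 pcp_pm X Y1) k
      ~= vt_sq (al3 pcp_pm X Y) k </> pf_s (lt pcp_pm X) (vt_sq (lV pcp_pc U) k);
  assoc_23_vv : forall X Y Y1 (U : ver Y Y1) Z Z1 (u : ver Z Z1),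
    vt_gl (lV pcp_pc (pf_v (lt pcp_pm X) U)) u </> sq_hid (al pcp_pm X Y1 Z1)
      ~= sq_hid (al pcp_pm X Y Z) </> img_v (lt pcp_pm X) (vt_gl (lV pcp_pc U) u)
}.

Definition trivial_vv (D : double_cat) (P : pc_premonoidal D) : Prop :=
  forall (B B1 : ob D) (u : ver B B1), vt_strict (rV P u).

(** ** The pure center

    The cells are triples [(b, left structure, right structure)] in which the
    structures are the chosen ones; for squares both structures are properties.
    A composite carries the chosen structures of the composite cell; up to the
    compositors these are the composites of the structures of the factors, by the
    exchange equations in [purely_central] and the composition laws of [htrans]
    and [vtrans].  Horizontal composition is strict because it is so in [D]. *)

Section PureCenter.
Variables (D : double_cat) (P : pc_premonoidal D).

Record zhom (A A' : ob D) := ZHom {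
  zh : hom A A';
  zh_left : left_central_h P zh;
  zh_right : right_central_h P zh;
  zh_left_chosen : lH P zh = zh_left;
  zh_right_chosen : rH P zh = zh_right
}.

Record zver (A A' : ob D) := ZVer {
  zv : ver A A';
  zv_left : left_central_v P zv;
  zv_right : right_central_v P zv;
  zv_left_chosen : lV P zv = zv_left;
  zv_right_chosen : rV P zv = zv_right
}.

Record zsq (A B A1 B1 : ob D) (t : zhom A B) (b : zhom A1 B1)
    (l : zver A A1) (r : zver B B1) := ZSq {
  zs : sq (zh t) (zh b) (zv l) (zv r);
  zs_left : left_central_sq (zh_left t) (zh_left b) (zv_left l) (zv_left r) zs;
  zs_right : right_central_sq (zh_right t) (zh_right b) (zv_right l) (zv_right r) zs
}.

Definition mkzh (A B : ob D) (f : hom A B) : zhom A B :=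
  @ZHom A B f (lH P f) (rH P f) eq_refl eq_refl.
Definition mkzv (A B : ob D) (u : ver A B) : zver A B :=
  @ZVer A B u (lV P u) (rV P u) eq_refl eq_refl.

Lemma zh_mk (A B : ob D) (f : zhom A B) : mkzh (zh f) = f.
Proof. destruct f as [f l r el er]; simpl. destruct el, er. reflexivity. Qed.
Lemma zv_mk (A B : ob D) (u : zver A B) : mkzv (zv u) = u.
Proof. destruct u as [u l r el er]; simpl. destruct el, er. reflexivity. Qed.

Lemma mkzs_left (A B A1 B1 : ob D) (t : zhom A B) (b : zhom A1 B1)
    (l : zver A A1) (r : zver B B1) (s : sq (zh t) (zh b) (zv l) (zv r)) :
  left_central_sq (zh_left t) (zh_left b) (zv_left l) (zv_left r) s.
Proof.
destruct t as [t lt rt [] []], b as [b lb rb [] []].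
destruct l as [l ll rl [] []], r as [r lr rr [] []]. apply lS.
Qed.
Lemma mkzs_right (A B A1 B1 : ob D) (t : zhom A B) (b : zhom A1 B1)
    (l : zver A A1) (r : zver B B1) (s : sq (zh t) (zh b) (zv l) (zv r)) :
  right_central_sq (zh_right t) (zh_right b) (zv_right l) (zv_right r) s.
Proof.
destruct t as [t lt rt [] []], b as [b lb rb [] []].
destruct l as [l ll rl [] []], r as [r lr rr [] []]. apply rS.
Qed.

Definition mkzs (A B A1 B1 : ob D) (t : zhom A B) (b : zhom A1 B1)
    (l : zver A A1) (r : zver B B1) (s : sq (zh t) (zh b) (zv l) (zv r)) :
    zsq t b l r := ZSq (mkzs_left s) (mkzs_right s).

Lemma zs_inj (A B A1 B1 : ob D) (t : zhom A B) (b : zhom A1 B1)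
    (l : zver A A1) (r : zver B B1) (s s' : zsq t b l r) : zs s = zs s' -> s = s'.
Proof.
destruct s as [s p q], s' as [s' p' q']; simpl; intro e; subst s'.
f_equal; apply proof_irrelevance.
Qed.

Lemma zsqeq (A B A1 B1 : ob D) (t t' : zhom A B) (b b' : zhom A1 B1)
    (l l' : zver A A1) (r r' : zver B B1) (s : zsq t b l r) (s' : zsq t' b' l' r') :
  zs s ~= zs s' -> sqeq (S := zsq) s s'.
Proof.
destruct t as [t lt rt [] []], b as [b lb rb [] []].
destruct l as [l ll rl [] []], r as [r lr rr [] []].
destruct t' as [t' lt' rt' [] []], b' as [b' lb' rb' [] []].
destruct l' as [l' ll' rl' [] []], r' as [r' lr' rr' [] []].
destruct s as [s p q], s' as [s' p' q']; simpl in *; intro e.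
destruct e.
rewrite (proof_irrelevance _ p' p), (proof_irrelevance _ q' q).
apply sqeq_refl.
Qed.

Definition pure_center : double_cat.
Proof.
refine (@DoubleCat (ob D) zhom zver zsq
  (fun A => mkzh (hid A)) (fun A B C f g => mkzh (zh f >> zh g))
  (fun A => mkzv (vid A)) (fun A B C u v => mkzv (zv u // zv v))
  (fun A B u =>
     mkzs (t := mkzh (hid A)) (b := mkzh (hid B)) (l := u) (r := u)
       (sq_hid (zv u)))
  (fun A B f =>
     mkzs (t := f) (b := f) (l := mkzv (vid A)) (r := mkzv (vid B))
       (sq_vid (zh f)))
  (fun A B C A1 B1 C1 t t' b b' l m r x y =>
     mkzs (t := mkzh (zh t >> zh t')) (b := mkzh (zh b >> zh b')) (l := l) (r := r)
       (zs x <|> zs y))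
  (fun A B A1 B1 A2 B2 t m b l l' r r' x y =>
     mkzs (t := t) (b := b) (l := mkzv (zv l // zv l')) (r := mkzv (zv r // zv r'))
       (zs x </> zs y))
  _ _ _ _ _ _ _ _ _ _ _ _ _ _ _ _).
- intros; simpl; now rewrite hassoc.
- intros; simpl; rewrite hid_l; apply zh_mk.
- intros; simpl; rewrite hid_r; apply zh_mk.
- intros; simpl; now rewrite vassoc.
- intros; simpl; rewrite vid_l; apply zv_mk.
- intros; simpl; rewrite vid_r; apply zv_mk.
- intros; apply zsqeq; simpl; apply sq_hassoc.
- intros; apply zsqeq; simpl; apply sq_hid_l.
- intros; apply zsqeq; simpl; apply sq_hid_r.
- intros; apply zsqeq; simpl; apply sq_vassoc.
- intros; apply zsqeq; simpl; apply sq_vid_l.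
- intros; apply zsqeq; simpl; apply sq_vid_r.
- intros; apply zs_inj; simpl; apply interchange.
- intros; apply zs_inj; simpl; apply sq_hid_vcomp.
- intros; apply zs_inj; simpl; apply sq_vid_hcomp.
- intros; apply zs_inj; simpl; apply sq_hid_vid.
Defined.

End PureCenter.

(** ** Products of double categories *)

Section Product.
Variables C D : double_cat.

Let psq (A B A1 B1 : ob C * ob D)
    (t : hom (fst A) (fst B) * hom (snd A) (snd B))
    (b : hom (fst A1) (fst B1) * hom (snd A1) (snd B1))
    (l : ver (fst A) (fst A1) * ver (snd A) (snd A1))
    (r : ver (fst B) (fst B1) * ver (snd B) (snd B1)) : Type :=
  (sq (fst t) (fst b) (fst l) (fst r) * sq (snd t) (snd b) (snd l) (snd r))%type.

Lemma psqeq (A B A1 B1 : ob C * ob D)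
    (t t' : hom (fst A) (fst B) * hom (snd A) (snd B))
    (b b' : hom (fst A1) (fst B1) * hom (snd A1) (snd B1))
    (l l' : ver (fst A) (fst A1) * ver (snd A) (snd A1))
    (r r' : ver (fst B) (fst B1) * ver (snd B) (snd B1))
    (s : psq t b l r) (s' : psq t' b' l' r') :
  fst s ~= fst s' -> snd s ~= snd s' -> sqeq (S := psq) s s'.
Proof.
destruct t as [t1 t2], b as [b1 b2], l as [l1 l2], r as [r1 r2].
destruct t' as [t1' t2'], b' as [b1' b2'], l' as [l1' l2'], r' as [r1' r2'].
destruct s as [s1 s2], s' as [s1' s2']; simpl; intros e1 e2.
simpl in *. destruct e1, e2. apply sqeq_refl.
Qed.

Definition prodc : double_cat.
Proof.
refine (@DoubleCat (ob C * ob D)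
  (fun A B => (hom (fst A) (fst B) * hom (snd A) (snd B))%type)
  (fun A B => (ver (fst A) (fst B) * ver (snd A) (snd B))%type)
  (fun A B A1 B1 t b l r =>
     (sq (fst t) (fst b) (fst l) (fst r) * sq (snd t) (snd b) (snd l) (snd r))%type)
  (fun A => (hid (fst A), hid (snd A)))
  (fun A B E f g => (fst f >> fst g, snd f >> snd g))
  (fun A => (vid (fst A), vid (snd A)))
  (fun A B E u v => (fst u // fst v, snd u // snd v))
  (fun A B u => (sq_hid (fst u), sq_hid (snd u)))
  (fun A B f => (sq_vid (fst f), sq_vid (snd f)))
  (fun A B E A1 B1 E1 t t' b b' l m r x y => (fst x <|> fst y, snd x <|> snd y))
  (fun A B A1 B1 A2 B2 t m b l l' r r' x y => (fst x </> fst y, snd x </> snd y))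
  _ _ _ _ _ _ _ _ _ _ _ _ _ _ _ _).
- intros; simpl; now rewrite !hassoc.
- intros A B [f g]; simpl; now rewrite !hid_l.
- intros A B [f g]; simpl; now rewrite !hid_r.
- intros; simpl; now rewrite !vassoc.
- intros A B [f g]; simpl; now rewrite !vid_l.
- intros A B [f g]; simpl; now rewrite !vid_r.
- intros; apply psqeq; apply sq_hassoc.
- intros; apply psqeq; apply sq_hid_l.
- intros; apply psqeq; apply sq_hid_r.
- intros; apply psqeq; apply sq_vassoc.
- intros; apply psqeq; apply sq_vid_l.
- intros; apply psqeq; apply sq_vid_r.
- intros; simpl; now rewrite !interchange.
- intros; simpl; now rewrite !sq_hid_vcomp.
- intros; simpl; now rewrite !sq_vid_hcomp.
- intros; simpl; now rewrite !sq_hid_vid.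
Defined.

Definition pffst : pfdata (C := prodc) (D := C) (fun A => fst A) :=
  @PFData prodc C (fun A => fst A)
    (fun A B f => fst f) (fun A B u => fst u)
    (fun A B A1 B1 t b l r s => fst s) (fun A => eq_refl)
    (fun A B E f g => sq_vid (fst f >> fst g))
    (fun A B E f g => sq_vid (fst f >> fst g))
    (fun A => sq_vid (hid (fst A))) (fun A => sq_vid (hid (fst A))).

Definition pfsnd : pfdata (C := prodc) (D := D) (fun A => snd A) :=
  @PFData prodc D (fun A => snd A)
    (fun A B f => snd f) (fun A B u => snd u)
    (fun A B A1 B1 t b l r s => snd s) (fun A => eq_refl)
    (fun A B E f g => sq_vid (snd f >> snd g))
    (fun A B E f g => sq_vid (snd f >> snd g))
    (fun A => sq_vid (hid (snd A))) (fun A => sq_vid (hid (snd A))).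

Definition pfpair (E : double_cat) (F0 : ob E -> ob C) (G0 : ob E -> ob D)
    (F : pfdata F0) (G : pfdata G0) :
    pfdata (C := E) (D := prodc) (fun A => (F0 A, G0 A)) :=
  @PFData E prodc (fun A => (F0 A, G0 A))
    (fun A B f => (pf_h F f, pf_h G f)) (fun A B u => (pf_v F u, pf_v G u))
    (fun A B A1 B1 t b l r s => (pf_s F s, pf_s G s))
    (fun A => f_equal2 pair (pf_vid F A) (pf_vid G A))
    (fun A B K f g => (pf_comp F f g, pf_comp G f g))
    (fun A B K f g => (pf_compV F f g, pf_compV G f g))
    (fun A => (pf_unit F A, pf_unit G A))
    (fun A => (pf_unitV F A, pf_unitV G A)).

End Product.

(** ** The product of the pure center *)

Section Box.
Variables (D : double_cat) (P : pc_premonoidal D).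
Let Z : double_cat := pure_center P.

Definition box0 (A : ob (prodc Z Z)) : ob Z := bow P (fst A) (snd A).

Definition box_h (A B : ob (prodc Z Z)) (f : hom A B) : hom (box0 A) (box0 B) :=
  mkzh P (pf_h (rt P (snd A)) (zh (fst f)) >> pf_h (lt P (fst B)) (zh (snd f))).

Definition box_v (A B : ob (prodc Z Z)) (u : ver A B) : ver (box0 A) (box0 B) :=
  mkzv P (pf_v (rt P (snd A)) (zv (fst u)) // pf_v (lt P (fst B)) (zv (snd u))).

Definition box_s (A B A1 B1 : ob (prodc Z Z)) (t : hom A B) (b : hom A1 B1)
    (l : ver A A1) (r : ver B B1) (s : sq t b l r) :
    sq (box_h t) (box_h b) (box_v l) (box_v r) :=
  mkzs (t := box_h t) (b := box_h b) (l := box_v l) (r := box_v r)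
    ((pf_s (rt P (snd A)) (zs (fst s)) </> vt_sq (rV P (zv (snd l))) (zh (fst b)))
     <|> (ht_sq (rH P (zh (snd t))) (zv (fst r))
          </> pf_s (lt P (fst B1)) (zs (snd s)))).

Lemma box_vid (A : ob (prodc Z Z)) : box_v (vid A) = vid (box0 A).
Proof.
destruct A as [X Y].
change (mkzv P (pf_v (rt P Y) (@vid D X) // pf_v (lt P X) (@vid D Y))
  = mkzv P (@vid D (bow P X Y))).
apply f_equal. rewrite (pf_vid (rt P Y) X), (pf_vid (lt P X) Y). apply vid_l.
Qed.

Lemma hassoc4 (A B C E G : ob D) (p : hom A B) (q : hom B C) (r : hom C E)
    (s : hom E G) : p >> (q >> r) >> s = (p >> q) >> (r >> s).
Proof. now rewrite !hassoc. Qed.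

(** With [f = (K, k)] and [g = (K', k')], the middle cell of the compositor is the
    component at [k] of the left structure of [K'], inverse to the component at
    [K'] of the right structure of [k].  The casts only rebracket the boundary. *)
Definition box_comp (A B E : ob (prodc Z Z)) (f : hom A B) (g : hom B E) :
    sq (box_h f >> box_h g) (box_h (f >> g)) (vid (box0 A)) (vid (box0 E)) :=
  mkzs (t := box_h f >> box_h g) (b := box_h (f >> g))
    (l := vid (box0 A)) (r := vid (box0 E))
    (sqcast eq_refl eq_refl (vid_vid _) (vid_vid _)
      (sqcast (hassoc4 _ _ _ _) (hassoc4 _ _ _ _) eq_refl eq_refl
         (sq_vid (pf_h (rt P (snd A)) (zh (fst f)))
          <|> ht_gl (lH P (zh (fst g))) (zh (snd f))
          <|> sq_vid (pf_h (lt P (fst E)) (zh (snd g))))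
       </> (pf_comp (rt P (snd A)) (zh (fst f)) (zh (fst g))
            <|> pf_comp (lt P (fst E)) (zh (snd f)) (zh (snd g))))).

Definition box_compV (A B E : ob (prodc Z Z)) (f : hom A B) (g : hom B E) :
    sq (box_h (f >> g)) (box_h f >> box_h g) (vid (box0 A)) (vid (box0 E)) :=
  mkzs (t := box_h (f >> g)) (b := box_h f >> box_h g)
    (l := vid (box0 A)) (r := vid (box0 E))
    (sqcast eq_refl eq_refl (vid_vid _) (vid_vid _)
      ((pf_compV (rt P (snd A)) (zh (fst f)) (zh (fst g))
        <|> pf_compV (lt P (fst E)) (zh (snd f)) (zh (snd g)))
       </> sqcast (hassoc4 _ _ _ _) (hassoc4 _ _ _ _) eq_refl eq_refl
         (sq_vid (pf_h (rt P (snd A)) (zh (fst f)))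
          <|> ht_gl (rH P (zh (snd f))) (zh (fst g))
          <|> sq_vid (pf_h (lt P (fst E)) (zh (snd g)))))).

Definition box_unit (A : ob (prodc Z Z)) :
    sq (hid (box0 A)) (box_h (hid A)) (vid (box0 A)) (vid (box0 A)) :=
  mkzs (t := hid (box0 A)) (b := box_h (hid A))
    (l := vid (box0 A)) (r := vid (box0 A))
    (sqcast (hid_l _) eq_refl eq_refl eq_refl
      (pf_unit (rt P (snd A)) (fst A) <|> pf_unit (lt P (fst A)) (snd A))).

Definition box_unitV (A : ob (prodc Z Z)) :
    sq (box_h (hid A)) (hid (box0 A)) (vid (box0 A)) (vid (box0 A)) :=
  mkzs (t := box_h (hid A)) (b := hid (box0 A))
    (l := vid (box0 A)) (r := vid (box0 A))
    (sqcast eq_refl (hid_l _) eq_refl eq_refl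
      (pf_unitV (rt P (snd A)) (fst A) <|> pf_unitV (lt P (fst A)) (snd A))).

Definition boxr : pfdata box0 :=
  @PFData (prodc Z Z) Z box0 box_h box_v box_s box_vid
    box_comp box_compV box_unit box_unitV.

End Box.

(** ** Monoidal structures with a given product *)

Section Monoidal.
Variables (C : double_cat) (T0 : ob (prodc C C) -> ob C).
Variable T : pfdata T0.

Let C3 : double_cat := prodc (prodc C C) C.

Definition tens3l :=
  pfcomp T (pfpair (pfcomp T (pffst (prodc C C) C)) (pfsnd (prodc C C) C)).

Definition tens3r :=
  pfcomp T (pfpair (pfcomp (pffst C C) (pffst (prodc C C) C))
    (pfcomp T (pfpair (pfcomp (pfsnd C C) (pffst (prodc C C) C))
                      (pfsnd (prodc C C) C)))).

Definition tens_l (I : ob C) := pfcomp T (pfpair (pfconst C I) (pfid C)).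
Definition tens_r (I : ob C) := pfcomp T (pfpair (pfid C) (pfconst C I)).

Definition th (A A' B B' : ob C) (f : hom A A') (g : hom B B') :
    hom (T0 (A, B)) (T0 (A', B')) :=
  @pf_h _ _ _ T (A, B) (A', B') (f, g).
Definition tv (A A' B B' : ob C) (u : ver A A') (v : ver B B') :
    ver (T0 (A, B)) (T0 (A', B')) :=
  @pf_v _ _ _ T (A, B) (A', B') (u, v).
Definition ts (A B A1 B1 A' B' A1' B1' : ob C)
    (t : hom A B) (b : hom A1 B1) (l : ver A A1) (r : ver B B1)
    (t' : hom A' B') (b' : hom A1' B1') (l' : ver A' A1') (r' : ver B' B1')
    (x : sq t b l r) (y : sq t' b' l' r') : sq (th t t') (th b b') (tv l l') (tv r r') :=
  @pf_s _ _ _ T (A, A') (B, B') (A1, A1') (B1, B1') (t, t') (b, b') (l, l') (r, r')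
    (x, y).

Record monoidal := Monoidal {
  mon_pf : is_pf T;
  mon_I : ob C;
  mon_al : forall X : ob C3,
    ver (T0 (T0 (fst X), snd X)) (T0 (fst (fst X), T0 (snd (fst X), snd X)));
  mon_la : forall A : ob C, ver (T0 (mon_I, A)) A;
  mon_ra : forall A : ob C, ver (T0 (A, mon_I)) A;
  mon_assoc : isvtrans tens3l tens3r mon_al;
  mon_lam : isvtrans (tens_l mon_I) (pfid C) mon_la;
  mon_rho : isvtrans (tens_r mon_I) (pfid C) mon_ra;
  mon_a3 (A A' B B' E E' : ob C) (f : hom A A') (g : hom B B') (h : hom E E') :
    sq (th (th f g) h) (th f (th g h)) (mon_al (A, B, E)) (mon_al (A', B', E')) :=
    @vt_sq _ _ _ _ _ _ _ mon_assoc (A, B, E) (A', B', E') (f, g, h);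
  mon_pentagon_v : forall W X Y Z : ob C,
    tv (mon_al (W, X, Y)) (vid Z) // mon_al (W, T0 (X, Y), Z)
        // tv (vid W) (mon_al (X, Y, Z))
      = mon_al (T0 (W, X), Y, Z) // mon_al (W, X, T0 (Y, Z));
  mon_pentagon_h : forall (W W' X X' Y Y' Z Z' : ob C)
    (f : hom W W') (g : hom X X') (h : hom Y Y') (k : hom Z Z'),
    ts (mon_a3 f g h) (sq_vid k) </> mon_a3 f (th g h) k
        </> ts (sq_vid f) (mon_a3 g h k)
      ~= mon_a3 (th f g) h k </> mon_a3 f g (th h k);
  mon_unit_m_v : forall W Y : ob C,
    mon_al (W, mon_I, Y) // tv (vid W) (mon_la Y) = tv (mon_ra W) (vid Y);
  mon_unit_m_h : forall (W W' Y Y' : ob C) (f : hom W W') (g : hom Y Y'),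
    mon_a3 f (hid mon_I) g </> ts (sq_vid f) (vt_sq mon_lam g)
      ~= ts (vt_sq mon_rho f) (sq_vid g);
  mon_unit_l_v : forall W Y : ob C,
    mon_al (mon_I, W, Y) // mon_la (T0 (W, Y)) = tv (mon_la W) (vid Y);
  mon_unit_l_h : forall (W W' Y Y' : ob C) (f : hom W W') (g : hom Y Y'),
    mon_a3 (hid mon_I) f g </> vt_sq mon_lam (th f g)
      ~= ts (vt_sq mon_lam f) (sq_vid g);
  mon_unit_r_v : forall W Y : ob C,
    mon_al (W, Y, mon_I) // tv (vid W) (mon_ra Y) = mon_ra (T0 (W, Y));
  mon_unit_r_h : forall (W W' Y Y' : ob C) (f : hom W W') (g : hom Y Y'),
    mon_a3 f g (hid mon_I) </> ts (sq_vid f) (vt_sq mon_rho g)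
      ~= vt_sq mon_rho (th f g)
}.
End Monoidal.

(* Main.v *)
(** A square is treated as a cell that carries its own boundary, so that every law
    becomes a plain equation between cells and the strict associativity of the
    boundaries plays no role.  At three 1h-cells [f], [g], [h] the associativity of
    the product is the row of the three given associativity squares at [f], [g], [h],
    conjugated by the compositors of [rt P Z] and [lt P X'].  Naturality,
    compatibility with composition, the pentagon and the unit triangles follow by
    first cancelling these invertible compositors: what is left splits into columns,
    each of which is one of the given coherence equations, and rows of exchange cells
    slide past the associativity squares by the compatibility of the latter with the
    exchange cells.  As a square of the pure center is determined by its underlying
    square, the equations in the base suffice. *)

From Stdlib Require Import ssreflect ssrfun ssrbool ProofIrrelevance ClassicalEpsilon.
Require Import Defs.
Set Implicit Arguments.
Unset Strict Implicit.

(** * Cells *)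

(** Two features shape the calculations. First, exchange behaves differently in the two directions.
    The hypothesis on 1v-cells makes every chosen vertical structure strict ([stR], [stL]), hence
    gives the swap law [sw], on which strict vertical functoriality of the product rests. For two
    1h-cells nothing similar holds: the exchange cell [chi] is a genuine part of the compositor
    [boxc], and most of the work is to keep track of such cells. To this end pastings of
    horizontally globular cells are written as columns of whiskered cells [W], in which cells at
    disjoint places commute; two pastings agree once they contain the same exchange cells and
    compositors, up to such moves. Secondly, the product with a horizontal identity is not that
    identity: [boxh (hid I) k] still has the factor [pf_h (R Y) (hid I)], so the unit constraints
    need unitors besides the given [lam] and [rho]. The use of cells has one price, namely that a
    cell need not contain a square. Actual squares are recovered from invertible cells only, so
    invertibility of the constraints is needed already to define them. *)

Section Cells.
Variable D : double_cat.

(** The interior is optional, which makes both compositions total: composites of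
    cells with different common boundaries have interior [None], and associativity
    holds without side conditions. *)
Set Primitive Projections.
Record cell (A B A1 B1 : ob D) := Cell {
  top : hom A B; bot : hom A1 B1; lft : ver A A1; rgt : ver B B1;
  inn : option (sq top bot lft rgt)
}.
Unset Primitive Projections.

Definition pk (A B A1 B1 : ob D) (t : hom A B) (b : hom A1 B1)
  (l : ver A A1) (r : ver B B1) (s : sq t b l r) : cell A B A1 B1 := Cell (Some s).

(** Equality of 1-cells has no decision procedure, hence the classical test. The equation it yields
    serves only as a cast, and proof irrelevance makes that cast trivial on squares that match by
    definition. *)
Definition hc_inn (A B C A1 B1 C1 : ob D) (x : cell A B A1 B1) (y : cell B C B1 C1) :
  option (sq (top x >> top y) (bot x >> bot y) (lft x) (rgt y)) :=
  match inn x, inn y, excluded_middle_informative (rgt x = lft y) with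
  | Some s, Some s', left e =>
      Some (sqcast eq_refl eq_refl eq_refl e s <|> s')
  | _, _, _ => None
  end.
Definition vc_inn (A B A1 B1 A2 B2 : ob D) (x : cell A B A1 B1) (y : cell A1 B1 A2 B2) :
  option (sq (top x) (bot y) (lft x // lft y) (rgt x // rgt y)) :=
  match inn x, inn y, excluded_middle_informative (bot x = top y) with
  | Some s, Some s', left e =>
      Some (sqcast eq_refl e eq_refl eq_refl s </> s')
  | _, _, _ => None
  end.
Definition hc (A B C A1 B1 C1 : ob D) (x : cell A B A1 B1) (y : cell B C B1 C1) :
  cell A C A1 C1 := Cell (hc_inn x y).
Definition vc (A B A1 B1 A2 B2 : ob D) (x : cell A B A1 B1) (y : cell A1 B1 A2 B2) :
  cell A B A2 B2 := Cell (vc_inn x y).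
Definition idv (A B : ob D) (f : hom A B) := pk (sq_vid f).
Definition idh (A B : ob D) (u : ver A B) := pk (sq_hid u).
End Cells.

Notation "x [|] y" := (hc x y) (at level 46, right associativity) : dbl_scope.
Notation "x [/] y" := (vc x y) (at level 47, right associativity) : dbl_scope.

(** * Strict laws for both compositions of cells *)

Section CellLaws.
Variable D : double_cat.
Implicit Types A B C : ob D.

(** An undefined cell is nothing but its boundary. In the degenerate cases of a law only the strict
    laws of 1-cells remain to be checked. *)
Lemma none_eq A B A1 B1 (x y : cell A B A1 B1) : top x = top y -> bot x = bot y ->
  lft x = lft y -> rgt x = rgt y -> inn x = None -> inn y = None -> x = y.
Proof.
case: x => t b l r s; case: y => t' b' l' r' s' /= et eb el er.
by case: t' / et s'; case: b' / eb; case: l' / el; case: r' / er => s' -> ->.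
Qed.
End CellLaws.

Section Boundary.
Variable D : double_cat.
Implicit Types A B C : ob D.
Lemma hcB A B C A1 B1 C1 (x : cell A B A1 B1) (y : cell B C B1 C1) :
  (top (x [|] y) = top x >> top y) * (bot (x [|] y) = bot x >> bot y)
  * (lft (x [|] y) = lft x) * (rgt (x [|] y) = rgt y).
Proof. by []. Qed.

Lemma vcB A B A1 B1 A2 B2 (x : cell A B A1 B1) (y : cell A1 B1 A2 B2) :
  (top (x [/] y) = top x) * (bot (x [/] y) = bot y)
  * (lft (x [/] y) = lft x // lft y) * (rgt (x [/] y) = rgt x // rgt y).
Proof. by []. Qed.
End Boundary.

(** Settles the undefined case of a law: [t1] and [t2] show that the left and the right cell have no
    interior. *)
Ltac ne t1 t2 :=
  apply: none_eq; [rewrite ?hcB ?vcB /= ?hassoc ?vassoc ?hid_l ?hid_r ?vid_l ?vid_r; first [reflexivity|congruence]..|t1|t2] => //.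

Section CellLaws2.
Variable D : double_cat.
Implicit Types A B C : ob D.
Lemma pk_eq A B A1 B1 (t t' : hom A B) (b b' : hom A1 B1)
  (l l' : ver A A1) (r r' : ver B B1) (s : sq t b l r) (s' : sq t' b' l' r') :
  s ~= s' -> pk s = pk s'.
Proof. by case. Qed.

(** Injectivity of a dependent constructor is avoided: the predicate [Q], saying that the interior
    exists and is [~=] to [s], is transported along the equation of cells. *)
Lemma eq_pk A B A1 B1 (t t' : hom A B) (b b' : hom A1 B1)
  (l l' : ver A A1) (r r' : ver B B1) (s : sq t b l r) (s' : sq t' b' l' r') :
  pk s = pk s' -> s ~= s'.
Proof.
pose Q (c : cell A B A1 B1) := match inn c with Some x => s ~= x | None => False end.
move=> e; change (Q (pk s')); rewrite -e; exact: sqeq_refl.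
Qed.

Lemma pk_cast A B A1 B1 (t t' : hom A B) (b b' : hom A1 B1)
  (l l' : ver A A1) (r r' : ver B B1) (et : t = t') (eb : b = b')
  (el : l = l') (er : r = r') (s : sq t b l r) : pk (sqcast et eb el er s) = pk s.
Proof. by case: t' / et; case: b' / eb; case: l' / el; case: r' / er. Qed.

Lemma pk_h A B C A1 B1 C1
    (t : hom A B) (t' : hom B C) (b : hom A1 B1) (b' : hom B1 C1)
    (l : ver A A1) (m : ver B B1) (r : ver C C1)
    (x : sq t b l m) (y : sq t' b' m r) : pk (x <|> y) = pk x [|] pk y.
Proof.
rewrite /hc /hc_inn /=; case: excluded_middle_informative => [e|[]] //.
by rewrite (proof_irrelevance _ e eq_refl).
Qed.

Lemma pk_v A B A1 B1 A2 B2
    (t : hom A B) (m : hom A1 B1) (b : hom A2 B2)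
    (l : ver A A1) (l' : ver A1 A2) (r : ver B B1) (r' : ver B1 B2)
    (x : sq t m l r) (y : sq m b l' r') : pk (x </> y) = pk x [/] pk y.
Proof.
rewrite /vc /vc_inn /=; case: excluded_middle_informative => [e|[]] //.
by rewrite (proof_irrelevance _ e eq_refl).
Qed.

Lemma hcN A B C A1 B1 C1 (x : cell A B A1 B1) (y : cell B C B1 C1) :
  rgt x <> lft y -> inn (x [|] y) = None.
Proof.
rewrite /= /hc_inn; case: (inn x) => // s; case: (inn y) => // s'.
by case: excluded_middle_informative.
Qed.

Lemma vcN A B A1 B1 A2 B2 (x : cell A B A1 B1) (y : cell A1 B1 A2 B2) :
  bot x <> top y -> inn (x [/] y) = None.
Proof.
rewrite /= /vc_inn; case: (inn x) => // s; case: (inn y) => // s'.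
by case: excluded_middle_informative.
Qed.

Lemma hc0l A B C A1 B1 C1 (x : cell A B A1 B1) (y : cell B C B1 C1) :
  inn x = None -> inn (x [|] y) = None.
Proof. by rewrite /= /hc_inn => ->. Qed.

Lemma hc0r A B C A1 B1 C1 (x : cell A B A1 B1) (y : cell B C B1 C1) :
  inn y = None -> inn (x [|] y) = None.
Proof. by rewrite /= /hc_inn => ->; case: (inn x). Qed.

Lemma vc0l A B A1 B1 A2 B2 (x : cell A B A1 B1) (y : cell A1 B1 A2 B2) :
  inn x = None -> inn (x [/] y) = None.
Proof. by rewrite /= /vc_inn => ->. Qed.

Lemma vc0r A B A1 B1 A2 B2 (x : cell A B A1 B1) (y : cell A1 B1 A2 B2) :
  inn y = None -> inn (x [/] y) = None.
Proof. by rewrite /= /vc_inn => ->; case: (inn x). Qed.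

Lemma hcA A B C E A1 B1 C1 E1 (x : cell A B A1 B1) (y : cell B C B1 C1)
  (z : cell C E C1 E1) : (x [|] y) [|] z = x [|] (y [|] z).
Proof.
case: (excluded_middle_informative (rgt x = lft y)) => [e1|n1]; last first.
  by ne ltac:(apply: hc0l; apply: hcN) ltac:(apply: hcN).
case: (excluded_middle_informative (rgt y = lft z)) => [e2|n2]; last first.
  by ne ltac:(apply: hcN) ltac:(apply: hc0r; apply: hcN).
case: x e1 => t b l r [s|] /= e1; last first.
  by ne ltac:(do ?apply: hc0l) ltac:(do ?apply: hc0l).
case: z e2 => t'' b'' l'' r'' [s''|] /= e2; last first.
  by ne ltac:(do ?apply: hc0r) ltac:(do ?apply: hc0r).
case: y e1 e2 => t' b' l' r' [s'|] /= e1 e2; last first.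
  by ne ltac:(apply: hc0l; apply: hc0r) ltac:(apply: hc0r; apply: hc0l).
case: l' / e1 s'=> s'; case: l'' / e2 s''=> s''.
rewrite -!/(pk _) -!pk_h; apply: pk_eq; exact: sq_hassoc.
Qed.

Lemma vcA A B A1 B1 A2 B2 A3 B3 (x : cell A B A1 B1) (y : cell A1 B1 A2 B2)
  (z : cell A2 B2 A3 B3) : (x [/] y) [/] z = x [/] (y [/] z).
Proof.
case: (excluded_middle_informative (bot x = top y)) => [e1|n1]; last first.
  by ne ltac:(apply: vc0l; apply: vcN) ltac:(apply: vcN).
case: (excluded_middle_informative (bot y = top z)) => [e2|n2]; last first.
  by ne ltac:(apply: vcN) ltac:(apply: vc0r; apply: vcN).
case: x e1 => t b l r [s|] /= e1; last first.
  by ne ltac:(do ?apply: vc0l) ltac:(do ?apply: vc0l).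
case: z e2 => t'' b'' l'' r'' [s''|] /= e2; last first.
  by ne ltac:(do ?apply: vc0r) ltac:(do ?apply: vc0r).
case: y e1 e2 => t' b' l' r' [s'|] /= e1 e2; last first.
  by ne ltac:(apply: vc0l; apply: vc0r) ltac:(apply: vc0r; apply: vc0l).
case: t' / e1 s'=> s'; case: t'' / e2 s''=> s''.
rewrite -!/(pk _) -!pk_v; apply: pk_eq; exact: sq_vassoc.
Qed.

(** In contrast to [hcA], premises are required: the left side only tests
    [bot x >> bot y = top z >> top w], and equal composites need not have equal factors. *)
Lemma inter A B C A1 B1 C1 A2 B2 C2 (x : cell A B A1 B1) (y : cell B C B1 C1)
  (z : cell A1 B1 A2 B2) (w : cell B1 C1 B2 C2) :
  rgt x = lft y -> rgt z = lft w -> bot x = top z -> bot y = top w ->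
  (x [|] y) [/] (z [|] w) = (x [/] z) [|] (y [/] w).
Proof.
case: x => t b l r [s|] /= e1 e2 e3 e4; last first.
  by ne ltac:(apply: vc0l; apply: hc0l) ltac:(apply: hc0l; apply: vc0l).
case: w e2 e4 => t' b' l' r' [s'|] /= e2 e4; last first.
  by ne ltac:(apply: vc0r; apply: hc0r) ltac:(apply: hc0r; apply: vc0r).
case: y e1 e4 => t'' b'' l'' r'' [s''|] /= e1 e4; last first.
  by ne ltac:(apply: vc0l; apply: hc0r) ltac:(apply: hc0r; apply: vc0l).
case: z e2 e3 => t4 b4 l4 r4 [s4|] /= e2 e3; last first.
  by ne ltac:(apply: vc0r; apply: hc0l) ltac:(apply: hc0l; apply: vc0r).
case: l'' / e1 s''=> s''; case: l' / e2 s' => s'.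
case: t4 / e3 s4 => s4; case: t' / e4 s' => s'.
by rewrite -!/(pk _) -!pk_h -!pk_v -!pk_h interchange.
Qed.

Lemma vc1l A B A1 B1 (f : hom A B) (x : cell A B A1 B1) : f = top x ->
  idv f [/] x = x.
Proof.
case: x => t b l r [s|] /= ->; last by ne ltac:(apply: vc0r) ltac:(by []).
rewrite -!/(pk _) -pk_v; apply: pk_eq; exact: sq_vid_l.
Qed.

Lemma vc1r A B A1 B1 (f : hom A1 B1) (x : cell A B A1 B1) : bot x = f ->
  x [/] idv f = x.
Proof.
case: x => t b l r [s|] /= <-; last by ne ltac:(apply: vc0l) ltac:(by []).
rewrite -!/(pk _) -pk_v; apply: pk_eq; exact: sq_vid_r.
Qed.

Lemma hc1l A B A1 B1 (u : ver A A1) (x : cell A B A1 B1) : u = lft x ->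
  idh u [|] x = x.
Proof.
case: x => t b l r [s|] /= ->; last by ne ltac:(apply: hc0r) ltac:(by []).
rewrite -!/(pk _) -pk_h; apply: pk_eq; exact: sq_hid_l.
Qed.

Lemma hc1r A B A1 B1 (u : ver B B1) (x : cell A B A1 B1) : rgt x = u ->
  x [|] idh u = x.
Proof.
case: x => t b l r [s|] /= <-; last by ne ltac:(apply: hc0l) ltac:(by []).
rewrite -!/(pk _) -pk_h; apply: pk_eq; exact: sq_hid_r.
Qed.

Lemma idv_h A B C (f : hom A B) (g : hom B C) : idv (f >> g) = idv f [|] idv g.
Proof. by rewrite /idv sq_vid_hcomp pk_h. Qed.

Lemma idh_v A B C (f : ver A B) (g : ver B C) : idh (f // g) = idh f [/] idh g.
Proof. by rewrite /idh sq_hid_vcomp pk_v. Qed.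

Lemma idh_vid A : idh (vid A) = idv (hid A).
Proof. by rewrite /idh sq_hid_vid. Qed.

(** Columns are nested to the right, so an equation for the first entries of a longer column does
    not match a subterm. This family lifts such equations: two entries to two ([vcR]), and two,
    three or four to one ([vcR1], [vcR3], [vcR4]). *)
Lemma vcR A B A1 B1 A1' B1' A2 B2 A3 B3 (x : cell A B A1 B1) (y : cell A1 B1 A2 B2)
   (x' : cell A B A1' B1') (y' : cell A1' B1' A2 B2) (z : cell A2 B2 A3 B3) :
   x [/] y = x' [/] y' -> x [/] y [/] z = x' [/] y' [/] z.
Proof. by rewrite -!vcA => ->. Qed.

Lemma vcR1 A B A1 B1 A2 B2 A3 B3 (x : cell A B A1 B1) (y : cell A1 B1 A2 B2)
   (x' : cell A B A2 B2) (z : cell A2 B2 A3 B3) :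
   x [/] y = x' -> x [/] y [/] z = x' [/] z.
Proof. by rewrite -!vcA => ->. Qed.

Lemma vcR3 A0 B0 A1 B1 A2 B2 A3 B3 A4 B4 (a : cell A0 B0 A1 B1) (b : cell A1 B1 A2 B2)
  (c : cell A2 B2 A3 B3) (e : cell A0 B0 A3 B3) (r : cell A3 B3 A4 B4) :
  a [/] b [/] c = e -> a [/] b [/] c [/] r = e [/] r.
Proof. by move=> <-; rewrite !vcA. Qed.

Lemma vcR4 A0 B0 A1 B1 A2 B2 A3 B3 A4 B4 A5 B5 (a : cell A0 B0 A1 B1) (b : cell A1 B1 A2 B2)
  (c : cell A2 B2 A3 B3) (d : cell A3 B3 A4 B4) (e : cell A0 B0 A4 B4) (r : cell A4 B4 A5 B5) :
  a [/] b [/] c [/] d = e -> a [/] b [/] c [/] d [/] r = e [/] r.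
Proof. by move=> <-; rewrite !vcA. Qed.
End CellLaws2.

(** * Functors and transformations on cells *)

Section Functors.
Variables (C D : double_cat) (F0 : ob C -> ob D) (F : pfdata F0).
Definition fc (A B A1 B1 : ob C) (x : cell A B A1 B1) : cell (F0 A) (F0 B) (F0 A1) (F0 B1) :=
  Cell (option_map (@pf_s _ _ _ F _ _ _ _ _ _ _ _) (inn x)).
Definition ph (A B E : ob C) (f : hom A B) (g : hom B E) := pk (pf_comp F f g).
Definition phV (A B E : ob C) (f : hom A B) (g : hom B E) := pk (pf_compV F f g).
Definition un (A : ob C) := pk (pf_unit F A).
Definition unV (A : ob C) := pk (pf_unitV F A).
End Functors.

Section Trans.
Variables (C D : double_cat) (F0 G0 : ob C -> ob D) (F : pfdata F0) (G : pfdata G0).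
Definition Hs (c : forall A, hom (F0 A) (G0 A)) (a : htrans F G c)
  (A A1 : ob C) (u : ver A A1) := pk (ht_sq a u).
Definition Hg (c : forall A, hom (F0 A) (G0 A)) (a : htrans F G c)
  (A A1 : ob C) (f : hom A A1) := pk (ht_gl a f).
(** The globular cells [vt_gl] get no packaged form: all vertical transformations used on cells are
    strict, and there these are identities. *)
Definition Vs (c : forall A, ver (F0 A) (G0 A)) (a : vtrans F G c)
  (A A1 : ob C) (f : hom A A1) := pk (vt_sq a f).
End Trans.

Section Boundary2.
Variable C : double_cat.
Implicit Types A B : ob C.
Lemma idvB A B (f : hom A B) : (top (idv f) = f) * (bot (idv f) = f)
  * (lft (idv f) = vid _) * (rgt (idv f) = vid _).
Proof. by []. Qed.

Lemma pkB A B A1 B1 (t : hom A B) (b : hom A1 B1)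
  (l : ver A A1) (r : ver B B1) (s : sq t b l r) :
  (top (pk s) = t) * (bot (pk s) = b) * (lft (pk s) = l) * (rgt (pk s) = r).
Proof. by []. Qed.
End Boundary2.

(** [bd] proves equations between boundary 1-cells, [sd] applies it only to such
    goals, [feed] uses it to discharge boundary premises and [rb] computes the
    boundary of concrete cells. *)
Ltac bds := lazy beta iota delta [hc vc fc ph phV un unV idv idh Hs Hg Vs pk top bot lft rgt].

Section Unfolded.
Variables (C D : double_cat) (F0 G0 : ob C -> ob D) (F : pfdata F0) (G : pfdata G0).
Lemma pk_fc (A B A1 B1 : ob C) (t : hom A B) (b : hom A1 B1) (l : ver A A1) (r : ver B B1)
  (s : sq t b l r) : pk (pf_s F s) = fc F (pk s).
Proof. by []. Qed.

Lemma pk_Hs c (a : htrans F G c) (A A1 : ob C) (u : ver A A1) : pk (ht_sq a u) = Hs a u.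
Proof. by []. Qed.

Lemma pk_Vs c (a : vtrans F G c) (A A1 : ob C) (f : hom A A1) : pk (vt_sq a f) = Vs a f.
Proof. by []. Qed.
End Unfolded.

Section FunctorLaws.
Variables (C D : double_cat) (F0 : ob C -> ob D) (F : pfdata F0) (HF : is_pf F).
Implicit Types A B E : ob C.

(** [F] may identify distinct 1-cells, so the images can be composable when [x] and [y] are not;
    hence the premise. *)
Lemma fc_v A B A1 B1 A2 B2 (x : cell A B A1 B1) (y : cell A1 B1 A2 B2) :
  bot x = top y -> fc F (x [/] y) = fc F x [/] fc F y.
Proof.
case: x => t b l r s; case: y => t' b' l' r' s' /= e; case: t' / e s'.
case: s => [s|]; last first.
  by move=> s'; apply: none_eq; rewrite //= /vc_inn /= ?(pf_vcomp HF).
case=> [s'|]; last first.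
  by apply: none_eq; rewrite //= /vc_inn /= ?(pf_vcomp HF).
rewrite -!/(pk _) -!pk_v; apply: pk_eq; exact: pf_s_vcomp.
Qed.

Lemma fc_idv A B (f : hom A B) : fc F (idv f) = idv (pf_h F f).
Proof. apply: pk_eq; exact: pf_s_vid. Qed.

Lemma ph_nat A B E A1 B1 E1 (x : cell A B A1 B1) (y : cell B E B1 E1) :
  rgt x = lft y ->
  (fc F x [|] fc F y) [/] ph F (bot x) (bot y) = ph F (top x) (top y) [/] fc F (x [|] y).
Proof.
case: x => t b l r s; case: y => t' b' l' r' s' /= e; case: l' / e s'.
case: s => [s|]; last first.
  by move=> s'; apply: none_eq; rewrite //= ?vid_l ?vid_r.
case=> [s'|]; last first.
  by apply: none_eq; rewrite //= /vc_inn /hc_inn //= ?vid_l ?vid_r.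
rewrite -!/(pk _) -?pk_h -!pk_v; apply: pk_eq; exact: pf_comp_nat.
Qed.

Lemma un_nat A B (u : ver A B) :
  idh (pf_v F u) [/] un F B = un F A [/] fc F (idh u).
Proof. rewrite -!pk_v; apply: pk_eq; exact: pf_unit_nat. Qed.

Lemma ph_assoc A B E G (f : hom A B) (g : hom B E) (h : hom E G) :
  (ph F f g [|] idv (pf_h F h)) [/] ph F (f >> g) h
  = (idv (pf_h F f) [|] ph F g h) [/] ph F f (g >> h).
Proof. rewrite -!pk_h -!pk_v; apply: pk_eq; exact: pf_comp_assoc. Qed.

Lemma ph_unl A B (f : hom A B) :
  (un F A [|] idv (pf_h F f)) [/] ph F (hid A) f = idv (pf_h F f).
Proof. rewrite -!pk_h -!pk_v; apply: pk_eq; exact: pf_unit_l. Qed.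

Lemma ph_unr A B (f : hom A B) :
  (idv (pf_h F f) [|] un F B) [/] ph F f (hid B) = idv (pf_h F f).
Proof. rewrite -!pk_h -!pk_v; apply: pk_eq; exact: pf_unit_r. Qed.

Lemma phK A B E (f : hom A B) (g : hom B E) :
  ph F f g [/] phV F f g = idv (pf_h F f >> pf_h F g).
Proof. rewrite -!pk_v; apply: pk_eq; exact: (proj1 (pf_comp_inv HF f g)). Qed.

Lemma phVK A B E (f : hom A B) (g : hom B E) :
  phV F f g [/] ph F f g = idv (pf_h F (f >> g)).
Proof. rewrite -!pk_v; apply: pk_eq; exact: (proj2 (pf_comp_inv HF f g)). Qed.

Lemma unK A : un F A [/] unV F A = idv (hid (F0 A)).
Proof. rewrite -!pk_v; apply: pk_eq; exact: (proj1 (pf_unit_inv HF A)). Qed.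

Lemma unVK A : unV F A [/] un F A = idv (pf_h F (hid A)).
Proof. rewrite -!pk_v; apply: pk_eq; exact: (proj2 (pf_unit_inv HF A)). Qed.
End FunctorLaws.

Section Pfcomp.
Variables (C D E : double_cat) (G0 : ob D -> ob E) (F0 : ob C -> ob D).
Variables (G : pfdata G0) (F : pfdata F0).
Lemma ph_pfcomp A B K (f : hom A B) (g : hom B K) :
  ph (pfcomp G F) f g = ph G (pf_h F f) (pf_h F g) [/] fc G (ph F f g).
Proof. exact: etrans (pk_cast _ _ _ _ _) (pk_v _ _). Qed.

Lemma un_pfcomp A :
  un (pfcomp G F) A = un G (F0 A) [/] fc G (un F A).
Proof. exact: etrans (pk_cast _ _ _ _ _) (pk_v _ _). Qed.

Lemma fc_pfcomp A B A1 B1 (x : cell A B A1 B1) : fc (pfcomp G F) x = fc G (fc F x).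
Proof. by case: x => t b l r [s|]. Qed.
End Pfcomp.

Section TransLaws.
Variables (C D : double_cat) (F0 G0 : ob C -> ob D) (F : pfdata F0) (G : pfdata G0).
Implicit Types A B E : ob C.
Section H.
Variables (c : forall A, hom (F0 A) (G0 A)) (a : htrans F G c).
Lemma Hs_vid A : Hs a (vid A) = idv (c A).
Proof. apply: pk_eq; exact: ht_sq_vid. Qed.

Lemma Hs_v A A1 A2 (u : ver A A1) (v : ver A1 A2) : Hs a (u // v) = Hs a u [/] Hs a v.
Proof. rewrite -pk_v; apply: pk_eq; exact: ht_sq_vcomp. Qed.

Lemma H_nat A B A1 B1 (x : cell A B A1 B1) :
  (fc F x [|] Hs a (rgt x)) [/] Hg a (bot x) = Hg a (top x) [/] (Hs a (lft x) [|] fc G x).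
Proof.
case: x => t b l r [s|] /=; last first.
  by ne ltac:(apply: vc0l; apply: hc0l) ltac:(apply: vc0r; apply: hc0r).
rewrite /fc /= -!/(pk _) -!pk_h -!pk_v; apply: pk_eq; exact: ht_nat.
Qed.

Lemma Hg_comp A B E (f : hom A B) (g : hom B E) :
  (ph F f g [|] idv (c E)) [/] Hg a (f >> g)
  = (idv (pf_h F f) [|] Hg a g) [/] (Hg a f [|] idv (pf_h G g)) [/] (idv (c A) [|] ph G f g).
Proof. rewrite -vcA -!pk_h -(pk_cast (hassoc _ _ _) (hassoc _ _ _) eq_refl eq_refl (_ <|> sq_vid (pf_h G g))) -!pk_v; apply: pk_eq; exact: ht_gl_comp. Qed.

Lemma Hg_hid A :
  (un F A [|] idv (c A)) [/] Hg a (hid A) = idv (c A) [|] un G A.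
Proof. rewrite -!pk_h -!pk_v; apply: pk_eq; exact: ht_gl_hid. Qed.
End H.

Section V.
Variables (c : forall A, ver (F0 A) (G0 A)) (a : vtrans F G c).
Lemma Vs_hid A : idh (c A) [/] un G A = un F A [/] Vs a (hid A).
Proof. rewrite -!pk_v; apply: pk_eq; exact: vt_sq_hid. Qed.

Lemma Vs_comp A B E (f : hom A B) (g : hom B E) :
  (Vs a f [|] Vs a g) [/] ph G f g = ph F f g [/] Vs a (f >> g).
Proof. rewrite -!pk_h -!pk_v; apply: pk_eq; exact: vt_sq_hcomp. Qed.
Hypothesis st : vt_strict a.
(** Strictness identifies [vt_gl a u] with an identity square; comparing right sides gives the
    equation. *)
Lemma V_sw A A1 (u : ver A A1) : c A // pf_v G u = pf_v F u // c A1.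
Proof. exact: esym (f_equal (@rgt _ _ _ _ _) (pk_eq (st u))). Qed.

(** This is [vt_nat] after both globular cells have become identities by [st]. *)
Lemma V_nat A B A1 B1 (x : cell A B A1 B1) :
  Vs a (top x) [/] fc G x = fc F x [/] Vs a (bot x).
Proof.
case: x => t b l r [s|] /=; last first.
  have e1 := V_sw l; have e2 := V_sw r; by ne ltac:(apply: vc0r) ltac:(apply: vc0l).
have := pk_eq (vt_nat a s).
rewrite !pk_h !pk_v (pk_eq (st l)) (pk_eq (st r)) -!/(idh _) hc1r ?hc1l //.
by rewrite /= V_sw.
Qed.
End V.
End TransLaws.

Ltac hyps := repeat match goal with
  | H : lft ?x = _ |- context [lft ?x] => rewrite H
  | H : rgt ?x = _ |- context [rgt ?x] => rewrite H
  | H : top ?x = _ |- context [top ?x] => rewrite H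
  | H : bot ?x = _ |- context [bot ?x] => rewrite H end.
Ltac bd := bds; hyps; rewrite ?hassoc ?hid_l ?hid_r ?pf_vid ?vid_l ?vid_r; first [reflexivity|congruence].
Ltac sd := match goal with
  | |- @eq (hom _ _) _ _ => bd
  | |- @eq (ver _ _) _ _ => bd
  | |- _ => idtac end.

Ltac feed H := repeat lazymatch type of H with
  | @eq (hom _ _) ?a ?b -> _ => let h := fresh in assert (h : a = b) by bd; specialize (H h); clear h
  | @eq (ver _ _) ?a ?b -> _ => let h := fresh in assert (h : a = b) by bd; specialize (H h); clear h
  end.

(** * Whiskering of globular cells *)

Section Whisker.
Variable D : double_cat.
Implicit Types A B C E : ob D.
(** Only equality of the corners is visible in the type; globularity, that is [lft] and [rgt] being
    [vid], appears as premises of the lemmas. Columns of such cells serve as normal forms of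
    globular pastings. *)
Definition W A B C E (f : hom A B) (x : cell B C B C) (g : hom C E) : cell A E A E :=
  idv f [|] x [|] idv g.
Ltac bds ::= lazy beta iota delta [hc vc fc ph phV un unV idv idh Hs Hg Vs pk top bot lft rgt W].
Lemma W_v A B C E (f : hom A B) (x y : cell B C B C) (g : hom C E) :
  bot x = top y -> lft x = vid _ -> rgt x = vid _ -> lft y = vid _ -> rgt y = vid _ ->
  W f (x [/] y) g = W f x g [/] W f y g.
Proof.
move=> e e1 e2 e3 e4; rewrite /W inter; sd; rewrite inter; sd; rewrite !vc1l; sd; by [].
Qed.

Lemma W_W A A' B C E' E (f' : hom A A') (f : hom A' B) (x : cell B C B C) (g : hom C E)
  (g' : hom E E') :
  W f' (W f x g) g' = W (f' >> f) x (g >> g').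
Proof. by rewrite /W !idv_h !hcA. Qed.

Lemma W_idv A B C E (f : hom A B) (x : hom B C) (g : hom C E) :
  W f (idv x) g = idv (f >> x >> g).
Proof. by rewrite /W !idv_h !hcA. Qed.

Lemma hW A B C (x : cell A B A B) (y : cell B C B C) :
  lft x = vid _ -> rgt x = vid _ -> lft y = vid _ -> rgt y = vid _ ->
  x [|] y = W (hid A) x (top y) [/] W (bot x) y (hid C).
Proof.
move=> e1 e2 e3 e4; rewrite /W -!idh_vid hc1l; sd; rewrite hc1r; sd.
rewrite inter; sd; rewrite vc1l; sd; rewrite vc1r; sd; by [].
Qed.

Lemma hWr A B C (f : hom A B) (y : cell B C B C) : rgt y = vid _ ->
  idv f [|] y = W f y (hid C).
Proof. by move=> e; rewrite /W -!idh_vid hc1r; sd. Qed.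

Lemma hWl A B C (f : hom B C) (y : cell A B A B) : lft y = vid _ ->
  y [|] idv f = W (hid A) y f.
Proof. by move=> e; rewrite /W -!idh_vid hc1l; sd. Qed.

(** Two cells at disjoint places of a row can be applied in either order. The outer 1-cells [h] and
    [f'] are free, constrained by equations, so that the rule applies whatever the bracketing of the
    boundary. *)
Lemma W_swap A B C E G K (f : hom A B) (x : cell B C B C) (m : hom C E) (y : cell E G E G)
  (g : hom G K) h f' :
  lft x = vid _ -> rgt x = vid _ -> lft y = vid _ -> rgt y = vid _ ->
  h = m >> top y >> g -> f' = f >> bot x >> m ->
  W f x h [/] W f' y g = W (f >> top x >> m) y g [/] W f x (m >> bot y >> g).
Proof.
move=> e1 e2 e3 e4 -> ->; rewrite /W !idv_h !hcA.
rewrite inter; sd; rewrite inter; sd; rewrite inter; sd; rewrite inter; sd.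
rewrite inter; sd; rewrite inter; sd; rewrite inter; sd; rewrite inter; sd.
rewrite !vc1l; sd; rewrite !vc1r; sd; by [].
Qed.

Lemma W_swap' A B C E G K (f : hom A B) (x : cell B C B C) (m : hom C E) (y : cell E G E G)
  (g : hom G K) h f' :
  lft x = vid _ -> rgt x = vid _ -> lft y = vid _ -> rgt y = vid _ ->
  f' = f >> top x >> m -> h = m >> bot y >> g ->
  W f' y g [/] W f x h = W f x (m >> top y >> g) [/] W (f >> bot x >> m) y g.
Proof. by move=> e1 e2 e3 e4 -> ->; apply: esym; apply: W_swap. Qed.

(** The regrouping that ends [assoc_cell_comp_L]: [im] is the image of an exchange cell, and the
    compositor [p] of the first slot joins the row of the compositors [x] and [y] of the other
    two. *)
Lemma W_tail A B C E G M (p : cell A B A B) (a : hom B C) (im : cell C E C E) (b : hom E G)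
  (x : cell B M B M) (y : cell M G M G) (q : cell B G B G) (F : hom A B) t t' :
  lft p = vid _ -> rgt p = vid _ -> lft im = vid _ -> rgt im = vid _ -> lft x = vid _ -> rgt x = vid _ ->
  lft y = vid _ -> rgt y = vid _ -> lft q = vid _ -> rgt q = vid _ ->
  bot p = F -> a >> (bot im >> b) = top x >> top y -> bot x >> bot y = top q ->
  t = a >> (top im >> b) -> t' = top p >> a ->
  W (hid A) p t [/] W F (W a im b [/] (x [|] y) [/] q) (hid G)
  = W t' im b [/] (p [|] x [|] y) [/] (idv F [|] q).
Proof.
move=> p1 p2 i1 i2 x1 x2 y1 y2 q1 q2 e1 e2 e3 -> ->.
rewrite W_v; sd; rewrite W_v; sd; rewrite W_W -hWl; sd; rewrite -[W F (x [|] y) _]hWr; sd.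
rewrite -[W F q _]hWr; sd.
rewrite -!vcA; congr (_ [/] _).
have d f : W (f >> a) im b = idv f [|] W a im b by rewrite /W idv_h hcA.
rewrite hid_r !d (inter (x := p)); sd; rewrite inter; sd; rewrite !vc1r; sd; rewrite !vc1l; sd.
by rewrite [RHS]inter; sd; rewrite vc1l; sd.
Qed.

(** Counterpart of [W_tail] for [assoc_cell_comp_R], where in addition the compositor [q] meets its
    inverse [qV]. *)
Lemma W_tail2 A B C E M G (a : hom A B) (im : cell B C B C) (b : hom C E)
  (x : cell A M A M) (y : cell M E M E) (q qV : cell A E A E) (p : cell E G E G) t t' f F :
  lft im = vid _ -> rgt im = vid _ -> lft x = vid _ -> rgt x = vid _ ->
  lft y = vid _ -> rgt y = vid _ -> lft q = vid _ -> rgt q = vid _ ->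
  lft p = vid _ -> rgt p = vid _ -> lft qV = vid _ -> rgt qV = vid _ ->
  a >> (bot im >> b) = top x >> top y -> bot x >> bot y = top q -> bot q = top qV ->
  q [/] qV = idv F -> F = bot x >> bot y ->
  t = top p -> t' = b >> top p -> f = bot x >> bot y ->
  W (hid A) (W a im b [/] (x [|] y) [/] q) t [/] W (hid A) qV t [/] W f p (hid G)
  = W a im t' [/] (x [|] y [|] p).
Proof.
move=> i1 i2 x1 x2 y1 y2 q1 q2 p1 p2 v1 v2 e1 e2 e3 eq eF -> -> ->.
rewrite W_v; sd; rewrite W_v; sd; rewrite W_W !vcA -[W (hid A) q _ [/] _]vcA -W_v; sd.
rewrite eq eF W_idv vc1l; sd.
rewrite hid_l; congr (_ [/] _).
by rewrite -[RHS]hcA [RHS]hW; sd.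
Qed.

(** Lets an exchange cell pass a row of associativity squares: only the middle entry meets it, so a
    local equation for [r2] and [x] is enough. *)
Lemma row_slide A B C E A' B' C' E' (r1 : cell A B A' B') (r2 r2' : cell B C B' C')
  (r3 : cell C E C' E') (x : cell B' C' B' C') (x' : cell B C B C) f g f' g' :
  lft x = vid _ -> rgt x = vid _ -> lft x' = vid _ -> rgt x' = vid _ ->
  rgt r1 = lft r2 -> rgt r2 = lft r3 -> rgt r1 = lft r2' -> rgt r2' = lft r3 ->
  f = bot r1 -> g = bot r3 -> f' = top r1 -> g' = top r3 ->
  bot r2 = top x -> bot x' = top r2' -> r2 [/] x = x' [/] r2' ->
  (r1 [|] r2 [|] r3) [/] W f x g = W f' x' g' [/] (r1 [|] r2' [|] r3).
Proof.
move=> x1 x2 x3 x4 e1 e2 e3 e4 -> -> -> -> e5 e6 e.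
rewrite /W inter; sd; rewrite inter; sd; rewrite e !vc1r; sd.
by rewrite inter; sd; rewrite inter; sd; rewrite !vc1l; sd.
Qed.

Lemma row3r A B C A' B' C' (r : cell A B A' B') (e p : cell A' B' A' B') (v : cell B C B' C') :
  bot r = top e -> bot e = top p -> rgt r = lft v -> rgt e = vid _ -> rgt p = vid _ ->
  (r [/] e [/] p) [|] v = (r [|] v) [/] (e [|] idv (bot v)) [/] (p [|] idv (bot v)).
Proof.
move=> e1 e2 e3 e4 e5; rewrite inter; sd; rewrite vc1r; sd; rewrite inter; sd; by rewrite vc1r; sd.
Qed.

Lemma row3l A B C A' B' C' (r : cell B C B' C') (e p : cell B' C' B' C') (v : cell A B A' B') :
  bot r = top e -> bot e = top p -> rgt v = lft r -> lft e = vid _ -> lft p = vid _ ->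
  v [|] (r [/] e [/] p) = (v [|] r) [/] (idv (bot v) [|] e) [/] (idv (bot v) [|] p).
Proof.
move=> e1 e2 e3 e4 e5; rewrite inter; sd; rewrite vc1r; sd; rewrite inter; sd; by rewrite vc1r; sd.
Qed.
End Whisker.

Ltac bds ::= lazy beta iota delta [hc vc fc ph phV un unV idv idh Hs Hg Vs pk top bot lft rgt W].
Ltac rb1 e := let v := eval lazy beta iota delta
    [hc vc fc ph phV un unV idv idh Hs Hg Vs pk top bot lft rgt W] in e in
  lazymatch v with e => fail | _ => idtac end;
  let H := fresh in assert (H : e = v) by (bds; reflexivity); rewrite H; clear H.
Ltac rb := repeat match goal with
  | |- context [bot ?x] => rb1 (bot x) | |- context [top ?x] => rb1 (top x)
  | |- context [lft ?x] => rb1 (lft x) | |- context [rgt ?x] => rb1 (rgt x) end.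
Ltac na := rb; rewrite ?vcA ?hassoc ?hid_l ?hid_r.
(** [wsw x m y] exchanges the adjacent whiskered cells [x] (on the left) and [y],
    separated by [m]; the primed forms do it in the other direction. *)
Tactic Notation "wsw" uconstr(x) uconstr(m) uconstr(y) :=
  rewrite (vcR _ (W_swap (x := x) (m := m) (y := y) _ _ _ _ _ _)); sd; na.
Tactic Notation "wsw'" uconstr(x) uconstr(m) uconstr(y) :=
  rewrite (vcR _ (W_swap' (x := x) (m := m) (y := y) _ _ _ _ _ _)); sd; na.
Tactic Notation "wswl'" uconstr(x) uconstr(m) uconstr(y) :=
  rewrite (W_swap' (x := x) (m := m) (y := y) _ _ _ _ _ _); sd; na.
Section WFun.
Variables (C D : double_cat) (F0 : ob C -> ob D) (F : pfdata F0) (HF : is_pf F).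
Lemma ph_assocW X Y (A B E G : ob C) (f : hom A B) (g : hom B E) (h : hom E G)
  (a a' : hom X (F0 A)) (b : hom (F0 G) Y) c : c = pf_h F h >> b -> a' = a ->
  W a (ph F f g) c [/] W a' (ph F (f >> g) h) b
  = W (a >> pf_h F f) (ph F g h) b [/] W a (ph F f (g >> h)) b.
Proof.
move=> -> ->; have := ph_assoc HF f g h.
rewrite hWl; sd; rewrite hWr; sd => e.
have e' := f_equal (fun z => W a z b) e; move: e'.
rewrite !W_v; sd; by rewrite !W_W !hid_r !hid_l.
Qed.

(** Among the bracketings of a fourfold composite, this one joins the two inner 1h-cells first,
    which makes room for a globular cell on [g >> f']. *)
Lemma ph4 (A B E G H : ob C) (f : hom A B) (g : hom B E) (f' : hom E G) (g' : hom G H) :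
  (ph F f g [|] ph F f' g') [/] ph F (f >> g) (f' >> g')
  = W (pf_h F f) (ph F g f') (pf_h F g') [/] W (hid _) (ph F f (g >> f')) (pf_h F g')
    [/] ph F (f >> (g >> f')) g'.
Proof.
rewrite hW; sd; rewrite vcA -[W _ (ph F f' g') _]hWr; sd; rb.
rewrite -(ph_assoc HF) hWl; sd. rewrite (vcR _ (ph_assocW f g (h:=f') _ _)); sd.
by rewrite !hid_l hassoc.
Qed.

(** The image of a middle cell [s], once reassociated, is the globular image of [s]
    used in [assoc_12_hh] and [assoc_23_hh]. *)
Lemma img4 (A B B' E G H : ob C) (f : hom A B) (g : hom B E) (f' : hom E G) (g' : hom G H)
   (f'' : hom B B') (g'' : hom B' G) (s : cell B G B G) (m : hom A B') (n : hom B' H) x y :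
  top s = g >> f' -> bot s = f'' >> g'' -> lft s = vid _ -> rgt s = vid _ ->
  top x = f >> f'' -> bot x = m -> lft x = vid _ -> rgt x = vid _ ->
  top y = g'' >> g' -> bot y = n -> lft y = vid _ -> rgt y = vid _ ->
  (ph F f g [|] ph F f' g') [/] ph F (f >> g) (f' >> g')
    [/] fc F ((idv f [|] s [|] idv g') [/] (x [|] y))
  = W (pf_h F f) (ph F g f' [/] fc F s [/] phV F f'' g'') (pf_h F g')
   [/] ((ph F f f'' [/] fc F x) [|] (ph F g'' g' [/] fc F y)) [/] ph F m n.
Proof.
move=> s1 s2 s3 s4 x1 x2 x3 x4 y1 y2 y3 y4.
rewrite (fc_v HF); first by rb; rewrite s2 x1 y1; bd.
rewrite -!vcA.
(* [ph4] on both sides joins the inner pair. Naturality lifts [fc F s] through the compositors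
   ([e1]), and the [phV] that makes the image globular cancels the next compositor ([e2]). *)
have -> : ((ph F f g [|] ph F f' g') [/] ph F (f >> g) (f' >> g')) [/] fc F (idv f [|] s [|] idv g')
  = W (pf_h F f) (ph F g f' [/] fc F s [/] phV F f'' g'') (pf_h F g')
     [/] (ph F f f'' [|] ph F g'' g') [/] ph F (f >> f'') (g'' >> g').
  rewrite !ph4 !vcA -hcA.
  have e0 : rgt (idv f [|] s) = lft (idv g') by bd.
  have := ph_nat HF e0; rb; rewrite s1 s2 => <-.
  rewrite (fc_idv HF) [fc F _ [|] idv _]hWl; sd.
  have e1 : W (hid _) (ph F f (g >> f')) (pf_h F g') [/] W (hid _) (fc F (idv f [|] s)) (pf_h F g')
    = W (pf_h F f) (fc F s) (pf_h F g') [/] W (hid _) (ph F f (f'' >> g'')) (pf_h F g').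
    rewrite -W_v; sd.
    have e3 : rgt (idv f) = lft s by bd.
    have := ph_nat HF e3; rb; rewrite s1 s2 => <-.
    by rewrite (fc_idv HF) hWr; sd; rewrite W_v; sd; rewrite W_W !hid_l.
  have e2 : W (pf_h F f) (phV F f'' g'') (pf_h F g') [/] W (pf_h F f) (ph F f'' g'') (pf_h F g')
    = idv (pf_h F f >> pf_h F (f'' >> g'') >> pf_h F g').
    by rewrite -W_v; sd; rewrite (phVK HF) W_idv.
  rewrite (vcR _ e1) !W_v; sd; by rewrite !vcA (vcR1 _ e2) vc1l; sd.
rewrite !vcA; congr (_ [/] _).
have e0 : rgt x = lft y by bd.
have := ph_nat HF e0; rewrite x1 x2 y1 y2 => <-.
by rewrite -vcA inter; sd.
Qed.

Lemma ph_unlW X Y (A B : ob C) (f : hom A B)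
  (a a' : hom X (F0 A)) (b : hom (F0 B) Y) c : c = pf_h F f >> b -> a' = a ->
  W a (un F A) c [/] W a' (ph F (hid A) f) b = idv (a >> pf_h F f >> b).
Proof.
move=> -> ->; have := ph_unl HF f.
rewrite hWl; sd => e.
have e' := f_equal (fun z => W a z b) e; move: e'.
rewrite !W_v; sd; by rewrite !W_W !hid_r W_idv.
Qed.

Lemma ph_unrW X Y (A B : ob C) (f : hom A B)
  (a a' : hom X _) (b b' : hom (F0 B) Y) : a' = a >> pf_h F f -> b' = b ->
  W a' (un F B) b [/] W a (ph F f (hid B)) b' = idv (a >> pf_h F f >> b).
Proof.
move=> -> ->; have := ph_unr HF f.
rewrite hWr; sd => e.
have e' := f_equal (fun z => W a z b) e; move: e'.
rewrite !W_v; sd; by rewrite !W_W !hid_l W_idv.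
Qed.
End WFun.

(** * Invertible cells and the squares they contain *)

Section CellIso.
Variable D : double_cat.
(** Identities have an interior and a composite with an undefined cell has none, so an invertible
    cell always contains a square. [fill] extracts it. *)
Definition ciso (A B A1 B1 : ob D) (x : cell A B A1 B1) : Prop :=
  exists y : cell A1 B1 A B, x [/] y = idv (top x) /\ y [/] x = idv (bot x).

Lemma ciso_h (A B C A1 B1 C1 : ob D) (x : cell A B A1 B1) (y : cell B C B1 C1) :
  rgt x = lft y -> ciso x -> ciso y -> ciso (x [|] y).
Proof.
move=> e [x' [ex ex']] [y' [ey ey']].
have f (E E' F F' : ob D) (p q : cell E E' F F') : p = q ->
  [/\ top p = top q, bot p = bot q, lft p = lft q & rgt p = rgt q] by move=> ->.
case: (f _ _ _ _ _ _ ex) (f _ _ _ _ _ _ ex') => /= _ e1 _ e2 [/= e3 _ _ e4].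
case: (f _ _ _ _ _ _ ey) (f _ _ _ _ _ _ ey') => /= _ e5 e6 _ [/= e7 _ e8 _].
(* Both are inverse to the common side [rgt x = lft y], and inverses of 1v-cells are unique. *)
have e' : rgt x' = lft y'.
  by rewrite -(vid_r (rgt x')) -e6 -e -vassoc e4 vid_l.
by exists (x' [|] y'); rewrite !inter // ex ex' ey ey' -!idv_h.
Qed.

Lemma ciso_v (A B A1 B1 A2 B2 : ob D) (x : cell A B A1 B1) (y : cell A1 B1 A2 B2) :
  bot x = top y -> ciso x -> ciso y -> ciso (x [/] y).
Proof.
move=> e [x' [ex ex']] [y' [ey ey']]; exists (y' [/] x'); split.
  have et : top x' = bot x := f_equal (@top _ _ _ _ _) ex'.
  by rewrite -ex vcA -(vcA y) ey vc1l // -e et.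
by rewrite vcA -(vcA x') ex' e vc1l.
Qed.

Lemma ciso_pk (A B A1 B1 : ob D) (t : hom A B) (b : hom A1 B1)
  (l : ver A A1) (r : ver B B1) (s : sq t b l r) : vinvertible s <-> ciso (pk s).
Proof.
split=> [[l' [r' [s' [e e']]]]|[y [e e']]].
  by exists (pk s'); rewrite -!pk_v; split; apply: pk_eq.
(* The horizontal sides of the inverse are read off from the two equations, so that it becomes a
   square from [b] to [t]. *)
have et := f_equal (@bot _ _ _ _ _) e; have eb := f_equal (@top _ _ _ _ _) e'.
case: y e e' et eb => b' t' l' r' [s'|] e e' /= et eb; last first.
  by have : inn (idv (top (pk s))) = None by rewrite -e; exact: vc0r.
have et' : t' = t by exact: et.
have eb' : b' = b by exact: eb.
subst t' b'.
exists l', r', s'; split; apply: eq_pk; rewrite pk_v; [exact: e|exact: e'].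
Qed.

Lemma ciso_idv (A B : ob D) (f : hom A B) : ciso (idv f).
Proof. by exists (idv f); rewrite vc1l. Qed.

Lemma ciso_inv (A B A1 B1 : ob D) (x : cell A B A1 B1) (y : cell A1 B1 A B) f g :
  x [/] y = idv f -> y [/] x = idv g -> ciso x.
Proof.
move=> e e'; exists y.
by rewrite e e' -[top x]/(top (x [/] y)) e -[bot x]/(bot (y [/] x)) e'.
Qed.
End CellIso.

Section Fill.
Variable D : double_cat.
Definition fill (A B A1 B1 : ob D) (x : cell A B A1 B1) (t : hom A B) (b : hom A1 B1)
  (l : ver A A1) (r : ver B B1) : ciso x -> top x = t -> bot x = b -> lft x = l -> rgt x = r ->
  {s : sq t b l r | pk s = x}.
Proof.
case: x => t' b' l' r' [s|] i /= et eb el er; last first.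
  suff : False by [].
  case: i => y [e _]; have : inn (idv t') = None by rewrite -e; exact: vc0l.
  by [].
by exists (sqcast et eb el er s); rewrite pk_cast.
Defined.
End Fill.

(** * Invertible strict transformations *)

Section StrictTrans.
Variables (C D : double_cat) (F0 G0 : ob C -> ob D) (F : pfdata F0) (G : pfdata G0).
Variable c : forall A, ver (F0 A) (G0 A).
Hypothesis sw : forall A A1 (u : ver A A1), c A // pf_v G u = pf_v F u // c A1.
Hypothesis Gv : forall A A1 A2 (u : ver A A1) (v : ver A1 A2), pf_v G (u // v) = pf_v G u // pf_v G v.
Variable s : forall A B (f : hom A B), sq (pf_h F f) (pf_h G f) (c A) (c B).
Hypothesis s_inv : forall A B (f : hom A B), vinvertible (s f).
Hypothesis s_hid : forall A : ob C, sq_hid (c A) </> pf_unit G A ~= pf_unit F A </> s (hid A).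
Hypothesis s_hcomp : forall (A B E : ob C) (f : hom A B) (g : hom B E),
    (s f <|> s g) </> pf_comp G f g ~= pf_comp F f g </> s (f >> g).
Hypothesis s_nat : forall (A B A1 B1 : ob C) (t : hom A B) (b : hom A1 B1)
    (l : ver A A1) (r : ver B B1) (x : sq t b l r),
    s t </> pf_s G x ~= pf_s F x </> s b.
Definition strict_gl A A1 (u : ver A A1) : sq (hid _) (hid _) (c A // pf_v G u) (pf_v F u // c A1) :=
  sqcast eq_refl eq_refl eq_refl (sw u) (sq_hid (c A // pf_v G u)).
Lemma pk_strict_gl A A1 (u : ver A A1) : pk (strict_gl u) = idh (c A // pf_v G u).
Proof. by rewrite pk_cast. Qed.

Lemma strict_gl_inv A A1 (u : ver A A1) : hinvertible (strict_gl u).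
Proof.
exists (hid _), (hid _), (sqcast eq_refl eq_refl (sw u) eq_refl (sq_hid (c A // pf_v G u))).
split; apply: eq_pk; rewrite pk_h pk_strict_gl pk_cast -!/(idh _) hc1l //.
by rewrite sw.
Qed.

Lemma strict_nat (A B A1 B1 : ob C) (t : hom A B) (b : hom A1 B1)
    (l : ver A A1) (r : ver B B1) (x : sq t b l r) :
    (s t </> pf_s G x) <|> strict_gl r ~= strict_gl l <|> (pf_s F x </> s b).
Proof.
apply: eq_pk; rewrite !pk_h !pk_v !pk_strict_gl hc1r // hc1l; first by rewrite /= sw.
by rewrite -!pk_v; apply: pk_eq.
Qed.

Lemma strict_gl_comp (A A1 A2 : ob C) (u : ver A A1) (v : ver A1 A2) :
    strict_gl (u // v)
      ~= sqcast eq_refl eq_refl (vassoc _ _ _) (vassoc _ _ _)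
           (strict_gl u </> sq_hid (pf_v G v))
         <|> (sq_hid (pf_v F u) </> strict_gl v).
Proof.
apply: eq_pk; rewrite pk_h pk_cast !pk_v !pk_strict_gl -!/(idh _) -!idh_v hc1l /=.
  by rewrite sw vassoc.
by rewrite Gv -!vassoc sw vassoc.
Qed.

Lemma strict_gl_vid A : strict_gl (vid A) ~= sq_hid (c A).
Proof. by apply: eq_pk; rewrite pk_strict_gl pf_vid vid_r. Qed.

(** With identities as globular cells, the coherence at 1v-cells reduces to [sw] and to
    functoriality of [G] on 1v-cells; only the laws at 1h-cells and squares have to be supplied. *)
Definition strict_vtrans : vtrans F G c :=
  VTrans strict_gl_inv s_hid s_hcomp strict_nat strict_gl_comp strict_gl_vid.
Lemma strict_vtrans_strict : vt_strict strict_vtrans.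
Proof. by move=> A A1 u; apply: eq_pk; rewrite pk_strict_gl. Qed.

Definition strict_isvtrans : isvtrans F G c := ISVTrans strict_vtrans_strict s_inv.
End StrictTrans.

(** * The product on cells *)

Section PC.
Variables (B : double_cat) (P : pc_premonoidal B) (triv : trivial_vv P).
Notation R := (rt P).
Notation L := (lt P).
(** [chi] and [chiV] are the exchange cells at two 1h-cells. *)
Notation chi K k := (Hg (lH P K) k).
Notation chiV K k := (Hg (rH P k) K).
Notation hv K u := (Vs (rV P u) K).
Notation vh U k := (Vs (lV P U) k).

Lemma stR (X X1 : ob B) (u : ver X X1) : vt_strict (rV P u).
Proof. exact: triv. Qed.

(** By [exch_vv] the globular cell of [lV P u] at [v] is horizontally inverse to that of [rV P v] at
    [u], which is an identity by hypothesis. *)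
Lemma stL (X X1 : ob B) (u : ver X X1) : vt_strict (lV P u).
Proof.
move=> Y Y1 v; case: (exch_vv P u v) => e1 e2.
apply: eq_pk; move: (pk_eq e1) (pk_eq e2); rewrite !pk_h (pk_eq (stR v u)) -!/(idh _).
have := f_equal (@rgt _ _ _ _ _) (pk_eq (stR v u)); rewrite /= => e3.
rewrite hc1r ?hc1l //.
Qed.

Lemma hvE X X' (K : hom X X') Y Y1 (u : ver Y Y1) : Hs (lH P K) u = hv K u.
Proof. by rewrite /Hs /Vs exch_hv. Qed.

Lemma vhE X X' (U : ver X X') Y Y1 (k : hom Y Y1) : Hs (rH P k) U = vh U k.
Proof. by rewrite /Hs /Vs exch_vh. Qed.

Lemma chiK X X' (K : hom X X') Y Y' (k : hom Y Y') :
  chi K k [/] chiV K k = idv (pf_h (L X) k >> pf_h (R Y') K).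
Proof. rewrite -pk_v; apply: pk_eq; exact: (proj1 (exch_hh P K k)). Qed.

Lemma chiVK X X' (K : hom X X') Y Y' (k : hom Y Y') :
  chiV K k [/] chi K k = idv (pf_h (R Y) K >> pf_h (L X') k).
Proof. rewrite -pk_v; apply: pk_eq; exact: (proj2 (exch_hh P K k)). Qed.

(** Naturality of [chi] in its left argument is the modification law for a central square. In the
    right argument ([chi_nat]) it is naturality of the transformation [lH P K] itself. *)
Lemma lS_h X X' X1 X1' (x : cell X X' X1 X1') Y Y' (k : hom Y Y') :
  (vh (lft x) k [|] fc (R Y') x) [/] chi (bot x) k
  = chi (top x) k [/] (fc (R Y) x [|] vh (rgt x) k).
Proof.
case: x => t b l r [s|] /=; last first.
  by ne ltac:(apply: vc0l; apply: hc0r) ltac:(apply: vc0r; apply: hc0l).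
rewrite /fc /= -!/(pk _) -!pk_h -!pk_v; apply: pk_eq; exact: (mod_h (lS P s)).
Qed.
Opaque pk hc vc fc ph phV un unV idv idh Hs Hg Vs.
Definition hv_nat X X' X1 X1' (x : cell X X' X1 X1') Y Y1 (u : ver Y Y1) :
  hv (top x) u [/] fc (R Y1) x = fc (R Y) x [/] hv (bot x) u := V_nat (stR u) x.
Definition vh_nat X X' X1 X1' (x : cell X X' X1 X1') Y Y1 (u : ver Y Y1) :
  vh u (top x) [/] fc (L Y1) x = fc (L Y) x [/] vh u (bot x) := V_nat (stL u) x.
(** 1v-cells in different slots commute strictly; otherwise [boxv] would preserve vertical
    composites only up to a globular cell. *)
Definition sw X X1 (u : ver X X1) Y Y1 (v : ver Y Y1) :
  pf_v (L X) v // pf_v (R Y1) u = pf_v (R Y) u // pf_v (L X1) v := V_sw (stR v) u.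

Definition boxh X X' (K : hom X X') Y Y' (k : hom Y Y') := pf_h (R Y) K >> pf_h (L X') k.
Definition boxv X X1 (U : ver X X1) Y Y1 (u : ver Y Y1) := pf_v (R Y) U // pf_v (L X1) u.
(** The factor [vh (rgt x) (top y)] uses the left structure of the 1v-cell, while [box_s] uses the
    right structure of the 1h-cell; [exch_vh] identifies them. *)
Definition boxs X X' X1 X1' (x : cell X X' X1 X1') Y Y' Y1 Y1' (y : cell Y Y' Y1 Y1') :=
  (fc (R Y) x [/] hv (bot x) (lft y)) [|] (vh (rgt x) (top y) [/] fc (L X1') y).
Definition boxc X X' X'' (K : hom X X') (K' : hom X' X'') Y Y' Y'' (k : hom Y Y') (k' : hom Y' Y'') :=
  (idv (pf_h (R Y) K) [|] chi K' k [|] idv (pf_h (L X'') k'))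
  [/] (ph (R Y) K K' [|] ph (L X'') k k').

Lemma LV X A A1 A2 (u : ver A A1) (v : ver A1 A2) :
  pf_v (L X) (u // v) = pf_v (L X) u // pf_v (L X) v.
Proof. exact: (pf_vcomp (lt_pf P X)). Qed.

Lemma RV X A A1 A2 (u : ver A A1) (v : ver A1 A2) :
  pf_v (R X) (u // v) = pf_v (R X) u // pf_v (R X) v.
Proof. exact: (pf_vcomp (rt_pf P X)). Qed.

Ltac bd ::= rewrite /boxs /boxc /boxh /boxv; bds; hyps; rewrite ?hassoc ?hid_l ?hid_r ?LV ?RV ?vid_l ?vid_r ?pf_vid ?vid_l ?vid_r ?vassoc;
  first [reflexivity | repeat match goal with H : @eq (cell _ _ _ _) _ _ |- _ => clear H end; congruence].
Lemma boxv_v X X1 X2 (U : ver X X1) (U1 : ver X1 X2) Y Y1 Y2 (u : ver Y Y1) (u1 : ver Y1 Y2) :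
  boxv (U // U1) (u // u1) = boxv U u // boxv U1 u1.
Proof. by rewrite /boxv LV RV !vassoc -[pf_v (L X1) u // _]vassoc sw !vassoc. Qed.

Lemma hv_v X X' (K : hom X X') Y Y1 Y2 (u : ver Y Y1) (v : ver Y1 Y2) :
  hv K (u // v) = hv K u [/] hv K v.
Proof. rewrite -!hvE; exact: (Hs_v (lH P K)). Qed.

Lemma vh_v X X1 X2 (U : ver X X1) (V : ver X1 X2) Y Y1 (k : hom Y Y1) :
  vh (U // V) k = vh U k [/] vh V k.
Proof. rewrite -!vhE; exact: (Hs_v (rH P k)). Qed.

Lemma hv_vid X X' (K : hom X X') Y :
  hv K (vid Y) = idv (pf_h (R Y) K).
Proof. rewrite -!hvE; exact: (Hs_vid (lH P K)). Qed.

Lemma vh_vid X Y Y' (k : hom Y Y') :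
  vh (vid X) k = idv (pf_h (L X) k).
Proof. rewrite -!vhE; exact: (Hs_vid (rH P k)). Qed.

(** In each of the two columns the inner two cells stand in the wrong order; [hv_nat] repairs the
    left column and [vh_nat] the right one. *)
Lemma boxs_v X X' X1 X1' X2 X2' (x : cell X X' X1 X1') (x1 : cell X1 X1' X2 X2')
   Y Y' Y1 Y1' Y2 Y2' (y : cell Y Y' Y1 Y1') (y1 : cell Y1 Y1' Y2 Y2') :
  bot x = top x1 -> bot y = top y1 ->
  boxs (x [/] x1) (y [/] y1) = boxs x y [/] boxs x1 y1.
Proof.
move=> e e1.
(* Swap laws are put into the context because the sides compared by [inter] agree only up to them;
   [bd] then finds the equations by congruence. The same device recurs below. *)
have e2 := sw (rgt x) (lft y1); have e3 := sw (rgt x1) (lft y1).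
rewrite /boxs inter; sd.
rewrite (fc_v (rt_pf P _)); sd; rewrite (fc_v (lt_pf P _)); sd; rewrite hv_v vh_v !vcA.
by rewrite ?vcB ?hcB /= -(vcR _ (hv_nat _ _)) (vcR _ (vh_nat y _)) e e1.
Qed.

Lemma boxs_id X X' (K : hom X X') Y Y' (k : hom Y Y') :
  boxs (idv K) (idv k) = idv (boxh K k).
Proof.
rewrite /boxs (fc_idv (rt_pf P _)) (fc_idv (lt_pf P _)) !idvB hv_vid vh_vid idv_h !vc1l; sd; by [].
Qed.

Lemma chi_nat X X' (K : hom X X') Y Y' Y1 Y1' (y : cell Y Y' Y1 Y1') :
  (fc (L X) y [|] hv K (rgt y)) [/] chi K (bot y)
  = chi K (top y) [/] (hv K (lft y) [|] fc (L X') y).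
Proof. by rewrite -!hvE (H_nat (lH P K)). Qed.

(** Two products side by side give four columns. The exchange cell lies under the inner two, where
    [mid] combines both naturalities of [chi]. The compositors then join first with second and third
    with fourth ([col1], [col2]). *)
Lemma boxc_nat X X' X'' X1 X1' X1'' (x : cell X X' X1 X1') (x' : cell X' X'' X1' X1'')
   Y Y' Y'' Y1 Y1' Y1'' (y : cell Y Y' Y1 Y1') (y' : cell Y' Y'' Y1' Y1'') :
  rgt x = lft x' -> rgt y = lft y' ->
  (boxs x y [|] boxs x' y') [/] boxc (bot x) (bot x') (bot y) (bot y')
  = boxc (top x) (top x') (top y) (top y') [/] boxs (x [|] x') (y [|] y').
Proof.
move=> e e'.
have w1 := sw (rgt x) (rgt y); have w2 := sw (rgt x') (lft y).
have w3 := sw (rgt x) (lft y); have w4 := sw (rgt x') (rgt y).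
have mid : ((vh (rgt x) (top y) [/] fc (L X1') y)
     [|] (fc (R Y') x' [/] hv (bot x') (lft y'))) [/] chi (bot x') (bot y)
   = chi (top x') (top y) [/] ((fc (R Y) x' [/] hv (bot x') (lft y))
     [|] (vh (rgt x') (top y) [/] fc (L X1'') y)).
  rewrite -inter; sd; rewrite !vcA -e' chi_nat e (vcR _ (lS_h _ _)) inter; sd; by [].
have col1 : ((fc (R Y) x [/] hv (bot x) (lft y)) [|] (fc (R Y) x' [/] hv (bot x') (lft y)))
    [/] ph (R Y1) (bot x) (bot x')
  = ph (R Y) (top x) (top x') [/] (fc (R Y) (x [|] x') [/] hv (bot x >> bot x') (lft y)).
  rewrite -inter; sd; rewrite vcA (Vs_comp (rV P (lft y))) -vcA (ph_nat (rt_pf P Y)); sd; by rewrite vcA.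
have col2 : ((vh (rgt x') (top y) [/] fc (L X1'') y) [|] (vh (rgt x') (top y') [/] fc (L X1'') y'))
    [/] ph (L X1'') (bot y) (bot y')
  = ph (L X'') (top y) (top y') [/] (vh (rgt x') (top y >> top y') [/] fc (L X1'') (y [|] y')).
  rewrite -inter; sd; rewrite vcA (ph_nat (lt_pf P X1'')); sd; by rewrite (vcR _ (Vs_comp (lV P (rgt x')) _ _)).
rewrite /boxs /boxc !hcB [RHS]vcA [X in _ = _ [/] X]inter; sd; rewrite -col1 -col2 -[X in _ = _ [/] X]inter; sd.
rewrite -[RHS]vcA -[LHS]vcA; congr (_ [/] _).
rewrite !hcA -(hcA (vh _ _ [/] _)) inter; sd; rewrite inter; sd; rewrite mid !vc1r; sd.
by rewrite -(hcA (fc _ x' [/] _)) [RHS]inter; sd; rewrite inter; sd; rewrite !vc1l; sd.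
Qed.

Lemma boxcW X X' X'' (K : hom X X') (K' : hom X' X'') Y Y' Y'' (k : hom Y Y') (k' : hom Y' Y'') :
  boxc K K' k k' = W (pf_h (R Y) K) (chi K' k) (pf_h (L X'') k')
    [/] W (hid _) (ph (R Y) K K') (pf_h (L X'') k >> pf_h (L X'') k')
    [/] W (pf_h (R Y) (K >> K')) (ph (L X'') k k') (hid _).
Proof. by rewrite /boxc [ph (R Y) K K' [|] _]hW; sd. Qed.

Lemma chi_r A E X X' (K : hom X X') Y Y' Y'' (k : hom Y Y') (k' : hom Y' Y'')
  (a a' : hom A _) (b : hom _ E) c : c = pf_h (R Y'') K >> b -> a' = a ->
  W a (ph (L X) k k') c [/] W a' (chi K (k >> k')) b
  = W (a >> pf_h (L X) k) (chi K k') b [/] W a (chi K k) (pf_h (L X') k' >> b)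
    [/] W (a >> pf_h (R Y) K) (ph (L X') k k') b.
Proof.
move=> -> ->; have := Hg_comp (lH P K) k k'.
rewrite [_ [|] idv _]hWl; sd; rewrite ![idv _ [|] _]hWr; sd; rewrite [_ [|] idv _]hWl; sd => e.
have e' := f_equal (fun z => W a z b) e; move: e'.
rewrite !W_v; sd; by rewrite !W_W !hid_r !hid_l.
Qed.

(** The composition law of the right structure of [k] concerns the inverse cells [chiV]; composing
    with [chi] on both sides turns it into a law for [chi]. *)
Lemma chi_l A E X X' X'' (K : hom X X') (K' : hom X' X'') Y Y' (k : hom Y Y')
  (a a' : hom A _) (b : hom _ E) c : a' = a >> pf_h (L X) k -> c = b ->
  W a' (ph (R Y') K K') b [/] W a (chi (K >> K') k) c
  = W a (chi K k) (pf_h (R Y') K' >> b) [/] W (a >> pf_h (R Y) K) (chi K' k) b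
    [/] W a (ph (R Y) K K') (pf_h (L X'') k >> b).
Proof.
move=> -> ->; have := Hg_comp (rH P k) K K'.
rewrite [_ [|] idv _]hWl; sd; rewrite ![idv _ [|] _]hWr; sd; rewrite [_ [|] idv _]hWl; sd => e.
have V1 : W (pf_h (R Y) K) (chi K' k) (hid _) [/] W (pf_h (R Y) K) (chiV K' k) (hid _)
   = idv (pf_h (R Y) K >> pf_h (L X') k >> pf_h (R Y') K').
  by rewrite -W_v; sd; rewrite chiK W_idv hid_r hassoc.
have V2 : W (hid _) (chi K k) (pf_h (R Y') K') [/] W (hid _) (chiV K k) (pf_h (R Y') K')
   = idv (pf_h (L X) k >> pf_h (R Y') K >> pf_h (R Y') K').
  by rewrite -W_v; sd; rewrite chiK W_idv hid_l.
have {}e : W (pf_h (L X) k) (ph (R Y') K K') (hid _) [/] chi (K >> K') k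
  = W (hid _) (chi K k) (pf_h (R Y') K') [/] W (pf_h (R Y) K) (chi K' k) (hid _) [/]
  W (hid _) (ph (R Y) K K') (pf_h (L X'') k).
  rewrite -[W _ (ph (R Y) K K') _](vc1r (f := pf_h (R Y) (K >> K') >> pf_h (L X'') k)); sd.
  by rewrite -chiVK -[W _ (ph (R Y) K K') _ [/] _]vcA e !vcA (vcR1 _ V1) vc1l; sd; rewrite (vcR1 _ V2) vc1l; sd.
have e' := f_equal (fun z => W a z b) e; move: e'.
rewrite !W_v; sd; by rewrite !W_W !hid_r !hid_l.
Qed.

Ltac nf := rewrite ?W_v; sd; rewrite ?W_W /boxh; na.
(** Both sides contain the exchange cells at [(K', k)], [(K'', k')] and [(K'', k)]. On the left the
    last two come from splitting [chi K'' (k >> k')], on the right the first and the last come from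
    splitting [chi (K' >> K'') k]. All compositors are moved below them and matched by
    [ph_assocW]. *)
Lemma boxc_assoc X X' X'' X3 (K : hom X X') (K' : hom X' X'') (K'' : hom X'' X3)
   Y Y' Y'' Y3 (k : hom Y Y') (k' : hom Y' Y'') (k'' : hom Y'' Y3) :
  (boxc K K' k k' [|] idv (boxh K'' k'')) [/] boxc (K >> K') K'' (k >> k') k''
  = (idv (boxh K k) [|] boxc K' K'' k' k'') [/] boxc K (K' >> K'') k (k' >> k'').
Proof.
rewrite hWl; sd; rewrite hWr; sd; rewrite !boxcW.
nf.
rewrite (vcR _ (chi_r _ _ _ _)); sd; na.
wsw (ph (R Y) K K') (pf_h (L X'') k) (chi K'' k').
wsw (ph (R Y) K K') (hid _) (chi K'' k).
wsw' (ph (R Y) (K >> K') K'') (hid _) (ph (L X3) k k').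
rewrite (ph_assocW (lt_pf P X3)); sd; na.
rewrite (vcR _ (ph_assocW (rt_pf P Y) K K' (h:=K'') _ _)); sd; na.
wsw' (chi (K' >> K'') k) (hid _) (ph (L X3) k' k'').
wsw' (ph (R Y) K (K' >> K'')) (pf_h (L X3) k) (ph (L X3) k' k'').
rewrite (vcR _ (chi_l K' K'' (k:=k) _ _)); sd; na.
(* The first two exchange cells act at disjoint places; only their order still differs. *)
wsw' (chi K' k) (hid _) (chi K'' k').
by [].
Qed.

Lemma chi_hid_r A E X X' (K : hom X X') Y (a a' : hom A _) (b : hom _ E) c :
  c = pf_h (R Y) K >> b -> a' = a ->
  W a (un (L X) Y) c [/] W a' (chi K (hid Y)) b = W (a >> pf_h (R Y) K) (un (L X') Y) b.
Proof.
move=> -> ->; have := Hg_hid (lH P K) Y.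
rewrite [_ [|] idv _]hWl; sd; rewrite ![idv _ [|] _]hWr; sd => e.
have e' := f_equal (fun z => W a z b) e; move: e'.
rewrite !W_v; sd; by rewrite !W_W !hid_r !hid_l.
Qed.

Lemma chi_hid_l A E X Y Y' (k : hom Y Y') (a a' : hom A _) (b : hom _ E) c :
  a' = a >> pf_h (L X) k -> c = b ->
  W a' (un (R Y') X) b [/] W a (chi (hid X) k) c = W a (un (R Y) X) (pf_h (L X) k >> b).
Proof.
move=> -> ->; have := Hg_hid (rH P k) X.
rewrite [_ [|] idv _]hWl; sd; rewrite ![idv _ [|] _]hWr; sd => e.
have {}e : W (pf_h (L X) k) (un (R Y') X) (hid _) [/] chi (hid X) k = W (hid _) (un (R Y) X) (pf_h (L X) k).
  by rewrite -e vcA chiVK vc1r; sd.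
have e' := f_equal (fun z => W a z b) e; move: e'.
rewrite !W_v; sd; by rewrite !W_W !hid_r !hid_l.
Qed.

Definition boxu X Y := un (R Y) X [|] un (L X) Y.
Lemma boxuW X Y : boxu X Y = W (hid _) (un (R Y) X) (hid _) [/] W (pf_h (R Y) (hid X)) (un (L X) Y) (hid _).
Proof. rewrite /boxu hW; sd; by []. Qed.

Lemma boxc_unl X X' (K : hom X X') Y Y' (k : hom Y Y') :
  (boxu X Y [|] idv (boxh K k)) [/] boxc (hid X) K (hid Y) k = idv (boxh K k).
Proof.
rewrite hWl; sd; rewrite boxcW boxuW; nf.
rewrite (vcR1 _ (chi_hid_r _ _)); sd; na.
wsw' (ph (R Y) (hid X) K) (hid _) (un (L X') Y).
rewrite (ph_unlW (lt_pf P X')); sd; na.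
rewrite (vcR1 _ (ph_unlW (rt_pf P Y) (f:=K) _ _)); sd; na.
by rewrite vc1l; sd.
Qed.

Lemma boxc_unr X X' (K : hom X X') Y Y' (k : hom Y Y') :
  (idv (boxh K k) [|] boxu X' Y') [/] boxc K (hid X') k (hid Y') = idv (boxh K k).
Proof.
rewrite hWr; sd; rewrite boxcW boxuW; nf.
wsw' (chi (hid X') k) (hid _) (un (L X') Y').
rewrite (vcR1 _ (chi_hid_l _ _)); sd; na.
wsw' (ph (R Y) K (hid X')) (pf_h (L X') k) (un (L X') Y').
rewrite (ph_unrW (lt_pf P X')); sd; na.
rewrite (vcR1 _ (ph_unrW (rt_pf P Y) (f:=K) _ _)); sd; na.
by rewrite vc1l; sd.
Qed.

Lemma boxu_nat X X' Y Y' (U : ver X X') (u : ver Y Y') :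
  idh (boxv U u) [/] boxu X' Y' = boxu X Y [/] boxs (idh U) (idh u).
Proof.
have e1 := sw U u.
rewrite /boxu /boxs inter; sd; rewrite -!vcA -(un_nat (rt_pf P Y)).
rewrite (vcA (idh _)) -(Vs_hid (rV P u) X') -vcA -idh_v.
rewrite -(Vs_hid (lV P U) Y) vcA -(un_nat (lt_pf P X')) -vcA -idh_v.
rewrite -inter; sd; congr (_ [/] _); by rewrite /boxv hc1r; sd.
Qed.

Definition boxcV X X' X'' (K : hom X X') (K' : hom X' X'') Y Y' Y'' (k : hom Y Y') (k' : hom Y' Y'') :=
  (phV (R Y) K K' [|] phV (L X'') k k')
  [/] (idv (pf_h (R Y) K) [|] chiV K' k [|] idv (pf_h (L X'') k')).
Definition boxuV X Y := unV (R Y) X [|] unV (L X) Y.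

Lemma boxcK X X' X'' (K : hom X X') (K' : hom X' X'') Y Y' Y'' (k : hom Y Y') (k' : hom Y' Y'') :
  boxc K K' k k' [/] boxcV K K' k k' = idv (boxh K k >> boxh K' k').
Proof.
have e : (ph (R Y) K K' [|] ph (L X'') k k') [/] (phV (R Y) K K' [|] phV (L X'') k k')
   = idv (pf_h (R Y) K >> pf_h (R Y) K' >> (pf_h (L X'') k >> pf_h (L X'') k')).
  by rewrite inter; sd; rewrite (phK (rt_pf P Y)) (phK (lt_pf P X'')) -idv_h.
rewrite /boxc /boxcV vcA (vcR1 _ e) vc1l; sd.
rewrite -!/(W _ _ _) -W_v; sd; by rewrite chiK W_idv /boxh; na.
Qed.

Lemma boxcVK X X' X'' (K : hom X X') (K' : hom X' X'') Y Y' Y'' (k : hom Y Y') (k' : hom Y' Y'') :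
  boxcV K K' k k' [/] boxc K K' k k' = idv (boxh (K >> K') (k >> k')).
Proof.
have e : W (pf_h (R Y) K) (chiV K' k) (pf_h (L X'') k') [/] W (pf_h (R Y) K) (chi K' k) (pf_h (L X'') k')
   = idv (pf_h (R Y) K >> pf_h (R Y) K' >> (pf_h (L X'') k >> pf_h (L X'') k')).
  by rewrite -W_v; sd; rewrite chiVK W_idv; na.
rewrite /boxc /boxcV !vcA (vcR1 _ e) vc1l; sd.
by rewrite inter; sd; rewrite (phVK (rt_pf P Y)) (phVK (lt_pf P X'')) -idv_h.
Qed.

Lemma boxuK X Y : boxu X Y [/] boxuV X Y = idv (hid _).
Proof.
by rewrite inter; sd; rewrite (unK (rt_pf P Y)) (unK (lt_pf P X)) -idv_h hid_l.
Qed.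

Lemma boxuVK X Y : boxuV X Y [/] boxu X Y = idv (boxh (hid X) (hid Y)).
Proof.
by rewrite inter; sd; rewrite (unVK (rt_pf P Y)) (unVK (lt_pf P X)) -idv_h.
Qed.

(** * Associativity *)

Notation A1 K Y Z := (Vs (al1 P Y Z) K).
Notation A2 X k Z := (Vs (al2 P X Z) k).
Notation A3 X Y h := (Vs (al3 P X Y) h).

Lemma phV_nat (C D : double_cat) (F0 : ob C -> ob D) (F : pfdata F0) (HF : is_pf F)
  (A A' A'' A1 A1' A1'' : ob C) (x : cell A A' A1 A1') (y : cell A' A'' A1' A1'') :
  rgt x = lft y ->
  phV F (top x) (top y) [/] (fc F x [|] fc F y) = fc F (x [|] y) [/] phV F (bot x) (bot y).
Proof.
move=> e.
rewrite -[fc F x [|] fc F y](vc1r (f := pf_h F (bot x) >> pf_h F (bot y))); sd.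
by rewrite -(phK HF) -[(_ [|] _) [/] _]vcA (ph_nat HF) // -!vcA (phVK HF) vc1l; sd.
Qed.

Lemma phV_V (C D : double_cat) (F0 G0 : ob C -> ob D) (F : pfdata F0) (G : pfdata G0)
  (HF : is_pf F) (HG : is_pf G) (c : forall A, ver (F0 A) (G0 A)) (a : vtrans F G c)
  (A A' A'' : ob C) (k : hom A A') (k' : hom A' A'') :
  phV F k k' [/] (Vs a k [|] Vs a k') = Vs a (k >> k') [/] phV G k k'.
Proof.
rewrite -[Vs a k [|] _](vc1r (f := pf_h G k >> pf_h G k')); sd.
by rewrite -(phK HG) -[(_ [|] _) [/] _]vcA Vs_comp -!vcA (phVK HF) vc1l; sd.
Qed.

Lemma a1_nat X X' X1 X1' (x : cell X X' X1 X1') Y Z :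
  A1 (top x) Y Z [/] fc (R (bow P Y Z)) x = fc (R Z) (fc (R Y) x) [/] A1 (bot x) Y Z.
Proof. by rewrite (V_nat (isv_strict (al1 P Y Z))) fc_pfcomp. Qed.

Lemma a2_nat X Y Y' Y1 Y1' (x : cell Y Y' Y1 Y1') Z :
  A2 X (top x) Z [/] fc (L X) (fc (R Z) x) = fc (R Z) (fc (L X) x) [/] A2 X (bot x) Z.
Proof. by have := V_nat (isv_strict (al2 P X Z)) x; rewrite !fc_pfcomp. Qed.

Lemma a3_nat X Y Z Z' Z1 Z1' (x : cell Z Z' Z1 Z1') :
  A3 X Y (top x) [/] fc (L X) (fc (L Y) x) = fc (L (bow P X Y)) x [/] A3 X Y (bot x).
Proof. by have := V_nat (isv_strict (al3 P X Y)) x; rewrite !fc_pfcomp. Qed.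

Transparent pk fc Vs Hs Hg.
Lemma assoc_12_hv_cell X X' (K : hom X X') Y Y1 (u : ver Y Y1) Z :
  fc (R Z) (hv K u) [/] A1 K Y1 Z = A1 K Y Z [/] hv K (pf_v (R Z) u).
Proof.
rewrite -?hvE.
exact: etrans (esym (pk_v _ _)) (etrans (pk_eq (assoc_12_hv P K u Z)) (pk_v _ _)).
Qed.

Lemma assoc_12_vh_cell X X1 (U : ver X X1) Y Y' (k : hom Y Y') Z :
  fc (R Z) (vh U k) [/] A2 X1 k Z = A2 X k Z [/] vh U (pf_h (R Z) k).
Proof.
rewrite -?hvE.
exact: etrans (esym (pk_v _ _)) (etrans (pk_eq (assoc_12_vh P U k Z)) (pk_v _ _)).
Qed.

Lemma assoc_13_hv_cell X X' (K : hom X X') Y Z Z1 (u : ver Z Z1) :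
  hv (pf_h (R Y) K) u [/] A1 K Y Z1 = A1 K Y Z [/] hv K (pf_v (L Y) u).
Proof.
rewrite -?hvE.
exact: etrans (esym (pk_v _ _)) (etrans (pk_eq (assoc_13_hv P K Y u)) (pk_v _ _)).
Qed.

Lemma assoc_13_vh_cell X X1 (U : ver X X1) Y Z Z' (k : hom Z Z') :
  vh (pf_v (R Y) U) k [/] A3 X1 Y k = A3 X Y k [/] vh U (pf_h (L Y) k).
Proof.
rewrite -?hvE.
exact: etrans (esym (pk_v _ _)) (etrans (pk_eq (assoc_13_vh P U Y k)) (pk_v _ _)).
Qed.

Lemma assoc_23_hv_cell X Y Y' (K : hom Y Y') Z Z1 (u : ver Z Z1) :
  hv (pf_h (L X) K) u [/] A2 X K Z1 = A2 X K Z [/] fc (L X) (hv K u).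
Proof.
rewrite -?hvE.
exact: etrans (esym (pk_v _ _)) (etrans (pk_eq (assoc_23_hv P X K u)) (pk_v _ _)).
Qed.

Lemma assoc_23_vh_cell X Y Y1 (U : ver Y Y1) Z Z' (k : hom Z Z') :
  vh (pf_v (L X) U) k [/] A3 X Y1 k = A3 X Y k [/] fc (L X) (vh U k).
Proof.
rewrite -?hvE.
exact: etrans (esym (pk_v _ _)) (etrans (pk_eq (assoc_23_vh P X U k)) (pk_v _ _)).
Qed.
Transparent ph phV.
Lemma assoc_12_hh_cell X X' (K : hom X X') Y Y' (k : hom Y Y') Z :
  (ph (R Z) (pf_h (L X) k) (pf_h (R Y') K) [/] fc (R Z) (chi K k)
     [/] phV (R Z) (pf_h (R Y) K) (pf_h (L X') k)) [/] (A1 K Y Z [|] A2 X' k Z)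
  = (A2 X k Z [|] A1 K Y' Z) [/] chi K (pf_h (R Z) k).
Proof.
have := pk_eq (assoc_12_hh P K k Z); rewrite /img_h !pk_v !pk_h !vcA; exact.
Qed.

Lemma assoc_13_hh_cell X X' (K : hom X X') Y Z Z' (k : hom Z Z') :
  chi (pf_h (R Y) K) k [/] (A1 K Y Z [|] A3 X' Y k)
  = (A3 X Y k [|] A1 K Y Z') [/] chi K (pf_h (L Y) k).
Proof.
have := pk_eq (assoc_13_hh P K Y k); rewrite !pk_v !pk_h; exact.
Qed.

Lemma assoc_23_hh_cell X Y Y' (K : hom Y Y') Z Z' (k : hom Z Z') :
  chi (pf_h (L X) K) k [/] (A2 X K Z [|] A3 X Y' k)
  = (A3 X Y k [|] A2 X K Z') [/] (ph (L X) (pf_h (L Y) k) (pf_h (R Z') K)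
       [/] fc (L X) (chi K k) [/] phV (L X) (pf_h (R Z) K) (pf_h (L Y') k)).
Proof.
have := pk_eq (assoc_23_hh P X K k); rewrite /img_h !pk_v !pk_h !vcA; exact.
Qed.
Opaque pk fc Vs Hs Hg ph phV.

Lemma al_sw1 X X1 (U : ver X X1) Y Z :
  al P X Y Z // pf_v (R (bow P Y Z)) U = pf_v (R Z) (pf_v (R Y) U) // al P X1 Y Z.
Proof. exact: (V_sw (isv_strict (al1 P Y Z)) U). Qed.

Lemma al_sw2 X Y Y1 (U : ver Y Y1) Z :
  al P X Y Z // pf_v (L X) (pf_v (R Z) U) = pf_v (R Z) (pf_v (L X) U) // al P X Y1 Z.
Proof. exact: (V_sw (isv_strict (al2 P X Z)) U). Qed.

Lemma al_sw3 X Y Z Z1 (U : ver Z Z1) :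
  al P X Y Z // pf_v (L X) (pf_v (L Y) U) = pf_v (L (bow P X Y)) U // al P X Y Z1.
Proof. exact: (V_sw (isv_strict (al3 P X Y)) U). Qed.

Lemma al_sw X X1 (U : ver X X1) Y Y1 (u : ver Y Y1) Z Z1 (w : ver Z Z1) :
  al P X Y Z // boxv U (boxv u w) = boxv (boxv U u) w // al P X1 Y1 Z1.
Proof.
rewrite /boxv !LV !RV -vassoc al_sw1 !vassoc; congr (_ // _).
by rewrite -vassoc al_sw2 !vassoc al_sw3.
Qed.

Definition assoc_cell X X' (K : hom X X') Y Y' (k : hom Y Y') Z Z' (h : hom Z Z') :=
  (phV (R Z) (pf_h (R Y) K) (pf_h (L X') k) [|] idv (pf_h (L (bow P X' Y')) h))
  [/] (A1 K Y Z [|] A2 X' k Z [|] A3 X' Y' h)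
  [/] (idv (pf_h (R (bow P Y Z)) K) [|] ph (L X') (pf_h (R Z) k) (pf_h (L Y') h)).

(** The right column of [boxs] at a horizontal composite splits in two. [phVR_col] does the same for
    the left column, with the inverse compositor, since that is the one at the top of
    [assoc_cell]. *)
Lemma phL_col X X1 (U : ver X X1) Y Y' Y'' Y1 Y1' Y1'' (d1 : cell Y Y' Y1 Y1') (d2 : cell Y' Y'' Y1' Y1'') :
  rgt d1 = lft d2 ->
  ph (L X) (top d1) (top d2) [/] (vh U (top d1 >> top d2) [/] fc (L X1) (d1 [|] d2))
  = ((vh U (top d1) [/] fc (L X1) d1) [|] (vh U (top d2) [/] fc (L X1) d2))
     [/] ph (L X1) (bot d1) (bot d2).
Proof.
move=> e; have e1 := sw U (rgt d1).
rewrite -(vcR _ (Vs_comp (lV P U) _ _)) -(ph_nat (lt_pf P X1)) // -vcA inter; sd; by [].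
Qed.

Lemma phVR_col X X' X'' X1 X1' X1'' (c1 : cell X X' X1 X1') (c2 : cell X' X'' X1' X1'') Y Y1 (u : ver Y Y1) :
  rgt c1 = lft c2 ->
  (fc (R Y) (c1 [|] c2) [/] hv (bot c1 >> bot c2) u) [/] phV (R Y1) (bot c1) (bot c2)
  = phV (R Y) (top c1) (top c2) [/]
    ((fc (R Y) c1 [/] hv (bot c1) u) [|] (fc (R Y) c2 [/] hv (bot c2) u)).
Proof.
move=> e; rewrite vcA -(phV_V (rt_pf P Y) (rt_pf P Y1) (rV P u)) -vcA -(phV_nat (rt_pf P Y)) //.
by rewrite vcA inter; sd.
Qed.

(** Once [phVR_col] and [phL_col] have split the nested products, one column per argument remains
    ([E1], [E2], [E3]). Each combines naturality of the associativity at that argument with its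
    compatibility with the exchange of a 1h-cell and a 1v-cell, for the two pairs of slots
    containing the argument. *)
Lemma assoc_cell_nat X X' X1 X1' (x : cell X X' X1 X1') Y Y' Y1 Y1' (y : cell Y Y' Y1 Y1')
  Z Z' Z1 Z1' (z : cell Z Z' Z1 Z1') :
  assoc_cell (top x) (top y) (top z) [/] boxs x (boxs y z)
  = boxs (boxs x y) z [/] assoc_cell (bot x) (bot y) (bot z).
Proof.
have E1 : A1 (top x) Y Z [/] (fc (R (bow P Y Z)) x [/] hv (bot x) (boxv (lft y) (lft z)))
  = (fc (R Z) (fc (R Y) x [/] hv (bot x) (lft y)) [/] hv (pf_h (R Y1) (bot x)) (lft z)) [/] A1 (bot x) Y1 Z1.
  rewrite (vcR _ (a1_nat x Y Z)) hv_v.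
  by rewrite (fc_v (rt_pf P Z)); sd; rewrite !vcA assoc_13_hv_cell -(vcR _ (assoc_12_hv_cell _ _ _)).
have E2 : A2 X' (top y) Z [/] (vh (rgt x) (pf_h (R Z) (top y)) [/] fc (L X1') (fc (R Z) y [/] hv (bot y) (lft z)))
  = (fc (R Z) (vh (rgt x) (top y) [/] fc (L X1') y) [/] hv (pf_h (L X1') (bot y)) (lft z)) [/] A2 X1' (bot y) Z1.
  rewrite -(vcR _ (assoc_12_vh_cell (rgt x) (top y) Z)) (fc_v (lt_pf P X1')); sd.
  by rewrite (fc_v (rt_pf P Z)); sd; rewrite !vcA (vcR _ (a2_nat X1' y Z)) assoc_23_hv_cell.
have E3 : A3 X' Y' (top z) [/] (vh (rgt x) (pf_h (L Y') (top z)) [/] fc (L X1') (vh (rgt y) (top z) [/] fc (L Y1') z))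
  = (vh (boxv (rgt x) (rgt y)) (top z) [/] fc (L (bow P X1' Y1')) z) [/] A3 X1' Y1' (bot z).
  rewrite -(vcR _ (assoc_13_vh_cell (rgt x) Y' (top z))) (fc_v (lt_pf P X1')); sd.
  by rewrite -(vcR _ (assoc_23_vh_cell X1' (rgt y) (top z))) a3_nat vh_v !vcA.
have S1 := phL_col (X:=X') (rgt x) (d1 := fc (R Z) y [/] hv (bot y) (lft z))
   (d2 := vh (rgt y) (top z) [/] fc (L Y1') z).
have S0 := phVR_col (c1 := fc (R Y) x [/] hv (bot x) (lft y))
  (c2 := vh (rgt x) (top y) [/] fc (L X1') y) (lft z).
move: S0 S1; rb => S0 S1.
have e1 := al_sw1 (rgt x) Y Z; have e2 := al_sw1 (rgt x) Y Z1.
rewrite /assoc_cell !vcA {1 2 3 4}/boxs.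
rewrite [X in _ [/] _ [/] X = _]inter; sd; rewrite vc1l; sd; rb.
rewrite S1; sd.
rewrite /boxv in E1 E3.
have Lx : (fc (R (bow P Y Z)) x [/] hv (bot x) (pf_v (R Z) (lft y) // pf_v (L Y1) (lft z)))
  [|] (((vh (rgt x) (pf_h (R Z) (top y)) [/] fc (L X1') (fc (R Z) y [/] hv (bot y) (lft z)))
      [|] (vh (rgt x) (pf_h (L Y') (top z)) [/] fc (L X1') (vh (rgt y) (top z) [/] fc (L Y1') z)))
   [/] ph (L X1') (pf_h (R Z1) (bot y)) (pf_h (L Y1') (bot z)))
  = ((fc (R (bow P Y Z)) x [/] hv (bot x) (pf_v (R Z) (lft y) // pf_v (L Y1) (lft z)))
  [|] (vh (rgt x) (pf_h (R Z) (top y)) [/] fc (L X1') (fc (R Z) y [/] hv (bot y) (lft z)))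
      [|] (vh (rgt x) (pf_h (L Y') (top z)) [/] fc (L X1') (vh (rgt y) (top z) [/] fc (L Y1') z)))
  [/] (idv (pf_h (R (bow P Y1 Z1)) (bot x)) [|] ph (L X1') (pf_h (R Z1) (bot y)) (pf_h (L Y1') (bot z))).
  by rewrite inter; sd; rewrite vc1r; sd.
rewrite Lx -(vcA (_ [|] (_ [|] Vs (al3 P X' Y') _))).
have e3 := al_sw2 X' (rgt y) Z. have e4 := al_sw3 X' Y' (rgt z).
have e5 := sw (rgt x) (pf_v (R Z) (rgt y)). have e6 := sw (rgt x) (rgt y).
rewrite [X in _ [/] X [/] _ = _]inter; sd.
rewrite [X in _ [/] (_ [|] X) [/] _ = _]inter; sd.
rewrite E1 E2 E3.
have e7 := sw (pf_v (R Y') (rgt x)) (lft z).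
rewrite -[X in _ [/] (_ [|] X) [/] _ = _]inter; sd.
rewrite -[X in _ [/] X [/] _ = _]inter; sd.
rewrite !vcA -![RHS]vcA -![LHS]vcA; congr ((_ [/] _) [/] _).
rewrite -hcA [LHS]inter; sd; rewrite [RHS]inter; sd.
rewrite S0; sd; rewrite vc1l; sd; by rewrite vc1r; sd.
Qed.

Lemma boxs_idl X X' (K : hom X X') Y Y' (y : cell Y Y' Y Y') : lft y = vid _ ->
  boxs (idv K) y = idv (pf_h (R Y) K) [|] fc (L X') y.
Proof.
move=> e; rewrite /boxs (fc_idv (rt_pf P _)) e; rb.
by rewrite vh_vid vc1l; sd; rewrite hv_vid vc1l; sd.
Qed.

Lemma boxs_idr X X' (x : cell X X' X X') Y Y' (k : hom Y Y') : rgt x = vid _ ->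
  boxs x (idv k) = fc (R Y) x [|] idv (pf_h (L X') k).
Proof.
move=> e; rewrite /boxs (fc_idv (lt_pf P _)) e; rb.
by rewrite vh_vid vc1l; sd; rewrite hv_vid vc1r; sd.
Qed.

(** Normal form of the part below the associativity squares on the left of [assoc_cell_comp]: first
    the exchanges of slots 1 and 3, 1 and 2, 2 and 3, then all compositors. The exchange with a
    composite is split by [chi_r]. *)
Lemma assoc_cell_comp_L X X' X'' (K : hom X X') (K' : hom X' X'') Y Y' Y'' (k : hom Y Y') (k' : hom Y' Y'')
  Z Z' Z'' (h : hom Z Z') (h' : hom Z' Z'') :
  ((idv (pf_h (R (bow P Y Z)) K) [|] ph (L X') (pf_h (R Z) k) (pf_h (L Y') h))
   [|] (idv (pf_h (R (bow P Y' Z')) K') [|] ph (L X'') (pf_h (R Z') k') (pf_h (L Y'') h')))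
  [/] boxc K K' (boxh k h) (boxh k' h') [/] boxs (idv (K >> K')) (boxc k k' h h')
  = W (pf_h (R (bow P Y Z)) K >> pf_h (L X') (pf_h (R Z) k))
      (chi K' (pf_h (L Y') h)) (pf_h (L X'') (pf_h (R Z') k') >> pf_h (L X'') (pf_h (L Y'') h'))
   [/] W (pf_h (R (bow P Y Z)) K) (chi K' (pf_h (R Z) k))
       (pf_h (L X'') (pf_h (L Y') h) >> pf_h (L X'') (pf_h (R Z') k') >> pf_h (L X'') (pf_h (L Y'') h'))
   [/] W (pf_h (R (bow P Y Z)) K >> pf_h (R (bow P Y Z)) K' >> pf_h (L X'') (pf_h (R Z) k))
       (ph (L X'') (pf_h (L Y') h) (pf_h (R Z') k') [/] fc (L X'') (chi k' h) [/]
          phV (L X'') (pf_h (R Z) k') (pf_h (L Y'') h)) (pf_h (L X'') (pf_h (L Y'') h'))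
   [/] (ph (R (bow P Y Z)) K K'
       [|] (ph (L X'') (pf_h (R Z) k) (pf_h (R Z) k') [/] fc (L X'') (ph (R Z) k k'))
       [|] (ph (L X'') (pf_h (L Y'') h) (pf_h (L Y'') h') [/] fc (L X'') (ph (L Y'') h h')))
   [/] (idv (pf_h (R (bow P Y Z)) (K >> K')) [|] ph (L X'') (pf_h (R Z) (k >> k')) (pf_h (L Y'') (h >> h'))).
Proof.
rewrite boxs_idl; sd.
(* [L X''] is applied to a whole compositor [boxc k k' h h']; [img4] isolates the exchange cell
   inside it. *)
have I := img4 (lt_pf P X'') (f := pf_h (R Z) k) (g := pf_h (L Y') h)
  (f' := pf_h (R Z') k') (g' := pf_h (L Y'') h') (f'' := pf_h (R Z) k') (g'' := pf_h (L Y'') h)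
  (s := chi k' h) (x := ph (R Z) k k') (y := ph (L Y'') h h')
  (m := pf_h (R Z) (k >> k')) (n := pf_h (L Y'') (h >> h')).
feed I. move: I; rewrite -/(boxc k k' h h') => I.
rewrite [idv _ [|] fc _ _]hWr; sd.
rewrite (hWr (pf_h (R (bow P Y Z)) K)); sd.
rewrite (hWr (pf_h (R (bow P Y' Z')) K')); sd.
rewrite (hW (x := W _ _ _)); sd.
rewrite boxcW; set RH := (X in _ = X); nf.
wsw' (chi K' (pf_h (R Z) k >> pf_h (L Y') h)) (hid _) (ph (L X'') (pf_h (R Z') k') (pf_h (L Y'') h')).
rewrite (vcR _ (chi_r _ _ _ _)); sd; na.
wsw' (ph (R (bow P Y Z)) K K') (pf_h (L X'') (pf_h (R Z) k >> pf_h (L Y') h))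
   (ph (L X'') (pf_h (R Z') k') (pf_h (L Y'') h')).
wsw' (ph (R (bow P Y Z)) K K') (hid _) (ph (L X'') (pf_h (R Z) k) (pf_h (L Y') h)).
have I' := f_equal (fun z => W (pf_h (R (bow P Y Z)) (K >> K')) z (hid _)) I.
move: I'; set RI := (X in _ = X).
rewrite (hW (x := ph (L X'') (pf_h (R Z) k) _)); sd; nf => ->.
rewrite /RI /RH !hassoc; congr (_ [/] (_ [/] _)).
apply: W_tail; bd.
Qed.

(** Normal form of the part above the associativity squares on the right of [assoc_cell_comp]. Here
    the first argument of the exchange is composite, hence [chi_l], and the functor applied to a
    compositor is [R Z]. *)
Lemma assoc_cell_comp_R X X' X'' (K : hom X X') (K' : hom X' X'') Y Y' Y'' (k : hom Y Y') (k' : hom Y' Y'')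
  Z Z' Z'' (h : hom Z Z') (h' : hom Z' Z'') :
  ((ph (R Z) (pf_h (R Y) K) (pf_h (L X') k) [|] idv (pf_h (L (bow P X' Y')) h))
   [|] (ph (R Z') (pf_h (R Y') K') (pf_h (L X'') k') [|] idv (pf_h (L (bow P X'' Y'')) h')))
  [/] boxc (boxh K k) (boxh K' k') h h' [/] boxs (boxc K K' k k') (idv (h >> h'))
  [/] (phV (R Z) (pf_h (R Y) (K >> K')) (pf_h (L X'') (k >> k')) [|] idv (pf_h (L (bow P X'' Y'')) (h >> h')))
  = W (pf_h (R Z) (pf_h (R Y) K) >> pf_h (R Z) (pf_h (L X') k))
      (chi (pf_h (R Y') K') h) (pf_h (R Z') (pf_h (L X'') k') >> pf_h (L (bow P X'' Y'')) h')
   [/] W (pf_h (R Z) (pf_h (R Y) K) >> pf_h (R Z) (pf_h (L X') k) >> pf_h (R Z) (pf_h (R Y') K'))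
       (chi (pf_h (L X'') k') h) (pf_h (L (bow P X'' Y'')) h')
   [/] W (pf_h (R Z) (pf_h (R Y) K))
       (ph (R Z) (pf_h (L X') k) (pf_h (R Y') K') [/] fc (R Z) (chi K' k) [/]
          phV (R Z) (pf_h (R Y) K') (pf_h (L X'') k))
       (pf_h (R Z) (pf_h (L X'') k') >> pf_h (L (bow P X'' Y'')) h >> pf_h (L (bow P X'' Y'')) h')
   [/] ((ph (R Z) (pf_h (R Y) K) (pf_h (R Y) K') [/] fc (R Z) (ph (R Y) K K'))
       [|] (ph (R Z) (pf_h (L X'') k) (pf_h (L X'') k') [/] fc (R Z) (ph (L X'') k k'))
       [|] ph (L (bow P X'' Y'')) h h').
Proof.
rewrite boxs_idr; sd.
have I := img4 (rt_pf P Z) (f := pf_h (R Y) K) (g := pf_h (L X') k)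
  (f' := pf_h (R Y') K') (g' := pf_h (L X'') k') (f'' := pf_h (R Y) K') (g'' := pf_h (L X'') k)
  (s := chi K' k) (x := ph (R Y) K K') (y := ph (L X'') k k')
  (m := pf_h (R Y) (K >> K')) (n := pf_h (L X'') (k >> k')).
feed I. move: I; rewrite -/(boxc K K' k k') => I.
rewrite !hWl; sd.
rewrite (hW (x := W _ _ _)); sd.
rewrite boxcW; set RH := (X in _ = X); nf.
rewrite (vcR _ (chi_l _ _ _ _)); sd; na.
wsw (ph (R Z) (pf_h (R Y) K) (pf_h (L X') k)) (hid _) (chi (pf_h (R Y') K') h).
wsw (ph (R Z) (pf_h (R Y) K) (pf_h (L X') k)) (pf_h (R Z) (pf_h (R Y') K')) (chi (pf_h (L X'') k') h).
wsw' (fc (R Z) (boxc K K' k k')) (hid _) (ph (L (bow P X'' Y'')) h h').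
wswl' (phV (R Z) (pf_h (R Y) (K >> K')) (pf_h (L X'') (k >> k'))) (hid _) (ph (L (bow P X'' Y'')) h h').
have I' := f_equal (fun z => W (hid _) z (pf_h (L (bow P X'' Y'')) h >> pf_h (L (bow P X'' Y'')) h')) I.
move: I'; set RI := (X in _ = X).
rewrite (hW (x := ph (R Z) (pf_h (R Y) K) _)); sd; nf => I'.
rewrite (vcR4 _ I') /RI /RH.
rewrite (W_tail2 (t' := pf_h (R Z) (pf_h (L X'') k') >> (pf_h (L (bow P X'' Y'')) h >> pf_h (L (bow P X'' Y'')) h'))
  (F := pf_h (R Z) (pf_h (R Y) (K >> K')) >> pf_h (R Z) (pf_h (L X'') (k >> k')))); sd;
  first exact: (phK (rt_pf P Z)).
by rewrite !hassoc.
Qed.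

(** Cancels the inverse compositor at the top of [assoc_cell]. The proofs of the composition law,
    the pentagon and the unit triangles use this form. *)
Lemma assoc_cell_top X X' (K : hom X X') Y Y' (k : hom Y Y') Z Z' (h : hom Z Z') :
  (ph (R Z) (pf_h (R Y) K) (pf_h (L X') k) [|] idv (pf_h (L (bow P X' Y')) h)) [/] assoc_cell K k h
  = (A1 K Y Z [|] A2 X' k Z [|] A3 X' Y' h)
  [/] (idv (pf_h (R (bow P Y Z)) K) [|] ph (L X') (pf_h (R Z) k) (pf_h (L Y') h)).
Proof.
rewrite /assoc_cell -!vcA inter; sd; rewrite (phK (rt_pf P Z)) vc1l; sd.
by rewrite -idv_h vc1l; sd.
Qed.

Lemma a1_comp X X' X'' (K : hom X X') (K' : hom X' X'') Y Z :
  (A1 K Y Z [|] A1 K' Y Z) [/] ph (R (bow P Y Z)) K K'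
  = (ph (R Z) (pf_h (R Y) K) (pf_h (R Y) K') [/] fc (R Z) (ph (R Y) K K')) [/] A1 (K >> K') Y Z.
Proof. by rewrite (Vs_comp (al1 P Y Z)) ph_pfcomp. Qed.

Lemma a2_comp X Y Y' Y'' (k : hom Y Y') (k' : hom Y' Y'') Z :
  (A2 X k Z [|] A2 X k' Z) [/] ph (L X) (pf_h (R Z) k) (pf_h (R Z) k') [/] fc (L X) (ph (R Z) k k')
  = (ph (R Z) (pf_h (L X) k) (pf_h (L X) k') [/] fc (R Z) (ph (L X) k k')) [/] A2 X (k >> k') Z.
Proof. have := Vs_comp (al2 P X Z) k k'; by rewrite !ph_pfcomp. Qed.

Lemma a3_comp X Y Z Z' Z'' (h : hom Z Z') (h' : hom Z' Z'') :
  (A3 X Y h [|] A3 X Y h') [/] ph (L X) (pf_h (L Y) h) (pf_h (L Y) h') [/] fc (L X) (ph (L Y) h h')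
  = ph (L (bow P X Y)) h h' [/] A3 X Y (h >> h').
Proof. have := Vs_comp (al3 P X Y) h h'; by rewrite !ph_pfcomp. Qed.

(** After cancelling the compositors, both sides are chains of three exchange cells
    followed by the same row; each is moved by one of [assoc_12_hh], [assoc_13_hh] and
    [assoc_23_hh]. *)
Lemma assoc_cell_comp X X' X'' (K : hom X X') (K' : hom X' X'') Y Y' Y'' (k : hom Y Y') (k' : hom Y' Y'')
  Z Z' Z'' (h : hom Z Z') (h' : hom Z' Z'') :
  (assoc_cell K k h [|] assoc_cell K' k' h') [/] boxc K K' (boxh k h) (boxh k' h') [/] boxs (idv (K >> K')) (boxc k k' h h')
  = boxc (boxh K k) (boxh K' k') h h' [/] boxs (boxc K K' k k') (idv (h >> h')) [/] assoc_cell (K >> K') (k >> k') (h >> h').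
Proof.
pose t := ph (R Z) (pf_h (R Y) K) (pf_h (L X') k) [|] idv (pf_h (L (bow P X' Y')) h).
pose t' := ph (R Z') (pf_h (R Y') K') (pf_h (L X'') k') [|] idv (pf_h (L (bow P X'' Y'')) h').
pose v := phV (R Z) (pf_h (R Y) K) (pf_h (L X') k) [|] idv (pf_h (L (bow P X' Y')) h).
pose v' := phV (R Z') (pf_h (R Y') K') (pf_h (L X'') k') [|] idv (pf_h (L (bow P X'' Y'')) h').
have vt : (v [|] v') [/] (t [|] t') = idv (boxh (boxh K k) h >> boxh (boxh K' k') h').
  rewrite /v /v' /t /t' inter; sd; rewrite !inter; sd; rewrite (phVK (rt_pf P Z)) (phVK (rt_pf P Z')).
  by rewrite !vc1l; sd; rewrite -!idv_h.
(* [v [|] v'] is a left inverse of [t [|] t'], so both sides may be compared below [t [|] t']. *)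
suff e : (t [|] t') [/] ((assoc_cell K k h [|] assoc_cell K' k' h') [/] boxc K K' (boxh k h) (boxh k' h') [/] boxs (idv (K >> K')) (boxc k k' h h'))
  = (t [|] t') [/] (boxc (boxh K k) (boxh K' k') h h' [/] boxs (boxc K K' k k') (idv (h >> h')) [/] assoc_cell (K >> K') (k >> k') (h >> h')).
  have := f_equal (fun z => (v [|] v') [/] z) e.
  by rewrite -!(vcA (v [|] v')) vt vc1l; sd; rewrite vc1l; sd.
have L0 : (t [|] t') [/] (assoc_cell K k h [|] assoc_cell K' k' h')
  = ((A1 K Y Z [|] A2 X' k Z [|] A3 X' Y' h) [|] (A1 K' Y' Z' [|] A2 X'' k' Z' [|] A3 X'' Y'' h'))
   [/] ((idv (pf_h (R (bow P Y Z)) K) [|] ph (L X') (pf_h (R Z) k) (pf_h (L Y') h))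
   [|] (idv (pf_h (R (bow P Y' Z')) K') [|] ph (L X'') (pf_h (R Z') k') (pf_h (L Y'') h'))).
  rewrite inter; sd; rewrite /t /t' !assoc_cell_top -inter; sd; by [].
rewrite -vcA L0 vcA assoc_cell_comp_L.
have R0 := assoc_cell_comp_R K K' k k' h h'.
have -> : ((t [|] t') [/] boxc (boxh K k) (boxh K' k') h h'
    [/] boxs (boxc K K' k k') (idv (h >> h')) [/] assoc_cell (K >> K') (k >> k') (h >> h')) =
  ((t [|] t') [/] boxc (boxh K k) (boxh K' k') h h' [/] boxs (boxc K K' k k') (idv (h >> h'))
  [/] (phV (R Z) (pf_h (R Y) (K >> K')) (pf_h (L X'') (k >> k')) [|] idv (pf_h (L (bow P X'' Y'')) (h >> h'))))
  [/] (A1 (K >> K') Y Z [|] A2 X'' (k >> k') Z [|] A3 X'' Y'' (h >> h'))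
  [/] (idv (pf_h (R (bow P Y Z)) (K >> K')) [|] ph (L X'') (pf_h (R Z) (k >> k')) (pf_h (L Y'') (h >> h'))).
  by rewrite /assoc_cell !vcA.
rewrite /t /t' R0 !vcA.
have T3 : ((ph (R Z) (pf_h (R Y) K) (pf_h (R Y) K') [/] fc (R Z) (ph (R Y) K K'))
     [|] (ph (R Z) (pf_h (L X'') k) (pf_h (L X'') k') [/] fc (R Z) (ph (L X'') k k'))
     [|] ph (L (bow P X'' Y'')) h h')
   [/] (A1 (K >> K') Y Z [|] A2 X'' (k >> k') Z [|] A3 X'' Y'' (h >> h'))
  = ((A1 K Y Z [|] A1 K' Y Z) [|] (A2 X'' k Z [|] A2 X'' k' Z) [|] (A3 X'' Y'' h [|] A3 X'' Y'' h'))
   [/] (ph (R (bow P Y Z)) K K'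
       [|] (ph (L X'') (pf_h (R Z) k) (pf_h (R Z) k') [/] fc (L X'') (ph (R Z) k k'))
       [|] (ph (L X'') (pf_h (L Y'') h) (pf_h (L Y'') h') [/] fc (L X'') (ph (L Y'') h h'))).
  rewrite inter; sd; rewrite [X in _ [|] X = _]inter; sd.
  rewrite -a1_comp -a2_comp -a3_comp -[X in _ [|] X = _]inter; sd; rewrite -inter; sd; by [].
rewrite -(vcA _ (A1 _ Y Z [|] _)) T3 !vcA.
(* The digits name the two slots whose exchange cell passes the row. *)
have S13 :
  ((A1 K Y Z [|] A2 X' k Z) [|] (A3 X' Y' h [|] A1 K' Y' Z') [|] (A2 X'' k' Z' [|] A3 X'' Y'' h'))
   [/] W (pf_h (R (bow P Y Z)) K >> pf_h (L X') (pf_h (R Z) k)) (chi K' (pf_h (L Y') h)) (pf_h (L X'') (pf_h (R Z') k') >> pf_h (L X'') (pf_h (L Y'') h'))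
  = W (pf_h (R Z) (pf_h (R Y) K) >> pf_h (R Z) (pf_h (L X') k)) (chi (pf_h (R Y') K') h) (pf_h (R Z') (pf_h (L X'') k') >> pf_h (L (bow P X'' Y'')) h')
   [/] ((A1 K Y Z [|] A2 X' k Z) [|] (A1 K' Y' Z [|] A3 X'' Y' h) [|] (A2 X'' k' Z' [|] A3 X'' Y'' h')).
  apply: row_slide; sd; exact: esym (assoc_13_hh_cell _ _ _).
have S12 :
  (A1 K Y Z [|] (A2 X' k Z [|] A1 K' Y' Z) [|] (A3 X'' Y' h [|] A2 X'' k' Z' [|] A3 X'' Y'' h'))
   [/] W (pf_h (R (bow P Y Z)) K) (chi K' (pf_h (R Z) k)) (pf_h (L X'') (pf_h (L Y') h) >> pf_h (L X'') (pf_h (R Z') k') >> pf_h (L X'') (pf_h (L Y'') h'))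
  = W (pf_h (R Z) (pf_h (R Y) K)) (ph (R Z) (pf_h (L X') k) (pf_h (R Y') K') [/] fc (R Z) (chi K' k) [/]
          phV (R Z) (pf_h (R Y) K') (pf_h (L X'') k)) (pf_h (L (bow P X'' Y')) h >> pf_h (R Z') (pf_h (L X'') k') >> pf_h (L (bow P X'' Y'')) h')
   [/] (A1 K Y Z [|] (A1 K' Y Z [|] A2 X'' k Z) [|] (A3 X'' Y' h [|] A2 X'' k' Z' [|] A3 X'' Y'' h')).
  apply: row_slide; sd; exact: esym (assoc_12_hh_cell _ _ _).
have S23 :
  ((A1 K Y Z [|] A1 K' Y Z [|] A2 X'' k Z) [|] (A3 X'' Y' h [|] A2 X'' k' Z') [|] A3 X'' Y'' h')
   [/] W (pf_h (R (bow P Y Z)) K >> pf_h (R (bow P Y Z)) K' >> pf_h (L X'') (pf_h (R Z) k)) (ph (L X'') (pf_h (L Y') h) (pf_h (R Z') k') [/] fc (L X'') (chi k' h) [/]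
          phV (L X'') (pf_h (R Z) k') (pf_h (L Y'') h)) (pf_h (L X'') (pf_h (L Y'') h'))
  = W (pf_h (R Z) (pf_h (R Y) K) >> pf_h (R Z) (pf_h (R Y) K') >> pf_h (R Z) (pf_h (L X'') k)) (chi (pf_h (L X'') k') h) (pf_h (L (bow P X'' Y'')) h')
   [/] ((A1 K Y Z [|] A1 K' Y Z [|] A2 X'' k Z) [|] (A2 X'' k' Z [|] A3 X'' Y'' h) [|] A3 X'' Y'' h').
  apply: row_slide; sd; exact: esym (assoc_23_hh_cell _ _ _).
move: S13 S12 S23; rewrite !hcA !hassoc => S13 S12 S23.
rewrite (vcR _ S13) (vcR _ S12) (vcR _ S23); congr (_ [/] _).
(* The chains still differ in the order of the exchanges of slots 1 and 2 and of slots 2 and 3,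
   which act at disjoint places. *)
wsw (ph (R Z) (pf_h (L X') k) (pf_h (R Y') K') [/] fc (R Z) (chi K' k) [/] phV (R Z) (pf_h (R Y) K') (pf_h (L X'') k)) (hid _) (chi (pf_h (L X'') k') h).
by [].
Qed.

Ltac bd ::= rewrite /boxs /boxc /boxh /boxv /boxu /boxuV /boxcV /assoc_cell; bds; hyps; rewrite ?hassoc ?hid_l ?hid_r ?LV ?RV ?vid_l ?vid_r ?pf_vid ?vid_l ?vid_r ?vassoc;
  first [reflexivity | repeat match goal with H : @eq (cell _ _ _ _) _ _ |- _ => clear H end; congruence].
Section UnUn.
Variables (C D : double_cat) (F0 : ob C -> ob D) (F : pfdata F0) (HF : is_pf F).
Lemma un_un A : (un F A [|] un F A) [/] ph F (hid A) (hid A) = un F A.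
Proof.
have -> : un F A [|] un F A = (idv (hid (F0 A)) [|] un F A) [/] (un F A [|] idv (pf_h F (hid A))).
  by rewrite inter; sd; rewrite vc1l; sd; rewrite vc1r; sd.
by rewrite vcA (ph_unl HF) vc1r; sd; rewrite -idh_vid hc1l; sd.
Qed.

Lemma un_fc A (x y : cell A A A A) : top x = hid A -> top y = hid A -> rgt x = lft y ->
  un F A [/] fc F (x [|] y)
  = ((un F A [/] fc F x) [|] (un F A [/] fc F y)) [/] ph F (bot x) (bot y).
Proof.
move=> e1 e2 e; rewrite -{1}un_un vcA.
have := ph_nat HF e; rewrite e1 e2 => <-.
by rewrite -vcA inter; sd.
Qed.
End UnUn.

Lemma a1_hid X Y Z : idh (al P X Y Z) [/] un (R (bow P Y Z)) X
  = (un (R Z) (bow P X Y) [/] fc (R Z) (un (R Y) X)) [/] A1 (hid X) Y Z.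
Proof. by rewrite (Vs_hid (al1 P Y Z)) un_pfcomp. Qed.

Lemma a2_hid X Y Z : idh (al P X Y Z) [/] (un (L X) (bow P Y Z) [/] fc (L X) (un (R Z) Y))
  = (un (R Z) (bow P X Y) [/] fc (R Z) (un (L X) Y)) [/] A2 X (hid Y) Z.
Proof. have := Vs_hid (al2 P X Z) Y; by rewrite !un_pfcomp. Qed.

Lemma a3_hid X Y Z : idh (al P X Y Z) [/] (un (L X) (bow P Y Z) [/] fc (L X) (un (L Y) Z))
  = un (L (bow P X Y)) Z [/] A3 X Y (hid Z).
Proof. have := Vs_hid (al3 P X Y) Z; by rewrite !un_pfcomp. Qed.

Lemma assoc_cell_hid X Y Z :
  idh (al P X Y Z) [/] boxu X (bow P Y Z) [/] boxs (idv (hid X)) (boxu Y Z)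
  = boxu (bow P X Y) Z [/] boxs (boxu X Y) (idv (hid Z)) [/] assoc_cell (hid X) (hid Y) (hid Z).
Proof.
rewrite boxs_idl; sd; rewrite boxs_idr; sd; rewrite /boxu.
rewrite (inter (x := un (R (bow P Y Z)) X)); sd; rewrite vc1r; sd.
rewrite (un_fc (lt_pf P X)); sd.
rewrite -[un (R (bow P Y Z)) X](vc1r (f := pf_h (R (bow P Y Z)) (hid X))); sd; rewrite -inter; sd.
(* The identity on [al] is cut into three columns, so that the unit laws of [al1], [al2] and [al3]
   each apply to one of them. *)
have i1 : idh (al P X Y Z) = idh (al P X Y Z) [|] idh (al P X Y Z) [|] idh (al P X Y Z).
  by rewrite !hc1r; sd.
rewrite i1 -vcA (inter (x := idh _)); sd; rewrite (inter (x := idh _)); sd.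
rewrite a1_hid a2_hid a3_hid.
rewrite -(inter (y := un (L (bow P X Y)) Z)); sd; rewrite -(inter (x := _ [/] fc (R Z) (un (R Y) X))); sd.
rewrite /assoc_cell -!vcA; congr (_ [/] _); congr (_ [/] _).
rewrite -hcA inter; sd; rewrite vc1r; sd; rewrite inter; sd; rewrite vc1r; sd.
rewrite (un_fc (rt_pf P Z)); sd; by rewrite vcA (phK (rt_pf P Z)) vc1r; sd.
Qed.

(** * Units *)

Notation I := (pm_I P).
(** The inverse unitor deletes the factor [pf_h (R Y) (hid I)] of [boxh (hid I) k], leaving the
    source of [lam]. *)
Definition lunit_cell Y Y' (k : hom Y Y') :=
  (unV (R Y) I [|] idv (pf_h (L I) k)) [/] Vs (lam P) k.
Definition runit_cell X X' (K : hom X X') :=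
  (idv (pf_h (R I) K) [|] unV (L X') I) [/] Vs (rho P) K.

Ltac bd ::= rewrite /boxs /boxc /boxh /boxv /boxu /boxuV /boxcV /assoc_cell /lunit_cell /runit_cell; bds; hyps; rewrite ?hassoc ?hid_l ?hid_r ?LV ?RV ?vid_l ?vid_r ?pf_vid ?vid_l ?vid_r ?vassoc;
  first [reflexivity | repeat match goal with H : @eq (cell _ _ _ _) _ _ |- _ => clear H end; congruence].

Lemma fc_pfid (C : double_cat) (A A' A1 A1' : ob C) (x : cell A A' A1 A1') : fc (pfid C) x = x.
Proof. by case: x => t b l r [s|]; exact: erefl. Qed.

Lemma lam_nat Y Y' Y1 Y1' (y : cell Y Y' Y1 Y1') :
  Vs (lam P) (top y) [/] y = fc (L I) y [/] Vs (lam P) (bot y).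
Proof. by have := V_nat (isv_strict (lam P)) y; rewrite fc_pfid. Qed.

Lemma rho_nat Y Y' Y1 Y1' (y : cell Y Y' Y1 Y1') :
  Vs (rho P) (top y) [/] y = fc (R I) y [/] Vs (rho P) (bot y).
Proof. by have := V_nat (isv_strict (rho P)) y; rewrite fc_pfid. Qed.

Lemma ph_pfid (C : double_cat) (A A' A'' : ob C) (f : hom A A') (g : hom A' A'') :
  ph (pfid C) f g = idv (f >> g).
Proof. exact: erefl. Qed.

Lemma un_pfid (C : double_cat) (A : ob C) : un (pfid C) A = idv (hid A).
Proof. exact: erefl. Qed.

Lemma lam_comp Y Y' Y'' (k : hom Y Y') (k' : hom Y' Y'') :
  Vs (lam P) k [|] Vs (lam P) k' = ph (L I) k k' [/] Vs (lam P) (k >> k').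
Proof. have := Vs_comp (lam P) k k'. rewrite ph_pfid vc1r; sd; by []. Qed.

Lemma rho_comp Y Y' Y'' (k : hom Y Y') (k' : hom Y' Y'') :
  Vs (rho P) k [|] Vs (rho P) k' = ph (R I) k k' [/] Vs (rho P) (k >> k').
Proof. have := Vs_comp (rho P) k k'. rewrite ph_pfid vc1r; sd; by []. Qed.

Lemma lam_hid Y : idh (la P Y) = un (L I) Y [/] Vs (lam P) (hid Y).
Proof. have := Vs_hid (lam P) Y. rewrite un_pfid vc1r; sd; by []. Qed.

Lemma rho_hid Y : idh (ra P Y) = un (R I) Y [/] Vs (rho P) (hid Y).
Proof. have := Vs_hid (rho P) Y. rewrite un_pfid vc1r; sd; by []. Qed.

Lemma la_sw Y Y1 (u : ver Y Y1) : la P Y // u = pf_v (L I) u // la P Y1.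
Proof. exact: (V_sw (isv_strict (lam P)) u). Qed.

Lemma ra_sw Y Y1 (u : ver Y Y1) : ra P Y // u = pf_v (R I) u // ra P Y1.
Proof. exact: (V_sw (isv_strict (rho P)) u). Qed.

(** At a horizontal identity the exchange with a 1v-cell is an identity square up to unitors. This
    removes the column of [hid I] in [lunit_cell_nat]; [vh_unV] does so for the right unit. *)
Lemma hv_unV X Y Y1 (u : ver Y Y1) :
  hv (hid X) u [/] unV (R Y1) X = unV (R Y) X [/] idh (pf_v (L X) u).
Proof.
rewrite -[hv _ u](vc1l (f := pf_h (R Y) (hid X))); sd.
rewrite -(unVK (rt_pf P Y)) !vcA -(vcA (un (R Y) X)) -(Vs_hid (rV P u) X) !vcA (unK (rt_pf P Y1)) vc1r; sd; by [].
Qed.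

Lemma vh_unV X X1 (U : ver X X1) Y :
  vh U (hid Y) [/] unV (L X1) Y = unV (L X) Y [/] idh (pf_v (R Y) U).
Proof.
rewrite -[vh U _](vc1l (f := pf_h (L X) (hid Y))); sd.
rewrite -(unVK (lt_pf P X)) !vcA -(vcA (un (L X) Y)) -(Vs_hid (lV P U) Y) !vcA (unK (lt_pf P X1)) vc1r; sd; by [].
Qed.

Lemma lunit_cell_nat Y Y' Y1 Y1' (y : cell Y Y' Y1 Y1') :
  lunit_cell (top y) [/] y = boxs (idv (hid I)) y [/] lunit_cell (bot y).
Proof.
have e := la_sw (rgt y).
rewrite /lunit_cell /boxs (fc_idv (rt_pf P _)) vc1l; sd; rb; rewrite vh_vid vc1l; sd.
rewrite !vcA lam_nat -!vcA; congr (_ [/] _).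
rewrite [RHS]inter; sd; rewrite hv_unV vc1r; sd.
rewrite -{2}[fc _ y](vc1l (f := pf_h (L I) (top y))); sd; rewrite -inter; sd.
by rewrite hc1l; sd.
Qed.

Lemma runit_cell_nat X X' X1 X1' (x : cell X X' X1 X1') :
  runit_cell (top x) [/] x = boxs x (idv (hid I)) [/] runit_cell (bot x).
Proof.
have e := ra_sw (rgt x).
rewrite /runit_cell /boxs (fc_idv (lt_pf P _)) vc1r; sd; rb; rewrite hv_vid vc1r; sd.
rewrite !vcA rho_nat -!vcA; congr (_ [/] _).
rewrite [RHS]inter; sd; rewrite vh_unV vc1r; sd.
rewrite -{2}[fc _ x](vc1l (f := pf_h (R I) (top x))); sd; rewrite -inter; sd.
by rewrite hc1r; sd.
Qed.

Lemma lunit_cell_hid Y : idh (la P Y) = boxu I Y [/] lunit_cell (hid Y).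
Proof.
by rewrite /lunit_cell /boxu -vcA inter; sd; rewrite (unK (rt_pf P Y)) vc1r; sd; rewrite -idh_vid hc1l; sd; exact: lam_hid.
Qed.

Lemma runit_cell_hid Y : idh (ra P Y) = boxu Y I [/] runit_cell (hid Y).
Proof.
by rewrite /runit_cell /boxu -vcA inter; sd; rewrite (unK (lt_pf P Y)) vc1r; sd; rewrite -idh_vid hc1r; sd; exact: rho_hid.
Qed.

Lemma lunit_cell_top Y Y' (k : hom Y Y') : (un (R Y) I [|] idv (pf_h (L I) k)) [/] lunit_cell k = Vs (lam P) k.
Proof.
rewrite /lunit_cell -vcA inter; sd; rewrite (unK (rt_pf P Y)) vc1r; sd; rewrite -idv_h vc1l; sd; by [].
Qed.

Lemma runit_cell_top X X' (K : hom X X') : (idv (pf_h (R I) K) [|] un (L X') I) [/] runit_cell K = Vs (rho P) K.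
Proof.
rewrite /runit_cell -vcA inter; sd; rewrite (unK (lt_pf P X')) vc1r; sd; rewrite -idv_h vc1l; sd; by [].
Qed.

Lemma lunit_cell_comp Y Y' Y'' (k : hom Y Y') (k' : hom Y' Y'') :
  lunit_cell k [|] lunit_cell k' = boxc (hid I) (hid I) k k' [/] lunit_cell (k >> k').
Proof.
pose t := un (R Y) I [|] idv (pf_h (L I) k); pose t' := un (R Y') I [|] idv (pf_h (L I) k').
pose v := unV (R Y) I [|] idv (pf_h (L I) k); pose v' := unV (R Y') I [|] idv (pf_h (L I) k').
have vt : (v [|] v') [/] (t [|] t') = idv (boxh (hid I) k >> boxh (hid I) k').
  rewrite /v /v' /t /t' inter; sd; rewrite !inter; sd; rewrite (unVK (rt_pf P Y)) (unVK (rt_pf P Y')).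
  by rewrite !vc1l; sd; rewrite -!idv_h.
suff e : (t [|] t') [/] (lunit_cell k [|] lunit_cell k') = (t [|] t') [/] (boxc (hid I) (hid I) k k' [/] lunit_cell (k >> k')).
  have := f_equal (fun z => (v [|] v') [/] z) e.
  by rewrite -!(vcA (v [|] v')) vt vc1l; sd; rewrite vc1l; sd.
rewrite inter; sd; rewrite !lunit_cell_top lam_comp.
rewrite /t /t'.
(* By [chi_hid_l] the second unitor absorbs the exchange cell at [hid I], and by the right unit law
   it then cancels the compositor of [R Y]. *)
have -> : ((un (R Y) I [|] idv (pf_h (L I) k)) [|] un (R Y') I [|] idv (pf_h (L I) k'))
   [/] boxc (hid I) (hid I) k k' [/] lunit_cell (k >> k')
  = (un (R Y) I [|] ph (L I) k k') [/] lunit_cell (k >> k').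
  rewrite -vcA; congr (_ [/] _).
  rewrite boxcW [RHS]hW; sd; rewrite !hWl; sd; rewrite hW; sd; nf.
  rewrite (vcR1 _ (chi_hid_l _ _)); sd; na.
  by rewrite (vcR1 _ (ph_unrW (rt_pf P Y) (f := hid I) _ _)); sd; na; rewrite vc1l; sd.
rewrite /lunit_cell -vcA inter; sd; rewrite (unK (rt_pf P Y)) vc1r; sd.
by rewrite -idh_vid hc1l; sd.
Qed.

Lemma runit_cell_comp X X' X'' (K : hom X X') (K' : hom X' X'') :
  runit_cell K [|] runit_cell K' = boxc K K' (hid I) (hid I) [/] runit_cell (K >> K').
Proof.
pose t := idv (pf_h (R I) K) [|] un (L X') I; pose t' := idv (pf_h (R I) K') [|] un (L X'') I.
pose v := idv (pf_h (R I) K) [|] unV (L X') I; pose v' := idv (pf_h (R I) K') [|] unV (L X'') I.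
have vt : (v [|] v') [/] (t [|] t') = idv (boxh K (hid I) >> boxh K' (hid I)).
  rewrite /v /v' /t /t' inter; sd; rewrite !inter; sd; rewrite (unVK (lt_pf P X')) (unVK (lt_pf P X'')).
  by rewrite !vc1l; sd; rewrite -!idv_h.
suff e : (t [|] t') [/] (runit_cell K [|] runit_cell K') = (t [|] t') [/] (boxc K K' (hid I) (hid I) [/] runit_cell (K >> K')).
  have := f_equal (fun z => (v [|] v') [/] z) e.
  by rewrite -!(vcA (v [|] v')) vt vc1l; sd; rewrite vc1l; sd.
rewrite inter; sd; rewrite !runit_cell_top rho_comp.
rewrite /t /t'.
have -> : ((idv (pf_h (R I) K) [|] un (L X') I) [|] idv (pf_h (R I) K') [|] un (L X'') I)
   [/] boxc K K' (hid I) (hid I) [/] runit_cell (K >> K')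
  = (ph (R I) K K' [|] un (L X'') I) [/] runit_cell (K >> K').
  rewrite -vcA; congr (_ [/] _).
  rewrite boxcW [RHS]hW; sd; rewrite !hWr; sd; rewrite hW; sd; nf.
  wsw' (chi K' (hid I)) (hid _) (un (L X'') I).
  rewrite (vcR1 _ (chi_hid_r _ _)); sd; na.
  wsw' (ph (R I) K K') (pf_h (L X'') (hid I)) (un (L X'') I).
  wsw' (ph (R I) K K') (hid _) (un (L X'') I).
  by rewrite (ph_unrW (lt_pf P X'')); sd; rewrite vc1r; sd.
rewrite /runit_cell -vcA inter; sd; rewrite (unK (lt_pf P X'')) vc1r; sd.
by rewrite -idh_vid hc1r; sd.
Qed.

(** * The pentagon *)

Section Sigma.
Variables (C D : double_cat) (F0 : ob C -> ob D) (F : pfdata F0) (HF : is_pf F).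
(** Abstract form of [fc_assoc_cell]: [pV] and [q] stand for the compositors at the top and bottom
    of an associativity cell, and [a], [b], [c] for its row. Inside [F] the cell [p] cancels [pV],
    after which naturality of [ph F] spreads [F] over the row. *)
Lemma sig_assoc_cell (E1 E2 E3 E4 G1 G2 G3 G4 : ob C) (x : hom E1 E2) (y : hom E2 E3) (z : hom E3 E4)
  (w : hom E1 E3) (p pV : cell E1 E3 E1 E3)
  (a : cell E1 E2 G1 G2) (b : cell E2 E3 G2 G3) (c : cell E3 E4 G3 G4) (q : cell G2 G4 G2 G4) :
  top p = x >> y -> bot p = w -> lft p = vid _ -> rgt p = vid _ ->
  top pV = w -> bot pV = x >> y -> lft pV = vid _ -> rgt pV = vid _ -> p [/] pV = idv (x >> y) ->
  top a = x -> top b = y -> top c = z -> rgt a = lft b -> rgt b = lft c ->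
  lft q = vid _ -> rgt q = vid _ -> top q = bot b >> bot c ->
  ((ph F x y [/] fc F p) [|] idv (pf_h F z)) [/] ph F w z
    [/] fc F ((pV [|] idv z) [/] (a [|] b [|] c) [/] (idv (bot a) [|] q))
  = (fc F a [|] fc F b [|] fc F c)
   [/] (idv (pf_h F (bot a)) [|] (ph F (bot b) (bot c) [/] fc F q)) [/] ph F (bot a) (bot q).
Proof.
move=> p1 p2 p3 p4 v1 v2 v3 v4 pv ta tb tc ab bc' q1 q2 q3.
rewrite !(fc_v HF); sd.
have n1 : ph F w z [/] fc F (pV [|] idv z) = (fc F pV [|] idv (pf_h F z)) [/] ph F (x >> y) z.
  have e0 : rgt pV = lft (idv z) by bd.
  by have := ph_nat HF e0; rb; rewrite v1 v2 (fc_idv HF) => <-.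
rewrite (vcR _ n1) -vcA.
have -> : ((ph F x y [/] fc F p) [|] idv (pf_h F z)) [/] (fc F pV [|] idv (pf_h F z)) = ph F x y [|] idv (pf_h F z).
  rewrite inter; sd; rewrite vcA -(fc_v HF); sd; rewrite pv (fc_idv HF) vc1r; sd; rewrite vc1r; sd; by [].
have n2 : ph F (x >> y) z [/] fc F (a [|] b [|] c) = (fc F (a [|] b) [|] fc F c) [/] ph F (bot a >> bot b) (bot c).
  have e0 : rgt (a [|] b) = lft c by bd.
  by have := ph_nat HF e0; rb; rewrite ta tb tc hcA => <-.
rewrite (vcR _ n2) -vcA.
have n3 : ph F x y [/] fc F (a [|] b) = (fc F a [|] fc F b) [/] ph F (bot a) (bot b).
  by have := ph_nat HF ab; rewrite ta tb => <-.
have n4 : (ph F x y [|] idv (pf_h F z)) [/] (fc F (a [|] b) [|] fc F c)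
  = (fc F a [|] fc F b [|] fc F c) [/] (ph F (bot a) (bot b) [|] idv (pf_h F (bot c))).
  rewrite inter; sd; rewrite n3 vc1l; sd; rewrite -[fc F c](vc1r (f := pf_h F (bot c))); sd.
  rewrite -inter; sd; by rewrite hcA vc1r; sd.
rewrite n4 !vcA; congr (_ [/] _).
rewrite (vcR _ (ph_assoc HF _ _ _)).
have e0 : rgt (idv (bot a)) = lft q by bd.
have := ph_nat HF e0; rb; rewrite q3 => <-.
by rewrite (fc_idv HF) -vcA inter; sd; rewrite vc1l; sd.
Qed.
End Sigma.

(** The pentagon axioms use the structure stored with [al], the product uses the chosen one;
    [al_agrees] reconciles them. *)
Lemma vh_al X Y Z T T' (k : hom T T') :
  vh (al P X Y Z) k = Vs (ic_left (al_ic P X Y Z)) k.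
Proof. case: (al_agrees P X Y Z) => [[e _] _]; by rewrite -!pk_Vs e. Qed.

Lemma hv_al X X' (K : hom X X') Y Z T :
  hv K (al P Y Z T) = Vs (ic_right (al_ic P Y Z T)) K.
Proof. case: (al_agrees P Y Z T) => [_ [[e _] _]]; by rewrite -!pk_Vs e. Qed.

Lemma pent1 X X' (f : hom X X') Y Z T :
  fc (R T) (A1 f Y Z) [/] A1 f (bow P Y Z) T [/] hv f (al P Y Z T)
  = A1 (pf_h (R Y) f) Z T [/] A1 f Y (bow P Z T).
Proof. rewrite hv_al -vcA -!pk_Vs -!pk_fc -!pk_v. apply: pk_eq; exact: pentagon1. Qed.

Lemma pent2 X Y Y' (f : hom Y Y') Z T :
  fc (R T) (A2 X f Z) [/] A2 X (pf_h (R Z) f) T [/] fc (L X) (A1 f Z T)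
  = A1 (pf_h (L X) f) Z T [/] A2 X f (bow P Z T).
Proof. rewrite -vcA -!pk_Vs -!pk_fc -!pk_v. apply: pk_eq; exact: pentagon2. Qed.

Lemma pent3 X Y Z Z' (f : hom Z Z') T :
  fc (R T) (A3 X Y f) [/] A2 X (pf_h (L Y) f) T [/] fc (L X) (A2 Y f T)
  = A2 (bow P X Y) f T [/] A3 X Y (pf_h (R T) f).
Proof. rewrite -vcA -!pk_Vs -!pk_fc -!pk_v. apply: pk_eq; exact: pentagon3. Qed.

Lemma pent4 X Y Z T T' (f : hom T T') :
  vh (al P X Y Z) f [/] A3 X (bow P Y Z) f [/] fc (L X) (A3 Y Z f)
  = A3 (bow P X Y) Z f [/] A3 X Y (pf_h (L Z) f).
Proof. rewrite vh_al -vcA -!pk_Vs -!pk_fc -!pk_v. apply: pk_eq; exact: pentagon4. Qed.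

Lemma assoc_cell_lft X X' (K : hom X X') Y Y' (k : hom Y Y') Z Z' (h : hom Z Z') :
  lft (assoc_cell K k h) = al P X Y Z.
Proof. by bd. Qed.

Lemma assoc_cell_rgt X X' (K : hom X X') Y Y' (k : hom Y Y') Z Z' (h : hom Z Z') :
  rgt (assoc_cell K k h) = al P X' Y' Z'.
Proof. by bd. Qed.

Lemma boxs_idvr X X' X1 X1' (x : cell X X' X1 X1') T T' (k : hom T T') :
  boxs x (idv k) = fc (R T) x [|] vh (rgt x) k.
Proof.
rewrite /boxs (fc_idv (lt_pf P _)); rb; rewrite hv_vid.
by rewrite vc1r; sd; rewrite vc1r; sd.
Qed.

Lemma boxs_idvl X X' (f : hom X X') Y Y' Y1 Y1' (y : cell Y Y' Y1 Y1') :
  boxs (idv f) y = hv f (lft y) [|] fc (L X') y.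
Proof.
rewrite /boxs (fc_idv (rt_pf P _)); rb; rewrite vh_vid.
by rewrite vc1l; sd; rewrite vc1l; sd.
Qed.

Lemma fc_assoc_cell (F0 : ob B -> ob B) (F : pfdata F0) (HF : is_pf F) X X' (f : hom X X') Y Y' (g : hom Y Y') Z Z' (h : hom Z Z') :
  ((ph F (pf_h (R Z) (pf_h (R Y) f)) (pf_h (R Z) (pf_h (L X') g))
     [/] fc F (ph (R Z) (pf_h (R Y) f) (pf_h (L X') g))) [|] idv (pf_h F (pf_h (L (bow P X' Y')) h)))
   [/] ph F (pf_h (R Z) (boxh f g)) (pf_h (L (bow P X' Y')) h) [/] fc F (assoc_cell f g h)
  = (fc F (A1 f Y Z) [|] fc F (A2 X' g Z) [|] fc F (A3 X' Y' h))
   [/] (idv (pf_h F (pf_h (R (bow P Y Z)) f)) [|]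
       (ph F (pf_h (L X') (pf_h (R Z) g)) (pf_h (L X') (pf_h (L Y') h)) [/]
          fc F (ph (L X') (pf_h (R Z) g) (pf_h (L Y') h))))
   [/] ph F (pf_h (R (bow P Y Z)) f) (pf_h (L X') (boxh g h)).
Proof.
have S := sig_assoc_cell HF (x := pf_h (R Z) (pf_h (R Y) f)) (y := pf_h (R Z) (pf_h (L X') g))
  (z := pf_h (L (bow P X' Y')) h) (w := pf_h (R Z) (boxh f g))
  (p := ph (R Z) (pf_h (R Y) f) (pf_h (L X') g))
  (pV := phV (R Z) (pf_h (R Y) f) (pf_h (L X') g)) (a := A1 f Y Z) (b := A2 X' g Z) (c := A3 X' Y' h)
  (q := ph (L X') (pf_h (R Z) g) (pf_h (L Y') h)).
feed S; move: {S}(S (phK (rt_pf P Z) _ _)) => S; feed S; move: S; rb.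
by rewrite /assoc_cell.
Qed.

(** After cancellation of compositors both sides are rows with one column for each of [f], [g], [h],
    [k], and each of the four pentagon axioms is the equation of one column. *)
Lemma assoc_cell_pentagon X X' (f : hom X X') Y Y' (g : hom Y Y') Z Z' (h : hom Z Z') T T' (k : hom T T') :
  boxs (assoc_cell f g h) (idv k) [/] assoc_cell f (boxh g h) k [/] boxs (idv f) (assoc_cell g h k)
  = assoc_cell (boxh f g) h k [/] assoc_cell f g (boxh h k).
Proof.
rewrite boxs_idvr boxs_idvl assoc_cell_lft assoc_cell_rgt.
(* [sig] is the chain of compositors that assembles the first three of the four whiskered 1h-cells
   into the nested source; [sigV] takes it apart. *)
pose sig := ((ph (R T) (pf_h (R Z) (pf_h (R Y) f)) (pf_h (R Z) (pf_h (L X') g))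
   [/] fc (R T) (ph (R Z) (pf_h (R Y) f) (pf_h (L X') g))) [|] idv (pf_h (R T) (pf_h (L (bow P X' Y')) h)))
   [/] ph (R T) (pf_h (R Z) (boxh f g)) (pf_h (L (bow P X' Y')) h).
pose sigV := phV (R T) (pf_h (R Z) (boxh f g)) (pf_h (L (bow P X' Y')) h)
   [/] ((fc (R T) (phV (R Z) (pf_h (R Y) f) (pf_h (L X') g)) [/] phV (R T) (pf_h (R Z) (pf_h (R Y) f)) (pf_h (R Z) (pf_h (L X') g))) [|] idv (pf_h (R T) (pf_h (L (bow P X' Y')) h))).
pose kk := pf_h (L (bow P (bow P X' Y') Z')) k.
have vt : (sigV [|] idv kk) [/] (sig [|] idv kk) = idv (boxh (boxh (boxh f g) h) k).
  rewrite /sigV /sig [LHS]inter; sd.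
  rewrite vc1l; sd; rewrite !vcA -(vcA (_ [|] _)) inter; sd.
  rewrite vcA -(vcA (phV (R T) (pf_h (R Z) (pf_h (R Y) f)) _)) (phVK (rt_pf P T)) vc1l; sd.
  rewrite -(fc_v (rt_pf P T)); sd; rewrite (phVK (rt_pf P Z)) (fc_idv (rt_pf P T)) vc1l; sd.
  by rewrite -idv_h vc1l; sd; rewrite (phVK (rt_pf P T)) -idv_h.
suff e : (sig [|] idv kk) [/] ((fc (R T) (assoc_cell f g h) [|] vh (al P X' Y' Z') k) [/] assoc_cell f (boxh g h) k
    [/] (hv f (al P Y Z T) [|] fc (L X') (assoc_cell g h k)))
  = (sig [|] idv kk) [/] (assoc_cell (boxh f g) h k [/] assoc_cell f g (boxh h k)).
  have := f_equal (fun z => (sigV [|] idv kk) [/] z) e.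
  rewrite -!(vcA (sigV [|] idv kk)) vt vc1l; first by rewrite /kk; bd.
  rewrite vc1l; first by rewrite /kk; bd.
  by [].
rewrite {vt sigV}/sig {sig}/kk {kk}.
have S1 := fc_assoc_cell (rt_pf P T) f g h; have S2 := fc_assoc_cell (lt_pf P X') g h k.
have e2 : lft (assoc_cell g h k) = al P Y Z T by exact: assoc_cell_lft.
rewrite -[LHS]vcA (inter (z := fc (R T) (assoc_cell f g h))); sd.
rewrite (vcA _ (ph (R T) (pf_h (R Z) (boxh f g)) _) (fc (R T) (assoc_cell f g h))) S1 vc1l; sd; rewrite row3r; sd; rb.
rewrite !(vcA _ _ (assoc_cell f (boxh g h) k [/] _)) (vcR _ (assoc_cell_top f (boxh g h) k)).
have q1 : ((idv (pf_h (R T) (pf_h (R (bow P Y Z)) f))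
     [|] (ph (R T) (pf_h (L X') (pf_h (R Z) g)) (pf_h (L X') (pf_h (L Y') h)) [/]
          fc (R T) (ph (L X') (pf_h (R Z) g) (pf_h (L Y') h))))
     [|] idv (pf_h (L (bow P X' (bow P Y' Z'))) k))
   [/] (A1 f (bow P Y Z) T [|] A2 X' (boxh g h) T [|] A3 X' (bow P Y' Z') k)
  = (A1 f (bow P Y Z) T [|] (A2 X' (pf_h (R Z) g) T [|] A2 X' (pf_h (L Y') h) T) [|] A3 X' (bow P Y' Z') k)
   [/] (idv (pf_h (R (bow P (bow P Y Z) T)) f)
     [|] (ph (L X') (pf_h (R T) (pf_h (R Z) g)) (pf_h (R T) (pf_h (L Y') h))
         [/] fc (L X') (ph (R T) (pf_h (R Z) g) (pf_h (L Y') h)))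
     [|] idv (pf_h (L X') (pf_h (L (bow P Y' Z')) k))).
  rewrite hcA inter; sd; rewrite inter; sd; rewrite -a2_comp !vc1l; sd.
  by rewrite [RHS]inter; sd; rewrite [X in _ = _ [|] X]inter; sd; rewrite !vc1r; sd.
rewrite (vcR _ q1).
have q2 : (idv (pf_h (R (bow P (bow P Y Z) T)) f)
     [|] (ph (L X') (pf_h (R T) (pf_h (R Z) g)) (pf_h (R T) (pf_h (L Y') h))
         [/] fc (L X') (ph (R T) (pf_h (R Z) g) (pf_h (L Y') h)))
     [|] idv (pf_h (L X') (pf_h (L (bow P Y' Z')) k)))
   [/] (idv (pf_h (R (bow P (bow P Y Z) T)) f)
      [|] ph (L X') (pf_h (R T) (boxh g h)) (pf_h (L (bow P Y' Z')) k))
   [/] (hv f (al P Y Z T) [|] fc (L X') (assoc_cell g h k))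
  = (hv f (al P Y Z T) [|] fc (L X') (A1 g Z T) [|] fc (L X') (A2 Y' h T) [|] fc (L X') (A3 Y' Z' k))
   [/] (idv (pf_h (R (bow P Y (bow P Z T))) f) [|] idv (pf_h (L X') (pf_h (R (bow P Z T)) g))
     [|] (ph (L X') (pf_h (L Y') (pf_h (R T) h)) (pf_h (L Y') (pf_h (L Z') k))
         [/] fc (L X') (ph (L Y') (pf_h (R T) h) (pf_h (L Z') k))))
   [/] (idv (pf_h (R (bow P Y (bow P Z T))) f)
      [|] ph (L X') (pf_h (R (bow P Z T)) g) (pf_h (L Y') (boxh h k))).
  have e3 : rgt (hv f (al P Y Z T)) = lft (fc (L X') (A1 g Z T)) by bd.
  rewrite [X in _ [/] X = _](inter (w := fc _ (assoc_cell g h k))); sd; rewrite inter; sd.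
  by rewrite !vc1l; sd; rewrite S2 row3l; sd; rb.
rewrite q2 {q1 q2 S1 S2} !hcA.
have q3 : (fc (R T) (A1 f Y Z) [|] fc (R T) (A2 X' g Z) [|] fc (R T) (A3 X' Y' h) [|] vh (al P X' Y' Z') k)
  [/] (A1 f (bow P Y Z) T [|] A2 X' (pf_h (R Z) g) T [|] A2 X' (pf_h (L Y') h) T [|] A3 X' (bow P Y' Z') k)
  [/] (hv f (al P Y Z T) [|] fc (L X') (A1 g Z T) [|] fc (L X') (A2 Y' h T) [|] fc (L X') (A3 Y' Z' k))
  = (A1 (pf_h (R Y) f) Z T [|] A1 (pf_h (L X') g) Z T [|] A2 (bow P X' Y') h T [|] A3 (bow P X' Y') Z' k)
  [/] (A1 f Y (bow P Z T) [|] A2 X' g (bow P Z T) [|] A3 X' Y' (pf_h (R T) h) [|] A3 X' Y' (pf_h (L Z') k)).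
  rewrite [RHS]inter; sd; rewrite [X in _ = _ [|] X]inter; sd; rewrite [X in _ = _ [|] _ [|] X]inter; sd.
  rewrite -pent1 -pent2 -pent3 -pent4.
  rewrite -[X in _ = _ [|] _ [|] X]inter; sd; rewrite -[X in _ = _ [|] X]inter; sd; rewrite -[RHS]inter; sd.
  congr (_ [/] _).
  by rewrite -[X in _ = _ [|] _ [|] X]inter; sd; rewrite -[X in _ = _ [|] X]inter; sd; rewrite -[RHS]inter; sd.
rewrite (vcR3 _ q3) {q3} [LHS]vcA.
rewrite -[idv (pf_h (L (bow P (bow P X' Y') Z')) k)](vc1r (f := pf_h (L (bow P (bow P X' Y') Z')) k)); sd.
rewrite -[X in _ = X [/] _]inter; sd.
rewrite (vcA _ (_ [|] idv _) (assoc_cell _ _ _ [/] _)) (vcR _ (assoc_cell_top (boxh f g) h k)).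
rewrite hcA.
(* On the right side the compositors are pushed below the row: [u1] and [u3] use the composition
   laws of [al1] and [al3], and [u2] exchanges two compositors at disjoint places. *)
have u1 : ((ph (R T) (pf_h (R Z) (pf_h (R Y) f)) (pf_h (R Z) (pf_h (L X') g))
    [/] fc (R T) (ph (R Z) (pf_h (R Y) f) (pf_h (L X') g)))
    [|] idv (pf_h (R T) (pf_h (L (bow P X' Y')) h)) [|] idv (pf_h (L (bow P (bow P X' Y') Z')) k))
   [/] (A1 (boxh f g) Z T [|] A2 (bow P X' Y') h T [|] A3 (bow P X' Y') Z' k)
  = (A1 (pf_h (R Y) f) Z T [|] A1 (pf_h (L X') g) Z T [|] A2 (bow P X' Y') h T [|] A3 (bow P X' Y') Z' k)
   [/] (ph (R (bow P Z T)) (pf_h (R Y) f) (pf_h (L X') g)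
      [|] idv (pf_h (L (bow P X' Y')) (pf_h (R T) h)) [|] idv (pf_h (L (bow P X' Y')) (pf_h (L Z') k))).
  rewrite -[X in _ = X [/] _]hcA inter; sd. rewrite -a1_comp.
  by rewrite -!idv_h vc1l; sd; rewrite [RHS]inter; sd; rewrite vc1r; sd.
rewrite (vcR _ u1) {u1}.
have u2 : (ph (R (bow P Z T)) (pf_h (R Y) f) (pf_h (L X') g)
      [|] idv (pf_h (L (bow P X' Y')) (pf_h (R T) h)) [|] idv (pf_h (L (bow P X' Y')) (pf_h (L Z') k)))
   [/] (idv (pf_h (R (bow P Z T)) (boxh f g)) [|] ph (L (bow P X' Y')) (pf_h (R T) h) (pf_h (L Z') k))
  = (idv (pf_h (R (bow P Z T)) (pf_h (R Y) f)) [|] idv (pf_h (R (bow P Z T)) (pf_h (L X') g))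
      [|] ph (L (bow P X' Y')) (pf_h (R T) h) (pf_h (L Z') k))
   [/] (ph (R (bow P Z T)) (pf_h (R Y) f) (pf_h (L X') g) [|] idv (pf_h (L (bow P X' Y')) (boxh h k))).
  rewrite -idv_h [LHS]inter; sd; rewrite vc1r; sd; rewrite vc1l; sd.
  by rewrite -hcA -idv_h [RHS]inter; sd; rewrite vc1r; sd; rewrite vc1l; sd.
rewrite (vcR _ u2) {u2} (assoc_cell_top f g (boxh h k)).
have u3 : (idv (pf_h (R (bow P Z T)) (pf_h (R Y) f)) [|] idv (pf_h (R (bow P Z T)) (pf_h (L X') g))
      [|] ph (L (bow P X' Y')) (pf_h (R T) h) (pf_h (L Z') k))
   [/] (A1 f Y (bow P Z T) [|] A2 X' g (bow P Z T) [|] A3 X' Y' (boxh h k))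
  = (A1 f Y (bow P Z T) [|] A2 X' g (bow P Z T) [|] A3 X' Y' (pf_h (R T) h) [|] A3 X' Y' (pf_h (L Z') k))
   [/] (idv (pf_h (R (bow P Y (bow P Z T))) f) [|] idv (pf_h (L X') (pf_h (R (bow P Z T)) g))
     [|] (ph (L X') (pf_h (L Y') (pf_h (R T) h)) (pf_h (L Y') (pf_h (L Z') k))
         [/] fc (L X') (ph (L Y') (pf_h (R T) h) (pf_h (L Z') k)))).
  rewrite inter; sd; rewrite [X in _ [|] X = _]inter; sd; rewrite -a3_comp.
  rewrite [RHS]inter; sd; rewrite [X in _ = _ [|] X]inter; sd.
  by rewrite !vc1l; sd; rewrite !vc1r; sd.
rewrite (vcR _ u3); by [].
Qed.

(** * The unit triangles *)

Section UnitCancel.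
Variables (C D : double_cat) (F0 : ob C -> ob D) (F : pfdata F0) (HF : is_pf F).
(** Inside [F] the pair [q], [qV] cancels; what is left is the left unit law of [F]. Applied to the
    unitor at the top of [lunit_cell]. *)
Lemma un_cancel_l (A E : ob C) (w : hom A A) (z : hom A E) (q qV : cell A A A A) :
  top q = hid A -> bot q = w -> lft q = vid _ -> rgt q = vid _ ->
  top qV = w -> bot qV = hid A -> lft qV = vid _ -> rgt qV = vid _ -> q [/] qV = idv (hid A) ->
  ((un F A [/] fc F q) [|] idv (pf_h F z)) [/] ph F w z [/] fc F (qV [|] idv z) = idv (pf_h F z).
Proof.
move=> q1 q2 q3 q4 v1 v2 v3 v4 qv.
have e0 : rgt qV = lft (idv z) by bd.
have := ph_nat HF e0; rb; rewrite v1 v2 (fc_idv HF) => <-.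
rewrite -vcA inter; sd; rewrite vcA -(fc_v HF); sd.
by rewrite qv (fc_idv HF) vc1r; sd; rewrite vc1r; sd; rewrite (ph_unl HF).
Qed.

Lemma un_cancel_r (A E : ob C) (w : hom A A) (z : hom E A) (q qV : cell A A A A) :
  top q = hid A -> bot q = w -> lft q = vid _ -> rgt q = vid _ ->
  top qV = w -> bot qV = hid A -> lft qV = vid _ -> rgt qV = vid _ -> q [/] qV = idv (hid A) ->
  (idv (pf_h F z) [|] (un F A [/] fc F q)) [/] ph F z w [/] fc F (idv z [|] qV) = idv (pf_h F z).
Proof.
move=> q1 q2 q3 q4 v1 v2 v3 v4 qv.
have e0 : rgt (idv z) = lft qV by bd.
have := ph_nat HF e0; rb; rewrite v1 v2 (fc_idv HF) => <-.
rewrite -vcA inter; sd; rewrite vcA -(fc_v HF); sd.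
by rewrite qv (fc_idv HF) vc1r; sd; rewrite vc1r; sd; rewrite (ph_unr HF).
Qed.
End UnitCancel.

Lemma fc_lunit_cell (F0 : ob B -> ob B) (F : pfdata F0) (HF : is_pf F) Y Y' (k : hom Y Y') :
  ((un F (bow P I Y) [/] fc F (un (R Y) I)) [|] idv (pf_h F (pf_h (L I) k)))
   [/] ph F (pf_h (R Y) (hid I)) (pf_h (L I) k) [/] fc F (lunit_cell k) = fc F (Vs (lam P) k).
Proof.
rewrite /lunit_cell (fc_v HF); sd.
have S := un_cancel_l HF (pf_h (L I) k) (q := un (R Y) I) (qV := unV (R Y) I) (w := pf_h (R Y) (hid I)).
feed S; move: {S}(S (unK (rt_pf P Y) _)) => S.
by rewrite (vcR3 _ S) vc1l; sd.
Qed.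

Lemma fc_runit_cell (F0 : ob B -> ob B) (F : pfdata F0) (HF : is_pf F) X X' (K : hom X X') :
  (idv (pf_h F (pf_h (R I) K)) [|] (un F (bow P X' I) [/] fc F (un (L X') I)))
   [/] ph F (pf_h (R I) K) (pf_h (L X') (hid I)) [/] fc F (runit_cell K) = fc F (Vs (rho P) K).
Proof.
rewrite /runit_cell (fc_v HF); sd.
have S := un_cancel_r HF (pf_h (R I) K) (q := un (L X') I) (qV := unV (L X') I) (w := pf_h (L X') (hid I)).
feed S; move: {S}(S (unK (lt_pf P X') _)) => S.
by rewrite (vcR3 _ S) vc1l; sd.
Qed.

Lemma unit_m1_cell X X' (f : hom X X') Y :
  A1 f I Y [/] hv f (la P Y) = fc (R Y) (Vs (rho P) f).
Proof.
have -> : hv f (la P Y) = Vs (ic_right (la_ic P Y)) f.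
  by case: (la_agrees P Y) => [_ [[e _] _]]; rewrite -!pk_Vs e.
rewrite -!pk_Vs -!pk_fc -!pk_v. apply: pk_eq; exact: unit_m1. Qed.

Lemma unit_m2_cell X Y Y' (f : hom Y Y') :
  A3 X I f [/] fc (L X) (Vs (lam P) f) = vh (ra P X) f.
Proof.
have -> : vh (ra P X) f = Vs (ic_left (ra_ic P X)) f.
  by case: (ra_agrees P X) => [[e _] _]; rewrite -!pk_Vs e.
rewrite -!pk_Vs -!pk_fc -!pk_v. apply: pk_eq; exact: unit_m2. Qed.

Lemma unit_l1_cell X X' (f : hom X X') Y :
  A2 I f Y [/] Vs (lam P) (pf_h (R Y) f) = fc (R Y) (Vs (lam P) f).
Proof. rewrite -!pk_Vs -!pk_fc -!pk_v. apply: pk_eq; exact: unit_l1. Qed.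

Lemma unit_l2_cell X Y Y' (f : hom Y Y') :
  A3 I X f [/] Vs (lam P) (pf_h (L X) f) = vh (la P X) f.
Proof.
have -> : vh (la P X) f = Vs (ic_left (la_ic P X)) f.
  by case: (la_agrees P X) => [[e _] _]; rewrite -!pk_Vs e.
rewrite -!pk_Vs -!pk_v. apply: pk_eq; exact: unit_l2. Qed.

Lemma unit_r1_cell X X' (f : hom X X') Y :
  A1 f Y I [/] hv f (ra P Y) = Vs (rho P) (pf_h (R Y) f).
Proof.
have -> : hv f (ra P Y) = Vs (ic_right (ra_ic P Y)) f.
  by case: (ra_agrees P Y) => [_ [[e _] _]]; rewrite -!pk_Vs e.
rewrite -!pk_Vs -!pk_v. apply: pk_eq; exact: unit_r1. Qed.

Lemma unit_r2_cell X Y Y' (f : hom Y Y') :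
  A2 X f I [/] fc (L X) (Vs (rho P) f) = Vs (rho P) (pf_h (L X) f).
Proof. rewrite -!pk_Vs -!pk_fc -!pk_v. apply: pk_eq; exact: unit_r2. Qed.

Lemma vc_cancel (D : double_cat) (A0 A0' A A' A1 A1' : ob D) (s : cell A A' A0 A0') (t : cell A0 A0' A A') (f : hom A A')
   (z z' : cell A A' A1 A1') : s [/] t = idv f -> f = top z -> f = top z' ->
  t [/] z = t [/] z' -> z = z'.
Proof.
move=> st e e' tz.
by rewrite -(vc1l e) -(vc1l e') -st !vcA tz.
Qed.

(** [un G (F0 A) [/] fc G (un F A)] is the unitor of the composite functor. *)
Lemma unfun_inv (F0 G0 : ob B -> ob B) (F : pfdata F0) (G : pfdata G0) (HF : is_pf F) (HG : is_pf G) A :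
  (fc G (unV F A) [/] unV G (F0 A)) [/] (un G (F0 A) [/] fc G (un F A)) = idv (pf_h G (pf_h F (hid A))).
Proof.
rewrite vcA (vcR1 _ (unVK HG _)) (vc1l (f := pf_h G (hid (F0 A)))); sd; rewrite -(fc_v HG); sd; by rewrite (unVK HF) (fc_idv HG).
Qed.

(** [inv_hc] and [inv_vc] assemble the inverse that [vc_cancel] needs from known inverse pairs, so
    that it is never written out. *)
Lemma inv_hc (D : double_cat) (A A' A'' C C' C'' : ob D) (s : cell A A' C C') (t : cell C C' A A') (s' : cell A' A'' C' C'') (t' : cell C' C'' A' A'')
   (f : hom A A') (g : hom A' A'') :
  s [/] t = idv f -> s' [/] t' = idv g ->
  rgt s = lft s' -> rgt t = lft t' -> bot s = top t -> bot s' = top t' ->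
  (s [|] s') [/] (t [|] t') = idv (f >> g).
Proof. by move=> e e' *; rewrite inter // e e' idv_h. Qed.

Lemma inv_vc (D : double_cat) (A A' C C' E E' : ob D) (s : cell A A' C C') (t : cell C C' A A')
   (s' : cell C C' E E') (t' : cell E E' C C') (f : hom A A') (g : hom C C') :
  s [/] t = idv f -> s' [/] t' = idv g -> g = top t ->
  (s [/] s') [/] (t' [/] t) = idv f.
Proof. by move=> e e' et; rewrite vcA (vcR1 _ e') (vc1l et). Qed.

Lemma inv_idv (D : double_cat) (A A' : ob D) (f : hom A A') : idv f [/] idv f = idv f.
Proof. by rewrite vc1l; sd. Qed.

(** The middle argument is an identity: [a2_hid] trades the middle column for unitors, which the
    compositors absorb. The columns of [f] and [g] are then [unit_m1] and [unit_m2]. *)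
Lemma assoc_cell_unit_m X X' (f : hom X X') Y Y' (g : hom Y Y') :
  assoc_cell f (hid I) g [/] boxs (idv f) (lunit_cell g) = boxs (runit_cell f) (idv g).
Proof.
have ve := unfun_inv (lt_pf P X') (rt_pf P Y) I.
have S1 := fc_lunit_cell (lt_pf P X') g.
have S2 := fc_runit_cell (rt_pf P Y) f.
have v1 := inv_hc (inv_idv (pf_h (R Y) (pf_h (R I) f))) ve. feed v1.
have v2 := inv_vc (phVK (rt_pf P Y) (pf_h (R I) f) (pf_h (L X') (hid I))) v1. feed v2.
have vt := inv_hc v2 (inv_idv (pf_h (L (bow P X' I)) g)). feed vt.
move: {v1 v2}vt => vt.
apply: (vc_cancel vt); sd.
rewrite boxs_idvr boxs_idvl [RHS]inter; sd; rewrite (vcA _ _ (fc (R Y) (runit_cell f))) S2 vc1l; sd.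
have Ti : (((idv (pf_h (R Y) (pf_h (R I) f)) [|] (un (R Y) (bow P X' I) [/] fc (R Y) (un (L X') I))) [/]
     ph (R Y) (pf_h (R I) f) (pf_h (L X') (hid I))) [|] idv (pf_h (L (bow P X' I)) g))
  = (idv (pf_h (R Y) (pf_h (R I) f)) [|] (un (R Y) (bow P X' I) [/] fc (R Y) (un (L X') I)) [|] idv (pf_h (L (bow P X' I)) g)) [/]
     (ph (R Y) (pf_h (R I) f) (pf_h (L X') (hid I)) [|] idv (pf_h (L (bow P X' I)) g)).
  rewrite -hcA [RHS]inter; sd; rewrite vc1l; sd; by [].
rewrite Ti vcA (vcR _ (assoc_cell_top f (hid I) g)).
have q1 : (idv (pf_h (R Y) (pf_h (R I) f)) [|] (un (R Y) (bow P X' I) [/] fc (R Y) (un (L X') I)) [|] idv (pf_h (L (bow P X' I)) g))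
  [/] (A1 f I Y [|] A2 X' (hid I) Y [|] A3 X' I g)
  = (A1 f I Y [|] A3 X' I g) [/]
   (idv (pf_h (R (bow P I Y)) f) [|] (un (L X') (bow P I Y) [/] fc (L X') (un (R Y) I)) [|] idv (pf_h (L X') (pf_h (L I) g))).
  rewrite inter; sd; rewrite inter; sd; rewrite -a2_hid.
  have -> : (A1 f I Y [|] A3 X' I g) = (A1 f I Y [|] idh (al P X' I Y) [|] A3 X' I g) by rewrite hc1l; sd.
  rewrite [RHS]inter; sd. rewrite [X in _ = _ [|] X]inter; sd.
  by rewrite !vc1l; sd; rewrite !vc1r; sd.
rewrite (vcR _ q1).
have q2 : (idv (pf_h (R (bow P I Y)) f)
     [|] (un (L X') (bow P I Y) [/] fc (L X') (un (R Y) I)) [|] idv (pf_h (L X') (pf_h (L I) g)))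
    [/] (idv (pf_h (R (bow P I Y)) f) [|] ph (L X') (pf_h (R Y) (hid I)) (pf_h (L I) g))
    [/] (hv f (lft (lunit_cell g)) [|] fc (L X') (lunit_cell g))
  = hv f (la P Y) [|] fc (L X') (Vs (lam P) g).
  have -> : lft (lunit_cell g) = la P Y by bd.
  have e1 : rgt (hv f (la P Y)) = lft (fc (L X') (lunit_cell g)) by bd.
  rewrite (inter (w := fc _ (lunit_cell g))); sd; rewrite inter; sd.
  by rewrite S1 !vc1l; sd.
rewrite q2 inter; sd; rewrite unit_m1_cell unit_m2_cell.
have -> : rgt (runit_cell f) = ra P X' by bd.
by [].
Qed.

(** Here [a1_hid] removes the first column. The unit cell is taken at a composite 1h-cell and is
    split by [lam_comp], which leaves [unit_l1] and [unit_l2]. *)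
Lemma assoc_cell_unit_l X X' (f : hom X X') Y Y' (g : hom Y Y') :
  assoc_cell (hid I) f g [/] lunit_cell (boxh f g) = boxs (lunit_cell f) (idv g).
Proof.
have ve := unfun_inv (rt_pf P X) (rt_pf P Y) I.
have S2 := fc_lunit_cell (rt_pf P Y) f.
have v1 := inv_hc ve (inv_idv (pf_h (R Y) (pf_h (L I) f))). feed v1.
have v2 := inv_vc (phVK (rt_pf P Y) (pf_h (R X) (hid I)) (pf_h (L I) f)) v1. feed v2.
have vt := inv_hc v2 (inv_idv (pf_h (L (bow P I X')) g)). feed vt.
move: {v1 v2}vt => vt.
apply: (vc_cancel vt); sd.
rewrite boxs_idvr [RHS]inter; sd; rewrite (vcA _ _ (fc (R Y) (lunit_cell f))) S2 vc1l; sd.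
have Ti : ((((un (R Y) (bow P I X) [/] fc (R Y) (un (R X) I)) [|] idv (pf_h (R Y) (pf_h (L I) f))) [/]
     ph (R Y) (pf_h (R X) (hid I)) (pf_h (L I) f)) [|] idv (pf_h (L (bow P I X')) g))
  = ((un (R Y) (bow P I X) [/] fc (R Y) (un (R X) I)) [|] idv (pf_h (R Y) (pf_h (L I) f)) [|] idv (pf_h (L (bow P I X')) g)) [/]
     (ph (R Y) (pf_h (R X) (hid I)) (pf_h (L I) f) [|] idv (pf_h (L (bow P I X')) g)).
  rewrite -hcA [RHS]inter; sd; rewrite vc1l; sd; by [].
rewrite Ti vcA (vcR _ (assoc_cell_top (hid I) f g)).
have q1 : ((un (R Y) (bow P I X) [/] fc (R Y) (un (R X) I)) [|] idv (pf_h (R Y) (pf_h (L I) f)) [|] idv (pf_h (L (bow P I X')) g))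
  [/] (A1 (hid I) X Y [|] A2 I f Y [|] A3 I X' g)
  = (A2 I f Y [|] A3 I X' g) [/]
   (un (R (bow P X Y)) I [|] idv (pf_h (L I) (pf_h (R Y) f)) [|] idv (pf_h (L I) (pf_h (L X') g))).
  rewrite inter; sd; rewrite inter; sd; rewrite -a1_hid.
  have -> : (A2 I f Y [|] A3 I X' g) = (idh (al P I X Y) [|] A2 I f Y [|] A3 I X' g) by rewrite hc1l; sd.
  rewrite [RHS]inter; sd. rewrite [X in _ = _ [|] X]inter; sd.
  by rewrite !vc1l; sd; rewrite !vc1r; sd.
rewrite (vcR _ q1).
have q2 : (un (R (bow P X Y)) I [|] idv (pf_h (L I) (pf_h (R Y) f)) [|] idv (pf_h (L I) (pf_h (L X') g)))
    [/] (idv (pf_h (R (bow P X Y)) (hid I)) [|] ph (L I) (pf_h (R Y) f) (pf_h (L X') g))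
  = ph (L I) (pf_h (R Y) f) (pf_h (L X') g) [/] (un (R (bow P X Y)) I [|] idv (pf_h (L I) (boxh f g))).
  rewrite -idv_h inter; sd; rewrite vc1l; sd; rewrite vc1r; sd.
  rewrite -{2}(hc1l (x := ph (L I) _ _) (u := vid _)); sd; rewrite idh_vid inter; sd.
  by rewrite vc1l; sd; rewrite vc1r; sd.
rewrite (vcR _ q2) lunit_cell_top -lam_comp inter; sd; rewrite unit_l1_cell unit_l2_cell.
have -> : rgt (lunit_cell f) = la P X' by bd.
by [].
Qed.

(** Dual to the left triangle: [a3_hid] removes the last column and [rho_comp] splits the unit
    cell. *)
Lemma assoc_cell_unit_r X X' (f : hom X X') Y Y' (g : hom Y Y') :
  assoc_cell f g (hid I) [/] boxs (idv f) (runit_cell g) = runit_cell (boxh f g).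
Proof.
have S2 := fc_runit_cell (lt_pf P X') g.
have vt := inv_hc (phVK (rt_pf P I) (pf_h (R Y) f) (pf_h (L X') g)) (unVK (lt_pf P (bow P X' Y')) I). feed vt.
apply: (vc_cancel vt); sd.
rewrite boxs_idvl.
have -> : ph (R I) (pf_h (R Y) f) (pf_h (L X') g) [|] un (L (bow P X' Y')) I
   = ph (R I) (pf_h (R Y) f) (pf_h (L X') g) [/] (idv (pf_h (R I) (boxh f g)) [|] un (L (bow P X' Y')) I).
  rewrite -{2}(hc1r (x := ph (R I) _ _) (u := vid _)); sd; rewrite idh_vid inter; sd.
  by rewrite vc1l; sd; rewrite vc1r; sd.
rewrite [RHS]vcA runit_cell_top -rho_comp.
have Ti : ph (R I) (pf_h (R Y) f) (pf_h (L X') g) [/] (idv (pf_h (R I) (boxh f g)) [|] un (L (bow P X' Y')) I)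
  = (idv (pf_h (R I) (pf_h (R Y) f)) [|] idv (pf_h (R I) (pf_h (L X') g)) [|] un (L (bow P X' Y')) I) [/]
     (ph (R I) (pf_h (R Y) f) (pf_h (L X') g) [|] idv (pf_h (L (bow P X' Y')) (hid I))).
  rewrite -hcA -idv_h [RHS]inter; sd; rewrite vc1l; sd; rewrite vc1r; sd.
  rewrite -{1}(hc1r (x := ph (R I) _ _) (u := vid _)); sd; rewrite idh_vid inter; sd.
  by rewrite vc1l; sd; rewrite vc1r; sd.
rewrite Ti vcA (vcR _ (assoc_cell_top f g (hid I))).
have q1 : (idv (pf_h (R I) (pf_h (R Y) f)) [|] idv (pf_h (R I) (pf_h (L X') g)) [|] un (L (bow P X' Y')) I)
  [/] (A1 f Y I [|] A2 X' g I [|] A3 X' Y' (hid I))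
  = (A1 f Y I [|] A2 X' g I) [/]
   (idv (pf_h (R (bow P Y I)) f) [|] idv (pf_h (L X') (pf_h (R I) g)) [|] (un (L X') (bow P Y' I) [/] fc (L X') (un (L Y') I))).
  rewrite inter; sd; rewrite inter; sd; rewrite -a3_hid.
  have -> : (A1 f Y I [|] A2 X' g I) = (A1 f Y I [|] A2 X' g I [|] idh (al P X' Y' I)) by rewrite hc1r; sd.
  rewrite [RHS]inter; sd. rewrite [X in _ = _ [|] X]inter; sd.
  by rewrite !vc1l; sd; rewrite !vc1r; sd.
rewrite (vcR _ q1).
have q2 : (idv (pf_h (R (bow P Y I)) f) [|] idv (pf_h (L X') (pf_h (R I) g)) [|] (un (L X') (bow P Y' I) [/] fc (L X') (un (L Y') I)))
    [/] (idv (pf_h (R (bow P Y I)) f) [|] ph (L X') (pf_h (R I) g) (pf_h (L Y') (hid I)))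
    [/] (hv f (lft (runit_cell g)) [|] fc (L X') (runit_cell g))
  = hv f (ra P Y) [|] fc (L X') (Vs (rho P) g).
  have -> : lft (runit_cell g) = ra P Y by bd.
  have e1 : rgt (hv f (ra P Y)) = lft (fc (L X') (runit_cell g)) by bd.
  rewrite (inter (w := fc _ (runit_cell g))); sd; rewrite inter; sd.
  by rewrite S2 !vc1l; sd.
by rewrite q2 inter; sd; rewrite unit_r1_cell unit_r2_cell.
Qed.

(** * Invertibility of the associativity and unit cells *)

Lemma ciso_ph (C D : double_cat) (F0 : ob C -> ob D) (F : pfdata F0) (HF : is_pf F) A A' A'' (f : hom A A') (g : hom A' A'') :
  ciso (ph F f g) /\ ciso (phV F f g).
Proof. by split; [exact: ciso_inv (phK HF f g) (phVK HF f g)|exact: ciso_inv (phVK HF f g) (phK HF f g)]. Qed.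

Lemma ciso_unV (C D : double_cat) (F0 : ob C -> ob D) (F : pfdata F0) (HF : is_pf F) A : ciso (unV F A).
Proof. exact: ciso_inv (unVK HF A) (unK HF A). Qed.

Lemma ciso_Vs (C D : double_cat) (F0 G0 : ob C -> ob D) (F : pfdata F0) (G : pfdata G0) c
  (a : isvtrans F G c) A A' (f : hom A A') : ciso (Vs a f).
Proof. apply/ciso_pk; exact: isv_inv. Qed.

Lemma ciso_assoc_cell X X' (f : hom X X') Y Y' (g : hom Y Y') Z Z' (h : hom Z Z') : ciso (assoc_cell f g h).
Proof.
rewrite /assoc_cell; apply: ciso_v; sd.
  apply: ciso_h; sd; [exact: (proj2 (ciso_ph (rt_pf P Z) _ _))|exact: ciso_idv].
apply: ciso_v; sd.
  apply: ciso_h; sd; [exact: (ciso_Vs (al1 P Y Z) f)|].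
  by apply: ciso_h; sd; [exact: (ciso_Vs (al2 P X' Z) g)|exact: (ciso_Vs (al3 P X' Y') h)].
apply: ciso_h; sd; [exact: ciso_idv|exact: (proj1 (ciso_ph (lt_pf P X') _ _))].
Qed.

Lemma ciso_lunit_cell Y Y' (k : hom Y Y') : ciso (lunit_cell k).
Proof.
apply: ciso_v; sd; last exact: (ciso_Vs (lam P) k).
by apply: ciso_h; sd; [exact: ciso_unV (rt_pf P Y) _|exact: ciso_idv].
Qed.

Lemma ciso_runit_cell X X' (K : hom X X') : ciso (runit_cell K).
Proof.
apply: ciso_v; sd; last exact: (ciso_Vs (rho P) K).
by apply: ciso_h; sd; [exact: ciso_idv|exact: ciso_unV (lt_pf P _) _].
Qed.

(** * The pure center *)

Notation Z := (pure_center P).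
Definition zpk (A A' A1 A1' : ob Z) (t : hom A A') (b : hom A1 A1') (l : ver A A1) (r : ver A' A1')
  (s : sq t b l r) : @cell B A A' A1 A1' := pk (zs s).
Lemma zeq (A A' A1 A1' : ob Z) (t t' : hom A A') (b b' : hom A1 A1') (l l' : ver A A1) (r r' : ver A' A1')
  (s : sq t b l r) (s' : sq t' b' l' r') : zpk s = zpk s' -> s ~= s'.
Proof. by move=> /eq_pk; exact: zsqeq. Qed.

Lemma zpk_h (A A' C A1 A1' C1 : ob Z)
    (t : hom A A') (t' : hom A' C) (b : hom A1 A1') (b' : hom A1' C1)
    (l : ver A A1) (m : ver A' A1') (r : ver C C1)
    (x : sq t b l m) (y : sq t' b' m r) : zpk (x <|> y) = zpk x [|] zpk y.
Proof. exact: pk_h. Qed.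

Lemma zpk_v (A A' A1 A1' A2 A2' : ob Z)
    (t : hom A A') (m : hom A1 A1') (b : hom A2 A2')
    (l : ver A A1) (l' : ver A1 A2) (r : ver A' A1') (r' : ver A1' A2')
    (x : sq t m l r) (y : sq m b l' r') : zpk (x </> y) = zpk x [/] zpk y.
Proof. exact: pk_v. Qed.

Lemma zpk_cast (A A' A1 A1' : ob Z) (t t' : hom A A') (b b' : hom A1 A1') (l l' : ver A A1) (r r' : ver A' A1')
   (et : t = t') (eb : b = b') (el : l = l') (er : r = r') (s : sq t b l r) : zpk (sqcast et eb el er s) = zpk s.
Proof. by case: t' / et; case: b' / eb; case: l' / el; case: r' / er. Qed.

Lemma zpk_idv (A A' : ob Z) (f : hom A A') : zpk (sq_vid f) = idv (zh f).
Proof. exact: erefl. Qed.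

Lemma zpk_idh (A A' : ob Z) (f : ver A A') : zpk (sq_hid f) = idh (zv f).
Proof. exact: erefl. Qed.

Notation bx := (boxr P).
Lemma zpk_boxs (A A' A1 A1' : ob (prodc Z Z)) (t : hom A A') (b : hom A1 A1') (l : ver A A1) (r : ver A' A1')
  (s : sq t b l r) : zpk (pf_s bx s) = boxs (zpk (fst s)) (zpk (snd s)).
Proof.
rewrite /zpk /= pk_h !pk_v !pk_fc (pk_Hs (rH P (zh (snd t))) (zv (fst r))) vhE. by [].
Qed.

Lemma zpk_boxc (A A' A'' : ob (prodc Z Z)) (f : hom A A') (g : hom A' A'') :
  zpk (pf_comp bx f g) = boxc (zh (fst f)) (zh (fst g)) (zh (snd f)) (zh (snd g)).
Proof.
apply: (etrans (pk_cast _ _ _ _ _)); rewrite pk_v pk_cast !pk_h hcA. by [].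
Qed.

Lemma zpk_boxcV (A A' A'' : ob (prodc Z Z)) (f : hom A A') (g : hom A' A'') :
  zpk (pf_compV bx f g) = boxcV (zh (fst f)) (zh (fst g)) (zh (snd f)) (zh (snd g)).
Proof.
apply: (etrans (pk_cast _ _ _ _ _)); rewrite pk_v pk_cast !pk_h hcA. by [].
Qed.

Lemma zpk_boxu (A : ob (prodc Z Z)) :
  zpk (pf_unit bx A) = boxu (fst A) (snd A).
Proof.
by apply: (etrans (pk_cast _ _ _ _ _)); rewrite pk_h.
Qed.

Lemma zpk_boxuV (A : ob (prodc Z Z)) :
  zpk (pf_unitV bx A) = boxuV (fst A) (snd A).
Proof.
by apply: (etrans (pk_cast _ _ _ _ _)); rewrite pk_h.
Qed.

Opaque assoc_cell lunit_cell runit_cell boxs boxc boxu boxcV boxuV.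
Lemma zv_eq (A A' : ob Z) (u v : ver A A') : zv u = zv v -> u = v.
Proof. by move=> e; rewrite -(zv_mk u) -(zv_mk v) e. Qed.

Lemma box_pf : is_pf bx.
Proof.
split.
- move=> A A' A'' u v; apply: zv_eq; exact: boxv_v.
- move=> *; apply: zeq; rewrite zpk_v !zpk_boxs /=.
  by rewrite -boxs_v // !zpk_v.
- move=> *; apply: zeq. rewrite zpk_boxs !zpk_idv; exact: boxs_id.
- move=> A A' E A1 A1' E1 t t' b b' l m r x y; apply: zeq.
  rewrite !zpk_v zpk_h !zpk_boxs !zpk_boxc !zpk_h. exact: boxc_nat.
- move=> A A' u; apply: zeq; rewrite !zpk_v !zpk_boxu zpk_boxs zpk_idh !zpk_idh. exact: boxu_nat.
- move=> *; apply: zeq; rewrite !zpk_v !zpk_h !zpk_boxc !zpk_idv. exact: boxc_assoc.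
- move=> *; apply: zeq; rewrite !zpk_v !zpk_h !zpk_boxc !zpk_boxu !zpk_idv. exact: boxc_unl.
- move=> *; apply: zeq; rewrite !zpk_v !zpk_h !zpk_boxc !zpk_boxu !zpk_idv. exact: boxc_unr.
- move=> *; split; apply: zeq; rewrite zpk_v zpk_boxc zpk_boxcV zpk_idv; [exact: boxcK|exact: boxcVK].
- move=> *; split; apply: zeq; rewrite zpk_v zpk_boxu zpk_boxuV zpk_idv; [exact: boxuK|exact: boxuVK].
Qed.

Transparent pk hc vc fc ph phV un unV idv idh Hs Hg Vs assoc_cell lunit_cell runit_cell.
(** The square comes with the equation to its cell, so later arguments never look into its
    construction. *)
Definition assoc_cell_real X X' (f : hom X X') Y Y' (g : hom Y Y') T T' (h : hom T T') :
  {s : sq (boxh (boxh f g) h) (boxh f (boxh g h)) (al P X Y T) (al P X' Y' T') | pk s = assoc_cell f g h}.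
Proof. apply: (fill (ciso_assoc_cell f g h)); bd. Defined.
Definition lunit_cell_real Y Y' (k : hom Y Y') :
  {s : sq (boxh (hid I) k) k (la P Y) (la P Y') | pk s = lunit_cell k}.
Proof. apply: (fill (ciso_lunit_cell k)); bd. Defined.
Definition runit_cell_real X X' (K : hom X X') :
  {s : sq (boxh K (hid I)) K (ra P X) (ra P X') | pk s = runit_cell K}.
Proof. apply: (fill (ciso_runit_cell K)); bd. Defined.
Opaque pk hc vc fc ph phV un unV idv idh Hs Hg Vs assoc_cell lunit_cell runit_cell.

(** Every cell of the base has chosen centrality structures, so an inverse found there lifts to the
    pure center. *)
Lemma ziso (A A' A1 A1' : ob Z) (t : hom A A') (b : hom A1 A1') (l : ver A A1) (r : ver A' A1')
  (s : sq t b l r) : ciso (zpk s) -> vinvertible s.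
Proof.
move=> /ciso_pk [l' [r' [s' [e e']]]].
exists (mkzv P l'), (mkzv P r'), (mkzs (t := b) (b := t) (l := mkzv P l') (r := mkzv P r') s').
by split; apply: zeq; rewrite zpk_v -pk_v; apply: pk_eq.
Qed.

Definition zal (X : ob (prodc (prodc Z Z) Z)) :
  @ver Z (bow P (bow P (fst (fst X)) (snd (fst X))) (snd X)) (bow P (fst (fst X)) (bow P (snd (fst X)) (snd X))) :=
  mkzv P (al P (fst (fst X)) (snd (fst X)) (snd X)).
Definition zla (X : ob Z) : @ver Z (bow P I X) X := mkzv P (la P X).
Definition zra (X : ob Z) : @ver Z (bow P X I) X := mkzv P (ra P X).

Definition zassoc_sq (X X' : ob (prodc (prodc Z Z) Z)) (f : hom X X') :
   sq (pf_h (tens3l bx) f) (pf_h (tens3r bx) f) (zal X) (zal X') :=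
  mkzs (t := pf_h (tens3l bx) f) (b := pf_h (tens3r bx) f) (l := zal X) (r := zal X')
    (proj1_sig (assoc_cell_real (zh (fst (fst f))) (zh (snd (fst f))) (zh (snd f)))).
Definition zlam_sq (X X' : ob Z) (f : hom X X') :
   sq (pf_h (tens_l bx I) f) (pf_h (pfid Z) f) (zla X) (zla X') :=
  mkzs (t := pf_h (tens_l bx I) f) (b := f) (l := zla X) (r := zla X')
    (proj1_sig (lunit_cell_real (zh f))).
Definition zrho_sq (X X' : ob Z) (f : hom X X') :
   sq (pf_h (tens_r bx I) f) (pf_h (pfid Z) f) (zra X) (zra X') :=
  mkzs (t := pf_h (tens_r bx I) f) (b := f) (l := zra X) (r := zra X')
    (proj1_sig (runit_cell_real (zh f))).
Lemma zpk_zassoc_sq (X X' : ob (prodc (prodc Z Z) Z)) (f : hom X X') :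
  zpk (zassoc_sq f) = assoc_cell (zh (fst (fst f))) (zh (snd (fst f))) (zh (snd f)).
Proof. exact: (proj2_sig (assoc_cell_real _ _ _)). Qed.

Lemma zpk_zlam_sq (X X' : ob Z) (f : hom X X') : zpk (zlam_sq f) = lunit_cell (zh f).
Proof. exact: (proj2_sig (lunit_cell_real _)). Qed.

Lemma zpk_zrho_sq (X X' : ob Z) (f : hom X X') : zpk (zrho_sq f) = runit_cell (zh f).
Proof. exact: (proj2_sig (runit_cell_real _)). Qed.

(** * Compositors and unitors of the iterated products *)

Section Comp.
Variables (C D : double_cat) (G0 : ob D -> ob Z) (F0 : ob C -> ob D) (G : pfdata G0) (F : pfdata F0).
Lemma zpk_comp_c (A A' A'' : ob C) (f : hom A A') (g : hom A' A'') :
  zpk (pf_comp (pfcomp G F) f g) = zpk (pf_comp G (pf_h F f) (pf_h F g)) [/] zpk (pf_s G (pf_comp F f g)).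
Proof. exact: etrans (zpk_cast _ _ _ _ _) (zpk_v _ _). Qed.

Lemma zpk_comp_u (A : ob C) :
  zpk (pf_unit (pfcomp G F) A) = zpk (pf_unit G (F0 A)) [/] zpk (pf_s G (pf_unit F A)).
Proof. exact: etrans (zpk_cast _ _ _ _ _) (zpk_v _ _). Qed.
End Comp.

Lemma zpk_l3s (A A' A1 A1' : ob (prodc (prodc Z Z) Z)) (t : hom A A') (b : hom A1 A1') (l : ver A A1) (r : ver A' A1')
  (s : sq t b l r) : zpk (pf_s (tens3l bx) s) = boxs (boxs (zpk (fst (fst s))) (zpk (snd (fst s)))) (zpk (snd s)).
Proof.
apply: (etrans (zpk_boxs (pf_s (pfpair (pfcomp bx (pffst (prodc Z Z) Z)) (pfsnd (prodc Z Z) Z)) s))).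
exact: (f_equal (fun x => boxs x (zpk (snd s))) (zpk_boxs (fst s))).
Qed.

Lemma zpk_r3s (A A' A1 A1' : ob (prodc (prodc Z Z) Z)) (t : hom A A') (b : hom A1 A1') (l : ver A A1) (r : ver A' A1')
  (s : sq t b l r) : zpk (pf_s (tens3r bx) s) = boxs (zpk (fst (fst s))) (boxs (zpk (snd (fst s))) (zpk (snd s))).
Proof.
apply: (etrans (zpk_boxs (pf_s (pfpair (pfcomp (pffst Z Z) (pffst (prodc Z Z) Z))
    (pfcomp bx (pfpair (pfcomp (pfsnd Z Z) (pffst (prodc Z Z) Z))
                      (pfsnd (prodc Z Z) Z)))) s))).
exact: (f_equal (fun x => boxs (zpk (fst (fst s))) x) (zpk_boxs (A := (snd (fst A), snd A)) (A' := (snd (fst A'), snd A')) (A1 := (snd (fst A1), snd A1))(A1' := (snd (fst A1'), snd A1')) (t := (snd (fst t), snd t)) (b := (snd (fst b), snd b)) (l := (snd (fst l), snd l)) (r := (snd (fst r), snd r)) (snd (fst s), snd s))).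
Qed.

Let p3l := pfpair (pfcomp bx (pffst (prodc Z Z) Z)) (pfsnd (prodc Z Z) Z).
Let p3r2 := pfpair (pfcomp (pfsnd Z Z) (pffst (prodc Z Z) Z)) (pfsnd (prodc Z Z) Z).
Let p3r := pfpair (pfcomp (pffst Z Z) (pffst (prodc Z Z) Z)) (pfcomp bx p3r2).

(** The components enter through equations, so the result can be stated with cells of the base; at
    each use the projections and pairings are computed by conversion. *)
Lemma zpk_box_c (C : double_cat) (F0 : ob C -> ob (prodc Z Z)) (F : pfdata F0) (A A' A'' : ob C) (f : hom A A') (g : hom A' A'')
   (K K' k k' : hom _ _) (x y : cell _ _ _ _) :
   zh (fst (pf_h F f)) = K -> zh (fst (pf_h F g)) = K' ->
   zh (snd (pf_h F f)) = k -> zh (snd (pf_h F g)) = k' ->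
   zpk (fst (pf_comp F f g)) = x -> zpk (snd (pf_comp F f g)) = y ->
  zpk (pf_comp (pfcomp bx F) f g) = boxc K K' k k' [/] boxs x y.
Proof.
move=> <- <- <- <- <- <-; apply: (etrans (zpk_comp_c _ _ _ _)).
exact: (f_equal2 (fun u v => u [/] v) (zpk_boxc _ _) (zpk_boxs _)).
Qed.

Lemma zpk_box_u (C : double_cat) (F0 : ob C -> ob (prodc Z Z)) (F : pfdata F0) (A : ob C)
   (x y : cell _ _ _ _) : zpk (fst (pf_unit F A)) = x -> zpk (snd (pf_unit F A)) = y ->
  zpk (pf_unit (pfcomp bx F) A) = boxu (fst (F0 A)) (snd (F0 A)) [/] boxs x y.
Proof.
move=> <- <-; apply: (etrans (zpk_comp_u _ _ _)).
exact: (f_equal2 (fun u v => u [/] v) (zpk_boxu _) (zpk_boxs _)).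
Qed.

(** Projections have identity compositors; this discards their contribution to a composite
    functor. *)
Lemma boxc_boxs_id X X' X'' (K : hom X X') (K' : hom X' X'') Y Y' Y'' (k : hom Y Y') (k' : hom Y' Y'') :
  boxc K K' k k' [/] boxs (idv (K >> K')) (idv (k >> k')) = boxc K K' k k'.
Proof. by rewrite boxs_id vc1r. Qed.

Lemma boxu_boxs_id X Y :
  boxu X Y [/] boxs (idv (hid X)) (idv (hid Y)) = boxu X Y.
Proof. by rewrite boxs_id vc1r. Qed.

Lemma zpk_vid_fst (A A' A'' : ob (prodc Z Z)) (f : hom A A') (g : hom A' A'') :
  zpk (fst (sq_vid (f >> g))) = idv (zh (fst f) >> zh (fst g)).
Proof. exact: erefl. Qed.

Lemma zpk_vid_snd (A A' A'' : ob (prodc Z Z)) (f : hom A A') (g : hom A' A'') :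
  zpk (snd (sq_vid (f >> g))) = idv (zh (snd f) >> zh (snd g)).
Proof. exact: erefl. Qed.

Lemma zpk_vid (A A' A'' : ob Z) (f : hom A A') (g : hom A' A'') :
  zpk (sq_vid (f >> g)) = idv (zh f >> zh g).
Proof. exact: erefl. Qed.

Lemma zpk_f3c (A A' A'' : ob (prodc (prodc Z Z) Z)) (f : hom A A') (g : hom A' A'') :
  zpk (pf_comp (pfcomp bx (pffst (prodc Z Z) Z)) f g)
  = boxc (zh (fst (fst f))) (zh (fst (fst g))) (zh (snd (fst f))) (zh (snd (fst g))).
Proof.
have H := zpk_box_c (F := pffst (prodc Z Z) Z) erefl erefl erefl erefl (zpk_vid_fst (fst f) (fst g)) (zpk_vid_snd (fst f) (fst g)).
refine (etrans H _).
clear H.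
exact (boxc_boxs_id (zh (fst (fst f))) (zh (fst (fst g))) (zh (snd (fst f))) (zh (snd (fst g)))).
Qed.

Lemma zpk_l3c (A A' A'' : ob (prodc (prodc Z Z) Z)) (f : hom A A') (g : hom A' A'') :
  zpk (pf_comp (tens3l bx) f g)
  = boxc (boxh (zh (fst (fst f))) (zh (snd (fst f)))) (boxh (zh (fst (fst g))) (zh (snd (fst g)))) (zh (snd f)) (zh (snd g))
   [/] boxs (boxc (zh (fst (fst f))) (zh (fst (fst g))) (zh (snd (fst f))) (zh (snd (fst g)))) (idv (zh (snd f) >> zh (snd g))).
Proof.
have e (C C' : ob (prodc (prodc Z Z) Z)) (h : hom C C') : zh (fst (pf_h p3l h)) = boxh (zh (fst (fst h))) (zh (snd (fst h))) by exact: erefl.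
have H := zpk_box_c (F := p3l) (e _ _ f) (e _ _ g) erefl erefl (zpk_f3c f g) (zpk_vid (snd f) (snd g)).
exact H.
Qed.

Lemma zpk_r2c (A A' A'' : ob (prodc (prodc Z Z) Z)) (f : hom A A') (g : hom A' A'') :
  zpk (pf_comp (pfcomp bx p3r2) f g)
  = boxc (zh (snd (fst f))) (zh (snd (fst g))) (zh (snd f)) (zh (snd g)).
Proof.
have a := zpk_comp_c (pfsnd Z Z) (pffst (prodc Z Z) Z) f g.
have b := etrans a (f_equal2 (fun u v => u [/] v) (zpk_vid (snd (fst f)) (snd (fst g))) (zpk_vid_snd (fst f) (fst g))).
have H := zpk_box_c (F := p3r2) erefl erefl erefl erefl (etrans b (inv_idv _)) (zpk_vid (snd f) (snd g)).
refine (etrans H _); clear H.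
exact (boxc_boxs_id (zh (snd (fst f))) (zh (snd (fst g))) (zh (snd f)) (zh (snd g))).
Qed.

Lemma zpk_r3c (A A' A'' : ob (prodc (prodc Z Z) Z)) (f : hom A A') (g : hom A' A'') :
  zpk (pf_comp (tens3r bx) f g)
  = boxc (zh (fst (fst f))) (zh (fst (fst g))) (boxh (zh (snd (fst f))) (zh (snd f))) (boxh (zh (snd (fst g))) (zh (snd g)))
   [/] boxs (idv (zh (fst (fst f)) >> zh (fst (fst g)))) (boxc (zh (snd (fst f))) (zh (snd (fst g))) (zh (snd f)) (zh (snd g))).
Proof.
have a := zpk_comp_c (pffst Z Z) (pffst (prodc Z Z) Z) f g.
have b := etrans a (f_equal2 (fun u v => u [/] v) (zpk_vid (fst (fst f)) (fst (fst g))) (zpk_vid_fst (fst f) (fst g))).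
have e (C C' : ob (prodc (prodc Z Z) Z)) (h : hom C C') : zh (snd (pf_h p3r h)) = boxh (zh (snd (fst h))) (zh (snd h)) by exact: erefl.
have e1 (C C' : ob (prodc (prodc Z Z) Z)) (h : hom C C') : zh (fst (pf_h p3r h)) = zh (fst (fst h)) by exact: erefl.
have H := zpk_box_c (F := p3r) (e1 _ _ f) (e1 _ _ g) (e _ _ f) (e _ _ g) (etrans b (inv_idv _)) (zpk_r2c f g).
exact H.
Qed.

Lemma zpk_hid (A : ob Z) : zpk (sq_vid (hid A)) = idv (hid (A : ob B)).
Proof. exact: erefl. Qed.

Lemma zpk_hid_fst (A : ob (prodc Z Z)) : zpk (fst (sq_vid (hid A))) = idv (hid (fst A : ob B)).
Proof. exact: erefl. Qed.

Lemma zpk_hid_snd (A : ob (prodc Z Z)) : zpk (snd (sq_vid (hid A))) = idv (hid (snd A : ob B)).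
Proof. exact: erefl. Qed.

Lemma zpk_l3u (A : ob (prodc (prodc Z Z) Z)) :
  zpk (pf_unit (tens3l bx) A)
  = boxu (bow P (fst (fst A)) (snd (fst A))) (snd A) [/] boxs (boxu (fst (fst A)) (snd (fst A))) (idv (@hid B (snd A))).
Proof.
have H1 := zpk_box_u (F := pffst (prodc Z Z) Z) (zpk_hid_fst (fst A)) (zpk_hid_snd (fst A)).
have H := zpk_box_u (F := p3l) (etrans H1 (boxu_boxs_id (fst (fst A)) (snd (fst A)))) (zpk_hid (snd A)).
exact H.
Qed.

Lemma zpk_r3u (A : ob (prodc (prodc Z Z) Z)) :
  zpk (pf_unit (tens3r bx) A)
  = boxu (fst (fst A)) (bow P (snd (fst A)) (snd A)) [/] boxs (idv (@hid B (fst (fst A)))) (boxu (snd (fst A)) (snd A)).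
Proof.
have a := zpk_comp_u (pfsnd Z Z) (pffst (prodc Z Z) Z) A.
have b := etrans a (f_equal2 (fun u v => u [/] v) (zpk_hid (snd (fst A))) (zpk_hid_snd (fst A))).
have H1 := zpk_box_u (F := p3r2) (etrans b (inv_idv _)) (zpk_hid (snd A)).
have a' := zpk_comp_u (pffst Z Z) (pffst (prodc Z Z) Z) A.
have b' := etrans a' (f_equal2 (fun u v => u [/] v) (zpk_hid (fst (fst A))) (zpk_hid_fst (fst A))).
have H := zpk_box_u (F := p3r) (etrans b' (inv_idv _)) (etrans H1 (boxu_boxs_id (snd (fst A)) (snd A))).
exact H.
Qed.

Let plam := pfpair (pfconst Z (pm_I P : ob Z)) (pfid Z).
Let prho := pfpair (pfid Z) (pfconst Z (pm_I P : ob Z)).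
Lemma zpk_const (A A' A'' : ob Z) (f : hom A A') (g : hom A' A'') :
  zpk (pf_comp (pfconst Z (pm_I P : ob Z)) f g) = idv (hid I).
Proof. exact: (etrans (zpk_cast _ _ _ _ _) (zpk_hid _)). Qed.

Lemma zpk_lc (A A' A'' : ob Z) (f : hom A A') (g : hom A' A'') :
  zpk (pf_comp (tens_l bx I) f g) = boxc (hid I) (hid I) (zh f) (zh g).
Proof.
have e (C C' : ob Z) (h : hom C C') : zh (fst (pf_h plam h)) = hid I by exact: erefl.
have e1 (C C' : ob Z) (h : hom C C') : zh (snd (pf_h plam h)) = zh h by exact: erefl.
have H := zpk_box_c (F := plam) (e _ _ f) (e _ _ g) (e1 _ _ f) (e1 _ _ g) (zpk_const f g) (zpk_vid f g).
refine (etrans H _); clear H.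
(* The constant functor sends [f >> g] to [hid I], where [boxc_boxs_id] expects [hid I >> hid I]. *)
rewrite -{3}(hid_l (hid I)); exact: boxc_boxs_id.
Qed.

Lemma zpk_rc (A A' A'' : ob Z) (f : hom A A') (g : hom A' A'') :
  zpk (pf_comp (tens_r bx I) f g) = boxc (zh f) (zh g) (hid I) (hid I).
Proof.
have e (C C' : ob Z) (h : hom C C') : zh (snd (pf_h prho h)) = hid I by exact: erefl.
have e1 (C C' : ob Z) (h : hom C C') : zh (fst (pf_h prho h)) = zh h by exact: erefl.
have H := zpk_box_c (F := prho) (e1 _ _ f) (e1 _ _ g) (e _ _ f) (e _ _ g) (zpk_vid f g) (zpk_const f g).
refine (etrans H _); clear H.
rewrite -{3}(hid_l (hid I)); exact: boxc_boxs_id.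
Qed.

Lemma zpk_lu (A : ob Z) : zpk (pf_unit (tens_l bx I) A) = boxu I A.
Proof.
have H := zpk_box_u (F := plam) (A := A) (zpk_hid I) (zpk_hid A).
exact: (etrans H (boxu_boxs_id _ _)).
Qed.

Lemma zpk_ru (A : ob Z) : zpk (pf_unit (tens_r bx I) A) = boxu A I.
Proof.
have H := zpk_box_u (F := prho) (A := A) (zpk_hid A) (zpk_hid I).
exact: (etrans H (boxu_boxs_id _ _)).
Qed.

(** * Associativity and unit transformations of the pure center *)

Lemma zal_sw (X X' : ob (prodc (prodc Z Z) Z)) (u : ver X X') :
  zal X // pf_v (tens3r bx) u = pf_v (tens3l bx) u // zal X'.
Proof. apply: zv_eq; exact: al_sw. Qed.

Lemma zv_r3 (X X' : ob (prodc (prodc Z Z) Z)) (u : ver X X') :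
  zv (pf_v (tens3r bx) u) = boxv (zv (fst (fst u))) (boxv (zv (snd (fst u))) (zv (snd u))).
Proof. exact: erefl. Qed.

Lemma zv_v (X X' X'' : ob Z) (u : ver X X') (v : ver X' X'') : zv (u // v) = zv u // zv v.
Proof. exact: erefl. Qed.

Lemma fst_v (C D : double_cat) (X X' X'' : ob (prodc C D)) (u : ver X X') (v : ver X' X'') :
  fst (u // v) = fst u // fst v.
Proof. exact: erefl. Qed.

Lemma snd_v (C D : double_cat) (X X' X'' : ob (prodc C D)) (u : ver X X') (v : ver X' X'') :
  snd (u // v) = snd u // snd v.
Proof. exact: erefl. Qed.

Lemma r3_v (X X' X'' : ob (prodc (prodc Z Z) Z)) (u : ver X X') (v : ver X' X'') :
  pf_v (tens3r bx) (u // v) = pf_v (tens3r bx) u // pf_v (tens3r bx) v.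
Proof.
apply: zv_eq; rewrite zv_v !zv_r3 snd_v.
rewrite fst_v (fst_v (C := Z) (D := Z)) (snd_v (C := Z) (D := Z)) !zv_v !boxv_v. by [].
Qed.

Lemma zassoc_sq_inv (X X' : ob (prodc (prodc Z Z) Z)) (f : hom X X') : vinvertible (zassoc_sq f).
Proof. by apply: ziso; rewrite zpk_zassoc_sq; exact: ciso_assoc_cell. Qed.

Lemma zh_hid (X : ob Z) : zh (hid X) = @hid B X.
Proof. exact: erefl. Qed.

Lemma fst_hid (C D : double_cat) (X : ob (prodc C D)) : fst (hid X) = hid (fst X).
Proof. exact: erefl. Qed.

Lemma snd_hid (C D : double_cat) (X : ob (prodc C D)) : snd (hid X) = hid (snd X).
Proof. exact: erefl. Qed.

Lemma zh_h (X X' X'' : ob Z) (f : hom X X') (g : hom X' X'') : zh (f >> g) = zh f >> zh g.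
Proof. exact: erefl. Qed.

Lemma fst_h (C D : double_cat) (X X' X'' : ob (prodc C D)) (u : hom X X') (v : hom X' X'') :
  fst (u >> v) = fst u >> fst v.
Proof. exact: erefl. Qed.

Lemma snd_h (C D : double_cat) (X X' X'' : ob (prodc C D)) (u : hom X X') (v : hom X' X'') :
  snd (u >> v) = snd u >> snd v.
Proof. exact: erefl. Qed.

Lemma zassoc_sq_hid (X : ob (prodc (prodc Z Z) Z)) :
  sq_hid (zal X) </> pf_unit (tens3r bx) X ~= pf_unit (tens3l bx) X </> zassoc_sq (hid X).
Proof.
apply: zeq; rewrite !zpk_v zpk_r3u zpk_l3u zpk_zassoc_sq [RHS]vcA zpk_idh.
rewrite snd_hid fst_hid (fst_hid (C := Z) (D := Z)) (snd_hid (C := Z) (D := Z)) !zh_hid.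
exact: (assoc_cell_hid (fst (fst X)) (snd (fst X)) (snd X)).
Qed.

Lemma zassoc_sq_hcomp (X X' X'' : ob (prodc (prodc Z Z) Z)) (f : hom X X') (g : hom X' X'') :
  (zassoc_sq f <|> zassoc_sq g) </> pf_comp (tens3r bx) f g ~= pf_comp (tens3l bx) f g </> zassoc_sq (f >> g).
Proof.
apply: zeq; rewrite !zpk_v zpk_h zpk_r3c zpk_l3c !zpk_zassoc_sq [RHS]vcA.
rewrite snd_h fst_h (fst_h (C := Z) (D := Z)) (snd_h (C := Z) (D := Z)) !zh_h.
exact: (assoc_cell_comp (zh (fst (fst f))) (zh (fst (fst g))) (zh (snd (fst f))) (zh (snd (fst g))) (zh (snd f)) (zh (snd g))).
Qed.

Lemma zpkB (A A' A1 A1' : ob Z) (t : hom A A') (b : hom A1 A1') (l : ver A A1) (r : ver A' A1') (s : sq t b l r) :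
  (top (zpk s) = zh t) * (bot (zpk s) = zh b).
Proof. by rewrite /zpk !pkB. Qed.

Lemma zassoc_sq_nat (X X' X1 X1' : ob (prodc (prodc Z Z) Z)) (t : hom X X') (b : hom X1 X1')
   (l : ver X X1) (r : ver X' X1') (x : sq t b l r) :
  zassoc_sq t </> pf_s (tens3r bx) x ~= pf_s (tens3l bx) x </> zassoc_sq b.
Proof.
apply: zeq; rewrite !zpk_v zpk_r3s zpk_l3s !zpk_zassoc_sq.
by have := assoc_cell_nat (zpk (fst (fst x))) (zpk (snd (fst x))) (zpk (snd x)); rewrite !zpkB.
Qed.

Definition zassoc : isvtrans (tens3l bx) (tens3r bx) zal :=
  strict_isvtrans zal_sw r3_v zassoc_sq_inv zassoc_sq_hid zassoc_sq_hcomp zassoc_sq_nat.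

Lemma zla_sw (X X' : ob Z) (u : ver X X') :
  zla X // pf_v (pfid Z) u = pf_v (tens_l bx I) u // zla X'.
Proof.
apply: zv_eq; apply: (etrans (la_sw (zv u))).
by rewrite /= /boxv pf_vid vid_l.
Qed.

Lemma zra_sw (X X' : ob Z) (u : ver X X') :
  zra X // pf_v (pfid Z) u = pf_v (tens_r bx I) u // zra X'.
Proof.
apply: zv_eq; apply: (etrans (ra_sw (zv u))).
by rewrite /= /boxv pf_vid vid_r.
Qed.

Lemma zlam_sq_inv (X X' : ob Z) (f : hom X X') : vinvertible (zlam_sq f).
Proof. by apply: ziso; rewrite zpk_zlam_sq; exact: ciso_lunit_cell. Qed.

Lemma zrho_sq_inv (X X' : ob Z) (f : hom X X') : vinvertible (zrho_sq f).
Proof. by apply: ziso; rewrite zpk_zrho_sq; exact: ciso_runit_cell. Qed.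

Lemma zlam_sq_hid (X : ob Z) : sq_hid (zla X) </> pf_unit (pfid Z) X ~= pf_unit (tens_l bx I) X </> zlam_sq (hid X).
Proof.
apply: zeq; rewrite !zpk_v zpk_lu zpk_zlam_sq zpk_hid.
apply: (etrans _ (lunit_cell_hid X)); by rewrite vc1r.
Qed.

Lemma zrho_sq_hid (X : ob Z) : sq_hid (zra X) </> pf_unit (pfid Z) X ~= pf_unit (tens_r bx I) X </> zrho_sq (hid X).
Proof.
apply: zeq; rewrite !zpk_v zpk_ru zpk_zrho_sq zpk_hid.
apply: (etrans _ (runit_cell_hid X)); by rewrite vc1r.
Qed.

Lemma zlam_sq_hcomp (X X' X'' : ob Z) (f : hom X X') (g : hom X' X'') :
  (zlam_sq f <|> zlam_sq g) </> pf_comp (pfid Z) f g ~= pf_comp (tens_l bx I) f g </> zlam_sq (f >> g).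
Proof.
apply: zeq; rewrite !zpk_v zpk_h zpk_lc !zpk_zlam_sq zpk_vid.
apply: (etrans _ (lunit_cell_comp (zh f) (zh g))); by rewrite vc1r.
Qed.

Lemma zrho_sq_hcomp (X X' X'' : ob Z) (f : hom X X') (g : hom X' X'') :
  (zrho_sq f <|> zrho_sq g) </> pf_comp (pfid Z) f g ~= pf_comp (tens_r bx I) f g </> zrho_sq (f >> g).
Proof.
apply: zeq; rewrite !zpk_v zpk_h zpk_rc !zpk_zrho_sq zpk_vid.
apply: (etrans _ (runit_cell_comp (zh f) (zh g))); by rewrite vc1r.
Qed.

Lemma zlam_sq_nat (X X' X1 X1' : ob Z) (t : hom X X') (b : hom X1 X1')
   (l : ver X X1) (r : ver X' X1') (x : sq t b l r) :
  zlam_sq t </> pf_s (pfid Z) x ~= pf_s (tens_l bx I) x </> zlam_sq b.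
Proof.
apply: zeq; rewrite !zpk_v !zpk_zlam_sq.
have e : zpk (pf_s (tens_l bx I) x) = boxs (idv (hid I)) (zpk x) by exact: zpk_boxs.
rewrite e; have := lunit_cell_nat (zpk x); rewrite !zpkB; exact.
Qed.

Lemma zrho_sq_nat (X X' X1 X1' : ob Z) (t : hom X X') (b : hom X1 X1')
   (l : ver X X1) (r : ver X' X1') (x : sq t b l r) :
  zrho_sq t </> pf_s (pfid Z) x ~= pf_s (tens_r bx I) x </> zrho_sq b.
Proof.
apply: zeq; rewrite !zpk_v !zpk_zrho_sq.
have e : zpk (pf_s (tens_r bx I) x) = boxs (zpk x) (idv (hid I)) by exact: zpk_boxs.
rewrite e; have := runit_cell_nat (zpk x); rewrite !zpkB; exact.
Qed.

Definition zlam : isvtrans (tens_l bx I) (pfid Z) zla :=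
  strict_isvtrans zla_sw (fun _ _ _ _ _ => erefl) zlam_sq_inv zlam_sq_hid zlam_sq_hcomp zlam_sq_nat.
Definition zrho : isvtrans (tens_r bx I) (pfid Z) zra :=
  strict_isvtrans zra_sw (fun _ _ _ _ _ => erefl) zrho_sq_inv zrho_sq_hid zrho_sq_hcomp zrho_sq_nat.

(** * The monoidal structure *)

Lemma zpk_ts (A B0 A1 B1 A' B' A1' B1' : ob Z)
    (t : hom A B0) (b : hom A1 B1) (l : ver A A1) (r : ver B0 B1)
    (t' : hom A' B') (b' : hom A1' B1') (l' : ver A' A1') (r' : ver B' B1')
    (x : sq t b l r) (y : sq t' b' l' r') : zpk (ts bx x y) = boxs (zpk x) (zpk y).
Proof. exact: (zpk_boxs (A := (A, A')) (A' := (B0, B')) (A1 := (A1, A1')) (A1' := (B1, B1')) (t := (t, t')) (b := (b, b')) (l := (l, l')) (r := (r, r')) (x, y)). Qed.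

Lemma zpk_a3 (X X' Y Y' T T' : ob Z) (f : hom X X') (g : hom Y Y') (h : hom T T') :
  zpk (@vt_sq _ _ _ _ _ _ _ zassoc (X, Y, T) (X', Y', T') (f, g, h)) = assoc_cell (zh f) (zh g) (zh h).
Proof. exact: (zpk_zassoc_sq (X := (X, Y, T)) (X' := (X', Y', T')) (f, g, h)). Qed.

Lemma zpk_lam (X X' : ob Z) (f : hom X X') : zpk (vt_sq zlam f) = lunit_cell (zh f).
Proof. exact: zpk_zlam_sq. Qed.

Lemma zpk_rho (X X' : ob Z) (f : hom X X') : zpk (vt_sq zrho f) = runit_cell (zh f).
Proof. exact: zpk_zrho_sq. Qed.

Lemma zh_th (X X' Y Y' : ob Z) (f : hom X X') (g : hom Y Y') : zh (th bx f g) = boxh (zh f) (zh g).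
Proof. exact: erefl. Qed.

Lemma box_monoidal : inhabited (@monoidal Z (@box0 B P) bx).
Proof.
constructor.
refine (@Monoidal Z (@box0 B P) bx box_pf (pm_I P) zal zla zra zassoc zlam zrho _ _ _ _ _ _ _ _).
(* On 1v-cells, [boxv] with an identity adds only a factor [pf_v _ (vid _)], which is an identity;
   what remains is the pentagon of the base. The vertical unit triangles reduce in the same way. *)
- move=> X Y T V; apply: zv_eq.
  apply: (etrans _ (pentagon P X Y T V)).
  by rewrite /= !pf_vid vid_l vid_r.
- move=> X X' Y Y' T T' V V' f g h k; apply: zeq; rewrite !zpk_v !zpk_ts !zpk_a3 !zpk_idv !zh_th vcA.
  exact: assoc_cell_pentagon.
- move=> X Y; apply: zv_eq; apply: (etrans _ (etrans (unit_m P X Y) _)).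
    by rewrite /= pf_vid vid_l.
  by rewrite /= pf_vid vid_r.
- move=> X X' Y Y' f g; apply: zeq; rewrite !zpk_v !zpk_ts !zpk_a3 zpk_lam zpk_rho !zpk_idv zh_hid.
  exact: assoc_cell_unit_m.
- move=> X Y; apply: zv_eq; apply: (etrans (unit_l P X Y) _).
  by rewrite /= pf_vid vid_r.
- move=> X X' Y Y' f g; apply: zeq; rewrite !zpk_v !zpk_ts !zpk_a3 !zpk_lam !zpk_idv !zh_th zh_hid.
  exact: assoc_cell_unit_l.
- move=> X Y; apply: zv_eq; apply: (etrans _ (unit_r P X Y)).
  by rewrite /= pf_vid vid_l.
- move=> X X' Y Y' f g; apply: zeq; rewrite !zpk_v !zpk_ts !zpk_a3 !zpk_rho !zpk_idv !zh_th zh_hid.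
  exact: assoc_cell_unit_r.
Qed.

End PC.

Theorem theorem9p3 (B : double_cat) (P : pc_premonoidal B) (triv : trivial_vv P) :
  inhabited (@monoidal (pure_center P) (@box0 B P) (boxr P)).
Proof. exact: (box_monoidal triv). Qed.
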